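(* The following decision problem is strongly NP-complete, even when restricted to instances in which $G$ is a directed planar graph and $s$ and $t$ lie on the boundary of a common face: given a directed graph $G=(V,E)$ with capacity function $w:E\to\mathbb{Z}_{\ge 0}$, transport cost function $c:E\to\mathbb{Z}_{\ge 0}$, an integer budget $B>0$, two distinct vertices $s,t\in V$, and an integer $k\ge 0$, decide whether $\alpha_B^E(G,s,t)>k$.
   Context: For a directed graph $H$ with nonnegative edge capacities and vertices $s,t$, $\alpha(H,s,t)$ is the value of a maximum $s$-$t$ flow in $H$ (taken to be $0$ if $s$ or $t$ is not a vertex of $H$). For $I\subseteq E$, $G[I]$ denotes the subgraph of $G$ induced by the edge set $I$ (its edges are $I$ and its vertices are the endpoints of edges in $I$), with capacities inherited from $w$. The Budget-Constrained Flow Improvement Problem asks for $I\subseteq E$ with $c(I)=\sum_{e\in I}c(e)\le B$ maximizing $\alpha(G[I],s,t)$; $\alpha_B^E(G,s,t)$ denotes this optimal value. Strongly NP-complete means NP-complete even when all numbers in the input are bounded by a polynomial in the input size (equivalently, encoded in unary). *)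

(* Defs.v *)
(* MathComp / MathComp-Analysis. *)
From mathcomp Require Import all_boot all_order all_algebra all_fingroup.
From mathcomp Require Import reals.
Set Implicit Arguments.
Unset Strict Implicit.
Unset Printing Implicit Defensive.
Import Order.TTheory GRing.Theory Num.Theory.

(** * Multi-tape Turing machines *)

(* [None] is the blank; every alphabet contains the two input bits. *)
Definition symbol (G : finType) : finType := option (bool + G)%type.

Inductive direction := Left | Stay | Right.

(* Tapes 0 and 1 serve for input and output, the other ones are work tapes.
   The domain of the transition function is a finite type, so that it is a
   finite table. *)
Record machine := Machine {
  work_tapes : nat;
  extra_symbol : finType;
  state : finType;
  start : state;
  halting : pred state;
  accepting : pred state;
  transition : state -> {ffun 'I_work_tapes.+2 -> symbol extra_symbol} ->
    state * ('I_work_tapes.+2 -> symbol extra_symbol * direction)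
}.

(* A tape is infinite to the right only. It is given by a finite prefix, all
   cells beyond it being blank, and by the position of the head. *)
Definition tape (M : machine) : Type :=
  (seq (symbol (extra_symbol M)) * nat)%type.

Definition cell (M : machine) (u : tape M) (i : nat) : symbol (extra_symbol M) :=
  nth None u.1 i.

(* Moving left from cell 0 has no effect. *)
Definition move (d : direction) (h : nat) : nat :=
  match d with Left => h.-1 | Stay => h | Right => h.+1 end.

Definition write (M : machine) (u : tape M)
    (a : symbol (extra_symbol M) * direction) : tape M :=
  (set_nth None u.1 u.2 a.1, move a.2 u.2).

Definition config (M : machine) : Type :=
  (state M * ('I_(work_tapes M).+2 -> tape M))%type.

Definition step (M : machine) (c : config M) : config M :=
  if halting c.1 then c else
  let r := transition c.1 [ffun j => cell (c.2 j) (c.2 j).2] in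
  (r.1, fun j => write (c.2 j) (r.2 j)).

Definition bits_on_tape (M : machine) (x : seq bool) :
    seq (symbol (extra_symbol M)) :=
  [seq Some (inl b) | b <- x].

Definition initial (M : machine) (x y : seq bool) : config M :=
  (start M, fun j : 'I_(work_tapes M).+2 => (bits_on_tape M (nth [::] [:: x; y] j), 0%N)).

Definition run (M : machine) (n : nat) (x y : seq bool) : config M :=
  iter n (@step M) (initial M x y).

(* Tape 1 contains [z] followed by blanks only. *)
Definition has_output (M : machine) (c : config M) (z : seq bool) : Prop :=
  forall i, cell (c.2 (Ordinal (isT : 1 < (work_tapes M).+2))) i =
            nth None (bits_on_tape M z) i.

(** * Polynomial time, NP, strong NP-completeness *)

Definition polytime_function (f : seq bool -> seq bool) : Prop :=
  exists (M : machine) (p : {poly nat}), forall x : seq bool,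
    let c := run M p.[size x]%R x [::] in
    halting c.1 /\ has_output c (f x).

Definition polytime_relation (V : seq bool -> seq bool -> bool) : Prop :=
  exists (M : machine) (p : {poly nat}), forall x y : seq bool,
    let c := run M p.[size x + size y]%R x y in
    halting c.1 /\ accepting c.1 = V x y.

Definition language := seq bool -> Prop.

Definition NP (L : language) : Prop :=
  exists (V : seq bool -> seq bool -> bool) (q : {poly nat}),
    polytime_relation V /\
    forall x, L x <-> exists2 y : seq bool, size y <= q.[size x]%R & V x y.

(* [is_instance] delimits the instances of the problem, [largest_number] is the
   largest numerical parameter occurring in an instance. *)
Record decision_problem := DecisionProblem {
  raw_instance : Type;
  encoding : raw_instance -> seq bool;
  largest_number : raw_instance -> nat;
  is_instance : raw_instance -> Prop;
  is_yes : raw_instance -> Prop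
}.

Definition restrict (P : decision_problem) (D : raw_instance P -> Prop) :
    decision_problem :=
  {| raw_instance := raw_instance P;
     encoding := @encoding P;
     largest_number := @largest_number P;
     is_instance := fun I => is_instance I /\ D I;
     is_yes := @is_yes P |}.

Definition yes_language (P : decision_problem) : language :=
  fun x => exists I : raw_instance P,
    [/\ is_instance I, is_yes I & encoding I = x].

(* The reduction maps every string to the encoding of an instance, including
   when the answer is negative. *)
Definition reduces_to (L : language) (P : decision_problem) : Prop :=
  exists2 f : seq bool -> seq bool, polytime_function f &
    forall x, exists I : raw_instance P,
      [/\ is_instance I, encoding I = f x & L x <-> is_yes I].

Definition NP_complete (P : decision_problem) : Prop :=
  NP (yes_language P) /\ forall L : language, NP L -> reduces_to L P.

Definition strongly_NP_complete (P : decision_problem) : Prop :=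
  NP_complete P /\
  exists p : {poly nat},
    NP_complete (restrict (fun I : raw_instance P =>
      largest_number I <= p.[size (encoding I)]%R)).

(** * Directed graphs and maximum flows *)

Record digraph := Digraph {
  nb_vertices : nat;
  nb_edges : nat;
  edge_tail : 'I_nb_edges -> 'I_nb_vertices;
  edge_head : 'I_nb_edges -> 'I_nb_vertices
}.

Notation vertex G := 'I_(nb_vertices G).
Notation edge G := 'I_(nb_edges G).

(* No two edges are parallel: the edge set is a subset of V * V. *)
Definition simple (G : digraph) : Prop :=
  injective (fun e : edge G => (edge_tail e, edge_head e)).

Record subgraph (G : digraph) := Subgraph {
  sub_vertices : {set vertex G};
  sub_edges : {set edge G}
}.

Definition edge_induced (G : digraph) (I : {set edge G}) : subgraph G :=
  {| sub_vertices := [set edge_tail e | e in I] :|: [set edge_head e | e in I];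
     sub_edges := I |}.

Section Flow.
Local Open Scope ring_scope.

Definition outflow (R : realType) (G : digraph) (H : subgraph G)
    (f : edge G -> R) (v : vertex G) : R :=
  \sum_(e in sub_edges H | edge_tail e == v) f e.

Definition inflow (R : realType) (G : digraph) (H : subgraph G)
    (f : edge G -> R) (v : vertex G) : R :=
  \sum_(e in sub_edges H | edge_head e == v) f e.

(* Only the values of [f] on the edges of [H] are relevant. *)
Definition is_flow (R : realType) (G : digraph) (w : edge G -> nat)
    (H : subgraph G) (s t : vertex G) (f : edge G -> R) : Prop :=
  (forall e, e \in sub_edges H -> 0 <= f e <= (w e)%:R) /\
  (forall v, v \in sub_vertices H -> v != s -> v != t ->
     inflow H f v = outflow H f v).

Definition flow_value (R : realType) (G : digraph) (H : subgraph G)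
    (s : vertex G) (f : edge G -> R) : R :=
  outflow H f s - inflow H f s.

(* The supremum is a maximum: the flows on [H] form a nonempty polytope. *)
Definition max_flow (R : realType) (G : digraph) (w : edge G -> nat)
    (H : subgraph G) (s t : vertex G) : R :=
  if (s \in sub_vertices H) && (t \in sub_vertices H) then
    sup (fun x : R => exists2 f, is_flow w H s t f & flow_value H s f = x)
  else 0.

(* The edge sets within the budget include the empty one, and maximum flow
   values are nonnegative, so that the default value 0 is harmless. *)
Definition budget_max_flow (R : realType) (G : digraph)
    (w c : edge G -> nat) (B : nat) (s t : vertex G) : R :=
  \big[Num.max/0]_(I : {set edge G} | (\sum_(e in I) c e <= B)%N)
    max_flow R w (edge_induced I) s t.

End Flow.

(** * Planarity *)

(* The two darts of an edge [e] are its ends: [(e, false)] is attached to the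
   tail of [e] and [(e, true)] to its head. *)
Notation dart G := (edge G * bool)%type.

Definition dart_vertex (G : digraph) (d : dart G) : vertex G :=
  if d.2 then edge_head d.1 else edge_tail d.1.

Definition flip (G : digraph) (d : dart G) : dart G := (d.1, ~~ d.2).

(* The cycles of [rot] are the cyclic orders of the darts around the
   (non-isolated) vertices. *)
Definition rotation_system (G : digraph) (rot : {perm dart G}) : Prop :=
  forall d d' : dart G,
    fconnect rot d d' = (dart_vertex d == dart_vertex d').

(* The orbits of [face_step rot] are the boundary walks of the faces. *)
Definition face_step (G : digraph) (rot : {perm dart G}) (d : dart G) : dart G :=
  rot (flip d).

Definition dart_link (G : digraph) (rot : {perm dart G}) : rel (dart G) :=
  fun d d' => (rot d == d') || (flip d == d').

(* Every component is embedded in the sphere: Euler's formula V + F = E + 2,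
   summed over the components that have an edge. As V + F <= E + 2 holds for
   each of them, equality of the sums is equality everywhere. *)
Definition planar_rotation (G : digraph) (rot : {perm dart G}) : Prop :=
  rotation_system rot /\
  fcard rot predT + fcard (face_step rot) predT =
    nb_edges G + (n_comp (dart_link rot) predT).*2.

Definition adjacent (G : digraph) : rel (vertex G) :=
  fun u v => [exists d : dart G, (dart_vertex d == u) && (dart_vertex (flip d) == v)].

(* A rotation system leaves free the relative position of the components: any
   face of one of them may be placed inside any face of another one. Hence two
   vertices in different components can always be put on a common face. *)
Definition on_common_face (G : digraph) (rot : {perm dart G})
    (s t : vertex G) : Prop :=
  connect (@adjacent G) s t ->
  exists d d' : dart G, [/\ dart_vertex d = s, dart_vertex d' = t &
    fconnect (face_step rot) d d'].

Definition planar_with_common_face (G : digraph) (s t : vertex G) : Prop :=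
  exists rot : {perm dart G}, planar_rotation rot /\ on_common_face rot s t.

(** * The budget-constrained flow improvement problem *)

Record flow_instance := FlowInstance {
  graph : digraph;
  capacity : edge graph -> nat;
  cost : edge graph -> nat;
  budget : nat;
  source : vertex graph;
  sink : vertex graph;
  threshold : nat
}.

(* Little-endian binary digits, without leading zero (none for 0). *)
Definition binary_digits (n : nat) : seq bool :=
  [seq odd (n %/ 2 ^ i) | i <- iota 0 (up_log 2 n.+1)].

(* Self-delimiting: each digit is preceded by [true], and [false] ends. *)
Definition encode_binary (n : nat) : seq bool :=
  flatten [seq [:: true; b] | b <- binary_digits n] ++ [:: false].

Definition encode_unary (n : nat) : seq bool := nseq n true ++ [:: false].

(* Adjacency list. The numbers of vertices and of edges are in unary, since
   they count towards the size of a graph; all other numbers are in binary. *)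
Definition encode_instance (X : flow_instance) : seq bool :=
  encode_unary (nb_vertices (graph X)) ++
  encode_unary (nb_edges (graph X)) ++
  flatten [seq encode_binary (edge_tail e) ++ encode_binary (edge_head e) ++
               encode_binary (capacity e) ++ encode_binary (cost e)
          | e <- enum (edge (graph X))] ++
  encode_binary (budget X) ++
  encode_binary (source X) ++ encode_binary (sink X) ++
  encode_binary (threshold X).

Definition max_number (X : flow_instance) : nat :=
  maxn (maxn (\max_(e : edge (graph X)) capacity e)
             (\max_(e : edge (graph X)) cost e))
       (maxn (budget X) (threshold X)).

Definition flow_improvement (R : realType) : decision_problem :=
  {| raw_instance := flow_instance;
     encoding := encode_instance;
     largest_number := max_number;
     is_instance := fun X =>
       [/\ simple (graph X), 0 < budget X & source X <> sink X];
     is_yes := fun X =>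
       ((threshold X)%:R <
        budget_max_flow R (@capacity X) (@cost X) (budget X)
          (source X) (sink X))%R |}.

Definition planar_instance (X : flow_instance) : Prop :=
  planar_with_common_face (source X) (sink X).

(* Main.v *)
(* Hardness. The acceptance of an input is a system of local constraints on the
   squares of a computation table. With one clause for every combination of
   values that a constraint excludes, it becomes a hitting set problem: choose N
   of Q lanes such that each of M sets A_j contains a chosen lane. In a planar
   grid, the lanes are the rows between a top row and a bottom row, and the sets
   are columns. The budget pays for N lanes. To reach the required value, each of
   them has to carry 2 units of flow, and M further units have to go from the top
   row to the bottom row. The column A_j has to be crossed by one such unit, from
   its left side, which gives no access to the bottom row, to its right side, to
   which the top row gives no access. This is possible only on a lane that is paid
   for and that has capacity 3 inside the column, which means that it belongs to
   A_j. All numbers are polynomial in the number of vertices.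

   Membership. Maximum flows may be taken integral, sums of binary numbers are
   compared through their carries, and planarity is certified by a rotation system
   with a representative for every vertex, face and component. *)

(* Polynomial time means an explicit multi-tape machine. All algorithms are therefore written in the
   language [expr], whose values fit in unary counters, and compiled once. A word is described by
   its length and its bits, a number of exponential size by its digits, and [ECarry] adds such
   numbers. In the grid, parity does the work. Paid lanes carry exactly 2 units in every gap, so the
   flow below a given row changes by an odd amount from one gap to the next; as it changes only
   through two sides of capacity 1, it grows by exactly one unit. Hence the same lanes are used in
   all gaps. A gap edge costs [N * M + 1], more than the [N * M] left for edges inside the sets, so
   that savings inside the sets never buy another gap edge. The rows are joined end to end into a
   helix: a vertex is one number, its neighbours differ from it by 1 or by the circumference, and
   planarity becomes arithmetic on labels. One reduction and one verifier with two switches serve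
   all four NP-completeness claims, with or without planarity and with or without bounded
   numbers. *)
Require Import Defs.
From mathcomp Require Import all_boot all_order all_fingroup all_algebra.
From mathcomp Require Import boolp reals.
From mathcomp Require Import zify lra.
Set Implicit Arguments.
Unset Strict Implicit.
Unset Printing Implicit Defensive.

(** * Programs for Turing machines *)

(* A work tape contains one symbol, in cell 0, so that it serves as a counter,
   whose value is the position of its head. *)
Inductive instr :=
  IMove of nat & direction | IEmit of bool | IJump of nat & option bool & nat | IGoto of nat.

Definition store : Type := ((nat -> nat) * seq bool)%type.

Definition upd (f : nat -> nat) (k v : nat) : nat -> nat :=
  fun j => if j == k then v else f j.

Section Abstract.
Variable x : seq bool.

(** The default of [nth] is the constant content of the work tapes: a counter is zero exactly when
    its head scans [Some true]. *)
Definition content (out : seq bool) (t : nat) : seq bool :=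
  nth [:: true] [:: x; out] t.

Definition scan (s : store) (t : nat) : option bool :=
  nth None (map Some (content s.2 t)) (s.1 t).

Definition move_head (s : store) (t : nat) (d : direction) : store :=
  (upd s.1 t (move d (s.1 t)), s.2).

Definition emit (s : store) (b : bool) : store :=
  (upd s.1 1 (s.1 1).+1, rcons s.2 b).

(** [IEmit] has a meaning only when the output head stands right after the word, so that writing one
    cell amounts to [rcons]. *)
Inductive astep (code : seq instr) : nat * store -> nat * store -> Prop :=
| astep_move i s t d : i < size code -> nth (IGoto 0) code i = IMove t d ->
    astep code (i, s) (i.+1, move_head s t d)
| astep_emit i s b : i < size code -> nth (IGoto 0) code i = IEmit b ->
    s.1 1 = size s.2 -> astep code (i, s) (i.+1, emit s b)
| astep_jump i s t a l : i < size code -> nth (IGoto 0) code i = IJump t a l ->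
    astep code (i, s) (if scan s t == a then l else i.+1, s)
| astep_goto i s l : i < size code -> nth (IGoto 0) code i = IGoto l ->
    astep code (i, s) (l, s).

Inductive aexec (code : seq instr) : nat -> nat * store -> nat * store -> Prop :=
| aexec0 a : aexec code 0 a a
| aexecS n a b c : astep code a b -> aexec code n b c -> aexec code n.+1 a c.

Lemma aexec_trans code n m a b c :
  aexec code n a b -> aexec code m b c -> aexec code (n + m) a c.
Proof. by elim=> // {}n {}a a' b' st _ IH /IH; rewrite addSn; apply: aexecS. Qed.

Lemma aexec1 code a b : astep code a b -> aexec code 1 a b.
Proof. by move=> h; apply: aexecS h _; apply: aexec0. Qed.

Inductive cmd :=
| Skip | Mv of nat & direction | Emit of bool | Seq of cmd & cmd
| If of nat & option bool & cmd & cmd | Until of nat & option bool & cmd.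

Fixpoint len (c : cmd) : nat :=
  match c with
  | Skip => 0 | Mv _ _ => 1 | Emit _ => 1 | Seq c1 c2 => len c1 + len c2
  | If _ _ c1 c2 => (len c2 + len c1).+2 | Until _ _ c => (len c).+2
  end.

(** Jumps are absolute, hence the offset [o]. In a conditional the second branch is placed first and
    ends with a jump over the other one; this is why [bs_if_false] counts two additional steps and
    [bs_if_true] one. *)
Fixpoint assemble (o : nat) (c : cmd) : seq instr :=
  match c with
  | Skip => [::]
  | Mv t d => [:: IMove t d]
  | Emit b => [:: IEmit b]
  | Seq c1 c2 => assemble o c1 ++ assemble (o + len c1) c2
  | If t a c1 c2 =>
      IJump t a (o + len c2).+2 ::
        assemble o.+1 c2 ++
        IGoto (o + (len c2 + len c1).+2) :: assemble (o + len c2).+2 c1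
  | Until t a c =>
      IJump t a (o + (len c).+2) :: rcons (assemble o.+1 c) (IGoto o)
  end.

Lemma size_assemble o c : size (assemble o c) = len c.
Proof.
elim: c o => //= [c1 IH1 c2 IH2|t a c1 IH1 c2 IH2|t a c IH] o.
- by rewrite size_cat IH1 IH2.
- by rewrite size_cat /= IH1 IH2 addnS.
- by rewrite size_rcons IH.
Qed.

Inductive bigstep : cmd -> store -> nat -> store -> Prop :=
| bs_skip s : bigstep Skip s 0 s
| bs_mv t d s : bigstep (Mv t d) s 1 (move_head s t d)
| bs_emit b s : s.1 1 = size s.2 -> bigstep (Emit b) s 1 (emit s b)
| bs_seq c1 c2 s m1 s1 m2 s2 : bigstep c1 s m1 s1 -> bigstep c2 s1 m2 s2 ->
    bigstep (Seq c1 c2) s (m1 + m2) s2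
| bs_if_true t a c1 c2 s m s' : scan s t = a -> bigstep c1 s m s' ->
    bigstep (If t a c1 c2) s m.+1 s'
| bs_if_false t a c1 c2 s m s' : scan s t <> a -> bigstep c2 s m s' ->
    bigstep (If t a c1 c2) s m.+2 s'
| bs_until_stop t a c s : scan s t = a -> bigstep (Until t a c) s 1 s
| bs_until_loop t a c s m s' m' s'' : scan s t <> a -> bigstep c s m s' ->
    bigstep (Until t a c) s' m' s'' -> bigstep (Until t a c) s (m + m').+2 s''.

Definition code_at (code : seq instr) (o : nat) (sub : seq instr) : Prop :=
  exists pre post, code = pre ++ sub ++ post /\ size pre = o.

Lemma code_at_cat code o u v :
  code_at code o (u ++ v) -> code_at code o u /\ code_at code (o + size u) v.
Proof.
move=> [pre [post [-> <-]]]; split.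
  by exists pre, (v ++ post); rewrite -catA.
by exists (pre ++ u), post; rewrite size_cat -!catA.
Qed.

Lemma code_at_cons code o i v :
  code_at code o (i :: v) ->
  [/\ o < size code, nth (IGoto 0) code o = i & code_at code o.+1 v].
Proof.
move=> h; have [[pre [post [e1 e2]]] h2] := code_at_cat (u := [:: i]) h.
split; last by rewrite addn1 in h2.
  by rewrite e1 size_cat /= e2; lia.
by rewrite e1 nth_cat -e2 ltnn subnn.
Qed.

Lemma assemble_ok c s m s' : bigstep c s m s' ->
  forall code o, code_at code o (assemble o c) ->
  aexec code m (o, s) (o + len c, s').
Proof.
elim=> {c s m s'}.
- by move=> s code o _; rewrite addn0; apply: aexec0.
- move=> t d s code o /code_at_cons[lt e _]; rewrite addn1; apply: aexec1.
  exact: astep_move.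
- move=> b s hs code o /code_at_cons[lt e _]; rewrite addn1; apply: aexec1.
  exact: astep_emit.
- move=> c1 c2 s m1 s1 m2 s2 _ IH1 _ IH2 code o /= /code_at_cat.
  rewrite size_assemble => -[/IH1 h1 /IH2 h2].
  by rewrite addnA; apply: aexec_trans h1 h2.
- move=> t a c1 c2 s m s' hs _ IH code o /= /code_at_cons[lt e h].
  have /code_at_cat [_] := h; rewrite size_assemble => /code_at_cons [_ _ h1].
  apply: aexecS (astep_jump s lt e) _; rewrite hs eqxx.
  have := IH code _ h1.
  by rewrite -addSn; congr aexec; congr pair; lia.
- move=> t a c1 c2 s m s' hs _ IH code o /= /code_at_cons[lt e h].
  have /code_at_cat [h2] := h; rewrite size_assemble => /code_at_cons [lt' e' _].
  apply: aexecS (astep_jump s lt e) _; rewrite (introF eqP hs).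
  rewrite -addn1; apply: aexec_trans (IH _ _ h2) (aexec1 _).
  exact: astep_goto.
- move=> t a c s hs code o /= /code_at_cons[lt e h].
  by apply: aexec1; have := astep_jump s lt e; rewrite hs eqxx.
- move=> t a c s m s' m' s'' hs _ IH1 _ IH2 code o /= hc.
  have [lt e h] := code_at_cons hc; rewrite -cats1 in h.
  have [h1] := code_at_cat h; rewrite size_assemble => /code_at_cons [lt' e' _].
  apply: aexecS (astep_jump s lt e) _; rewrite (introF eqP hs).
  rewrite -addnS; apply: aexec_trans (IH1 _ _ h1) _.
  by apply: aexecS (astep_goto _ lt' e') (IH2 _ _ hc).
Qed.

End Abstract.

(** * Simulation of programs by a machine *)

Definition tape_of (i : instr) : nat := if i is IJump t _ _ then t else 0.

(** Only tested tapes have to exist: moving the head of a missing tape changes nothing that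
    [represents] speaks of. *)
Definition asm_tapes (code : seq instr) : nat := \max_(i <- code) tape_of i.

(** The state [None] is a preliminary step that writes the symbol in cell 0 of all work tapes; the
    other states are program counters. *)
Definition asm_transition (code : seq instr) (n : nat)
    (st : option 'I_(size code).+2)
    (rd : {ffun 'I_n.+2 -> symbol unit}) :
    option 'I_(size code).+2 * ('I_n.+2 -> symbol unit * direction) :=
  if st isn't Some i then
    (Some (inord 0), fun j : 'I_n.+2 => (if j < 2 then rd j else Some (inl true), Stay))
  else match nth (IGoto 0) code i with
  | IMove t d =>
      (Some (inord i.+1), fun j : 'I_n.+2 => (rd j, if j == t :> nat then d else Stay))
  | IEmit b =>
      (Some (inord i.+1),
       fun j : 'I_n.+2 => if j == 1 :> nat then (Some (inl b), Right) else (rd j, Stay))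
  | IJump t a l =>
      (Some (inord (if [exists j : 'I_n.+2, (j == t :> nat) &&
                        (rd j == omap inl a :> symbol unit)]
                    then l else i.+1)), fun j : 'I_n.+2 => (rd j, Stay))
  | IGoto l => (Some (inord l), fun j : 'I_n.+2 => (rd j, Stay))
  end.

(** There are two addresses beyond the code: reaching [size code] means acceptance, reaching its
    successor means rejection. *)
Definition asm_machine (code : seq instr) : machine :=
  {| work_tapes := asm_tapes code; extra_symbol := unit;
     state := option 'I_(size code).+2; start := None;
     halting := fun st => if st is Some i then size code <= i else false;
     accepting := fun st => if st is Some i then size code == i else false;
     transition := @asm_transition code (asm_tapes code) |}.

Section Simulation.
Variables (code : seq instr) (x : seq bool).
Let M := asm_machine code.

Definition represents (c : config M) (a : nat * store) : Prop :=
  [/\ c.1 = Some (inord a.1),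
      forall j i, cell (c.2 j) i = nth None (bits_on_tape M (content x a.2.2 j)) i
    & forall j, (c.2 j).2 = a.2.1 j].

Lemma nth_bits (s : seq bool) i :
  nth None (bits_on_tape M s) i =
  omap (fun b => inl b) (nth None (map Some s) i).
Proof.
rewrite /bits_on_tape; elim: s i => [|b s IH] [|i] //=.
Qed.

Lemma cell_write (u : tape M) a i :
  cell (write u a) i = if i == u.2 then a.1 else cell u i.
Proof. by rewrite /cell /write /= nth_set_nth. Qed.

Lemma represents_step c a b : astep x code a b -> represents c a ->
  represents (step c) b.
Proof.
move=> st [e1 e2 e3].
have key : forall i, i = a.1 -> i < size code ->
    (val (inord i : 'I_(size code).+2) = i) /\ step c =
    ((transition c.1 [ffun j => cell (c.2 j) (c.2 j).2]).1,
     fun j => write (c.2 j) ((transition c.1 [ffun j => cell (c.2 j) (c.2 j).2]).2 j)).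
  move=> i ei lt; have iv : val (inord i : 'I_(size code).+2) = i.
    by rewrite /= inordK //; lia.
  by split=> //; rewrite /step e1 /= -ei iv leqNgt lt.
case: st e1 e2 e3 key => [i s t d lt en|i s b' lt en|i s t a' l lt en|i s l lt en].
- move=> e1 e2 e3 key; have [iv ->] := key i erefl lt.
  rewrite e1 /= /asm_transition iv en /=; split=> //= j => [k|].
    by rewrite cell_write /= ffunE; case: eqP => [->|_]; rewrite e2.
  rewrite /upd e3; case: eqP => [->|_] //=.
- move=> hs e1 e2 e3 key; have [iv ->] := key i erefl lt.
  rewrite e1 /= /asm_transition iv en /=; split=> //= j => [k|].
    rewrite cell_write /=; case: eqP => [->|hk] /=.
      case: eqP => [ej|hj] /=; rewrite ?ffunE ?e2 ?e3 ?nth_bits ?ej /=.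
        by rewrite hs /content /= map_rcons nth_rcons size_map ltnn eqxx.
      congr omap; congr nth; rewrite /content; congr map.
      by case: (nat_of_ord j) hj => [|[|]].
    rewrite e2 !nth_bits; case: (nat_of_ord j =P 1) => [ej|hj].
      rewrite /= ej.
      rewrite /content /= map_rcons nth_rcons size_map.
      case: ltnP => // h; rewrite nth_default ?size_map //.
      case: eqP => // ek; case: hk.
      by rewrite e3 /= ej hs.
    by rewrite /content; case: (nat_of_ord j) hj => [|[|]].
  by rewrite /upd; case: eqP => [ej|_] /=; rewrite e3 /= ?ej.
- move=> e1 e2 e3 key; have [iv ->] := key i erefl lt.
  rewrite e1 /= /asm_transition iv en /=; split=> /= [|j k|j].
  + congr (Some (inord _)).
    have ht : t < (asm_tapes code).+2.
      suff: t <= asm_tapes code by lia.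
      rewrite -[t]/(tape_of (IJump t a' l)) -en /asm_tapes.
      by rewrite (big_nth (IGoto 0)) big_mkord (leq_bigmax (Ordinal lt)).
    have -> : [exists j : 'I__, (val j == t) &&
       ([ffun j => cell (c.2 j) (c.2 j).2] j == omap inl a' :> symbol unit)] =
       (scan x s t == a').
      apply/existsP/eqP => [[j /andP[/eqP ej /eqP]]|es].
        rewrite ffunE e2 e3 nth_bits /= ej /scan.
        by case: nth => [b1|]; case: (a') => [b2|] //= [->].
      exists (Ordinal ht); rewrite eqxx ffunE e2 e3 nth_bits /=.
      by rewrite -es eqxx.
    by [].
  + by rewrite cell_write /= ffunE; case: eqP => [->|_]; rewrite e2.
  + by rewrite e3.
- move=> e1 e2 e3 key; have [iv ->] := key i erefl lt.
  rewrite e1 /= /asm_transition iv en /=; split=> //= j k.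
  by rewrite cell_write /= ffunE; case: eqP => [->|_]; rewrite e2.
Qed.

Lemma represents_exec n c a b : aexec x code n a b -> represents c a ->
  represents (iter n (@step M) c) b.
Proof.
move=> h; elim: h c => {n a b} // n a a' b st _ IH c hc.
by rewrite iterSr; apply: IH; apply: represents_step hc.
Qed.

Lemma represents_init y :
  represents (run M 1 x y) (0, ((fun=> 0), y)).
Proof.
rewrite /run /= /step /=; split=> //= j i.
  rewrite cell_write /=; case: j => -[|[|j]] hj /=; rewrite ?ffunE //=.
  - by case: eqP => [->|].
  - by case: eqP => [->|].
  by rewrite /cell /content /= !nth_nil; case: i => //= i; rewrite !nth_nil.
Qed.

Lemma run_exec n y b : aexec x code n (0, ((fun=> 0), y)) b ->
  represents (run M n.+1 x y) b.
Proof.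
by move=> h; rewrite /run iterSr; apply: represents_exec h (represents_init y).
Qed.

Lemma run_halt n m y b : aexec x code n (0, ((fun=> 0), y)) b ->
  size code <= b.1 <= (size code).+1 -> n < m ->
  represents (run M m x y) b.
Proof.
move=> /run_exec h hb lt; rewrite -(subnK lt) /run iterD.
elim: (m - n.+1) => // k IH; rewrite iterS /step.
case: IH => e1 e2 e3; rewrite e1 /= inordK ?ltnS ?(andP hb).2 // (andP hb).1.
by split.
Qed.

End Simulation.

(** * A language of polynomial-time computable functions *)

(* The two input words and the values of the variables, as de Bruijn indices. *)
Definition env : Type := ((seq bool * seq bool) * seq nat)%type.

Definition push (i : nat) (r : env) : env := (r.1, i :: r.2).

(* The carry into position [n] in a sum whose digits add up to [g 0], [g 1], ... *)
Fixpoint carry (g : nat -> nat) (n : nat) : nat :=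
  if n is n'.+1 then (carry g n' + g n')./2 else 0.

Definition bsum (n : nat) (f : nat -> nat) : nat := \sum_(i < n) f i.

(* The values are polynomially bounded in the numbers of the environment and the
   lengths of the words; exponentially large numbers given by their digits are
   added by means of [ECarry]. *)
Inductive expr :=
| EVar of nat | EConst of nat | ESize | EX of expr | EY of expr
| EAdd of expr & expr | ESub of expr & expr | ESum of expr & expr
| ECarry of expr & expr.

Fixpoint eval (e : expr) (r : env) : nat :=
  match e with
  | EVar j => nth 0 r.2 j
  | EConst c => c
  | ESize => size r.1.1
  | EX e => nth false r.1.1 (eval e r)
  | EY e => nth false r.1.2 (eval e r)
  | EAdd e1 e2 => eval e1 r + eval e2 r
  | ESub e1 e2 => eval e1 r - eval e2 r
  | ESum e1 e2 => bsum (eval e1 r) (fun i => eval e2 (push i r))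
  | ECarry e1 e2 => carry (fun i => eval e2 (push i r)) (eval e1 r)
  end.

(** * Compilation of expressions, with bounds on values and running time *)

Definition seqs (cs : seq cmd) : cmd := foldr Seq Skip cs.
Definition moves (rs : seq nat) (d : direction) : cmd := seqs [seq Mv r d | r <- rs].
Definition loop (r : nat) (c : cmd) : cmd := Until r (Some true) c.
(* Adds register [r] to the registers [us], subtracts it from the registers
   [ds], and clears it. *)
Definition transfer (r : nat) (us ds : seq nat) : cmd :=
  loop r (Seq (Mv r Left) (Seq (moves us Right) (moves ds Left))).
(** A counter is read by counting it down, hence the detour through [f], from which [r] is
    restored. *)
Definition copy (r d f : nat) : cmd :=
  Seq (transfer r [:: d; f] [::]) (transfer f [:: r] [::]).
Definition halve (a b : nat) : cmd :=
  loop a (Seq (Mv a Left)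
    (If a (Some true) Skip (Seq (Mv a Left) (Mv b Right)))).
(** The head of tape [t] is itself used as a counter: it is advanced by the value of [f], the bit
    under it is tested, and the copy in [f.+1] brings it back. Positions are thus relative to the
    place where the head stood. *)
Definition probe (t d f : nat) : cmd :=
  seqs [:: transfer f [:: f.+1; t] [::];
           If t (Some true) (Mv d Right) Skip;
           transfer f.+1 [::] [:: t]].

(* [compile e rs d f] adds the value of [e] to register [d]; the variables are
   in the registers [rs], and the registers from [f] on are free. *)
Fixpoint compile (e : expr) (rs : seq nat) (d f : nat) : cmd :=
  match e with
  | EVar j => if j < size rs then copy (nth 0 rs j) d f else Skip
  | EConst c => seqs (nseq c (Mv d Right))
  | ESize => copy 2 d f
  | EX e => Seq (compile e rs f f.+2) (probe 0 d f)
  | EY e => Seq (compile e rs f f.+2) (probe 1 d f)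
  | EAdd e1 e2 => Seq (compile e1 rs d f) (compile e2 rs d f)
  | ESub e1 e2 =>
      seqs [:: compile e1 rs f f.+2; compile e2 rs f.+1 f.+2;
               transfer f.+1 [::] [:: f]; transfer f [:: d] [::]]
  | ESum e1 e2 =>
      seqs [:: compile e1 rs f f.+2;
               loop f (seqs [:: Mv f Left; compile e2 (f.+1 :: rs) d f.+2;
                                Mv f.+1 Right]);
               transfer f.+1 [::] [::]]
  | ECarry e1 e2 =>
      seqs [:: compile e1 rs f f.+4;
               loop f (seqs [:: Mv f Left; compile e2 (f.+1 :: rs) f.+2 f.+4;
                                halve f.+2 f.+3; transfer f.+3 [:: f.+2] [::];
                                Mv f.+1 Right]);
               transfer f.+1 [::] [::]; transfer f.+2 [:: d] [::]]
  end.

Fixpoint vbound (e : expr) (B : nat) : nat :=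
  match e with
  | EVar _ => B | EConst c => c | ESize => B | EX _ => 1 | EY _ => 1
  | EAdd e1 e2 => vbound e1 B + vbound e2 B
  | ESub e1 e2 => vbound e1 B
  | ESum e1 e2 => vbound e1 B * vbound e2 (B + vbound e1 B)
  | ECarry e1 e2 => vbound e2 (B + vbound e1 B)
  end.

(** A [transfer] that touches [k] other registers takes [k + 3] steps per unit and one last test.
    The factor 9 is the 5 for going forth and the 4 for coming back in [copy] and [probe]. *)
Fixpoint tbound (e : expr) (B : nat) : nat :=
  match e with
  | EVar _ => B * 9 + 2 | EConst c => c | ESize => B * 9 + 2
  | EX e => tbound e B + (vbound e B * 9 + 5)
  | EY e => tbound e B + (vbound e B * 9 + 5)
  | EAdd e1 e2 => tbound e1 B + tbound e2 B
  | ESub e1 e2 => tbound e1 B + tbound e2 B + vbound e2 B * 4 + vbound e1 B * 4 + 2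
  | ESum e1 e2 =>
      tbound e1 B + vbound e1 B * (tbound e2 (B + vbound e1 B) + 7) + 2
  | ECarry e1 e2 =>
      tbound e1 B + vbound e1 B * (tbound e2 (B + vbound e1 B) +
        vbound e2 (B + vbound e1 B) * 16 + 20) + vbound e2 (B + vbound e1 B) * 4 + 3
  end.

(** A carry and a digit that are both at most [b] have a half-sum of at most [b]. Carries therefore
    do not grow with the number of digits, which allows sums of exponential size to be handled with
    unary counters. *)
Lemma carry_le g n b : (forall i, i < n -> g i <= b) -> carry g n <= b.
Proof.
elim: n => //= n IH h; have := IH (fun i hi => h i (ltnW hi)).
by have := h n (ltnSn n); lia.
Qed.

Lemma bsum_le n f b : (forall i, i < n -> f i <= b) -> bsum n f <= n * b.
Proof.
move=> h; rewrite /bsum -[n in n * b]card_ord -sum_nat_const.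
by apply: leq_sum => i _; apply: h.
Qed.

Lemma vboundP e r B : all (leq^~ B) r.2 -> size r.1.1 <= B -> eval e r <= vbound e B.
Proof.
elim: e r B => //= [j|e _|e _|e1 IH1 e2 IH2|e1 IH1 e2 IH2|e1 IH1 e2 IH2|
  e1 IH1 e2 IH2] r B hr hx.
- case: (ltnP j (size r.2)) => h; last by rewrite nth_default.
  exact: (allP hr) _ (mem_nth 0 h).
- exact: leq_b1.
- exact: leq_b1.
- by apply: leq_add; [exact: IH1|exact: IH2].
- by apply: leq_trans (leq_subr _ _) _; exact: IH1.
- have h1 := IH1 _ _ hr hx; apply: (@leq_trans (eval e1 r * vbound e2 (B + vbound e1 B))).
    apply: bsum_le => i hi; apply: IH2 => /=; last lia.
    by rewrite (leq_trans (ltnW hi)) ?(leq_trans h1) ?leq_addl //=; apply: sub_all hr => k; lia.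
  by rewrite leq_mul2r h1 orbT.
- have h1 := IH1 _ _ hr hx; apply: carry_le => i hi; apply: IH2 => /=; last lia.
  by rewrite (leq_trans (ltnW hi)) ?(leq_trans h1) ?leq_addl //=; apply: sub_all hr => k; lia.
Qed.

Definition transferred (p : nat -> nat) (r : nat) (us ds : seq nat) (n j : nat) : nat :=
  if j == r then p j - n else if j \in us then p j + n
  else if j \in ds then p j - n else p j.

(** The registers after [k] rounds of [halve]. The last round on an odd number only removes the
    remaining unit, hence the minimum. *)
Definition halved (p : nat -> nat) a b k :=
  upd (upd p b (p b + minn k (p a)./2)) a (p a - k.*2).

Ltac updlia :=
  repeat match goal with
  | H : forall _, _ |- _ => clear H | H : is_true (all _ _) |- _ => clear H
  | H : is_true (_ \notin _) |- _ => clear H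
  end;
  rewrite ?/transferred ?/halved ?/upd ?inE /= ?inE /= ?inE /=;
  repeat (case: eqP => ? /=; try (exfalso; lia)); subst; try lia; try congruence.

Lemma nth_map_Some (s : seq bool) i :
  (nth None (map Some s) i == Some true) = nth false s i.
Proof. by elim: s i => [|b s IH] [|i] //=; case: b. Qed.

Section Compile.
Variable x : seq bool.

Definition runs (c : cmd) (s : store) (m : nat) (s' : store) : Prop :=
  exists2 m', m' <= m & bigstep x c s m' s'.

Lemma runs_skip s : runs Skip s 0 s.
Proof. by exists 0 => //; apply: bs_skip. Qed.

Lemma runs_mv t d s : runs (Mv t d) s 1 (move_head s t d).
Proof. by exists 1 => //; apply: bs_mv. Qed.

Lemma runs_seq c1 c2 s m1 s1 m2 s2 m :
  runs c1 s m1 s1 -> runs c2 s1 m2 s2 -> m1 + m2 <= m -> runs (Seq c1 c2) s m s2.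
Proof.
move=> [m1' l1 h1] [m2' l2 h2] l; exists (m1' + m2'); first lia.
exact: bs_seq h1 h2.
Qed.

Lemma runs_le c s m s' m2 s2 : runs c s m s' -> m <= m2 -> s' = s2 -> runs c s m2 s2.
Proof. by move=> [k l h] l2 <-; exists k => //; lia. Qed.

Lemma runs_seqs c cs s m1 s1 m2 s2 m :
  runs c s m1 s1 -> runs (seqs cs) s1 m2 s2 -> m1 + m2 <= m ->
  runs (seqs (c :: cs)) s m s2.
Proof. exact: runs_seq. Qed.

Lemma scan_work s r : 1 < r -> (scan x s r == Some true) = (s.1 r == 0).
Proof.
case: r => // -[|r] // _; rewrite /scan /content /= nth_nil.
by case: (s.1 r.+2) => // n; rewrite /= nth_nil.
Qed.

Lemma runs_until t a c n (S : nat -> store) m :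
  (forall k, k < n -> scan x (S k) t <> a /\ runs c (S k) m (S k.+1)) ->
  scan x (S n) t = a -> runs (Until t a c) (S 0) (n * (m + 2)).+1 (S n).
Proof.
move=> h h0; elim: n => [|n IH] in S h h0 *.
  by exists 1; [lia|apply: bs_until_stop].
have [k hk hb] := IH (fun k => S k.+1) (fun k hk => h k.+1 hk) h0.
have [hz [k' hk' hb']] := h 0 isT.
by exists (k' + k).+2; [lia|apply: bs_until_loop hb' hb].
Qed.

Lemma runs_loop r c n (S : nat -> store) m :
  1 < r -> (forall k, k < n -> (S k).1 r <> 0 /\ runs c (S k) m (S k.+1)) ->
  (S n).1 r = 0 -> runs (loop r c) (S 0) (n * (m + 2)).+1 (S n).
Proof.
move=> hr h h0; apply: runs_until; last by apply/eqP; rewrite scan_work // h0.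
move=> k /h [h1 h2]; split=> //; apply/eqP; rewrite scan_work //; exact/eqP.
Qed.

Lemma runs_moves rs d (p : nat -> nat) out : uniq rs ->
  runs (moves rs d) (p, out) (size rs)
    (fun j => if j \in rs then move d (p j) else p j, out).
Proof.
elim: rs p => [|r rs IH] p /=; first by move=> _; exact: runs_skip.
move=> /andP[nr ur].
refine (runs_seqs (runs_mv _ _ _) (m2 := size rs) _ _) => //.
apply: runs_le (IH _ ur) (leqnn _) _.
congr pair; apply: funext => j; rewrite inE /upd /=.
by case: eqP => [->|]; rewrite ?(negbTE nr).
Qed.

Lemma runs_transfer r us ds p out m : 1 < r -> uniq (r :: us ++ ds) ->
  p r * (size us + size ds + 3) < m ->
  runs (transfer r us ds) (p, out) m (transferred p r us ds (p r), out).
Proof.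
move=> hr; rewrite /= cat_uniq mem_cat negb_or => /and4P[/andP[nu nd] uu dis ud] hm.
have dis' j : j \in us -> (j \in ds) = false.
  by move=> hj; apply: contraNF dis => hd; apply/hasP; exists j.
have := @runs_loop r (Seq (Mv r Left) (Seq (moves us Right) (moves ds Left)))
  (p r) (fun k => (transferred p r us ds k, out)) (size us + size ds + 1) hr.
have -> : transferred p r us ds 0 = p.
  apply: funext => j; rewrite /transferred; case: eqP => [->|_].
    by rewrite subn0.
  by rewrite subn0 addn0 !if_same.
move=> h; apply: runs_le (h _ _) _ erefl.
- move=> k hk /=; split; first by rewrite /transferred eqxx; lia.
  refine (runs_seq (runs_mv _ _ _) (m2 := size us + size ds) _ _); last lia.
  refine (runs_seq (runs_moves _ _ _ uu) (m2 := size ds) _ _); last by [].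
  apply: runs_le (runs_moves _ _ _ ud) (leqnn _) _.
  congr pair; apply: funext => j; rewrite /upd /transferred /=.
  case: (eqVneq j r) => [->|_]; first by rewrite !eqxx (negbTE nu) (negbTE nd) subnS.
  case: (boolP (j \in us)) => [hj|_]; first by rewrite dis' //= addnS.
  by case: (boolP (j \in ds)) => hd; rewrite ?subnS.
- by rewrite /transferred /= eqxx subnn.
- lia.
Qed.

Lemma runs_halve a b p out : 1 < a -> 1 < b -> a != b ->
  runs (halve a b) (p, out) (p a * 6 + 7)
    (upd (upd p b (p b + (p a)./2)) a 0, out).
Proof.
move=> ha hb ab.
have := @runs_loop a (Seq (Mv a Left)
    (If a (Some true) Skip (Seq (Mv a Left) (Mv b Right))))
  (uphalf (p a)) (fun k => (halved p a b k, out)) 5 ha.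
have -> : halved p a b 0 = p.
  apply: funext => j; rewrite /halved /upd min0n addn0 subn0.
  by do !case: eqP => [->|] //.
move=> h; apply: runs_le (h _ _) _ _.
- move=> k hk /=; split; first by rewrite /halved /upd eqxx; lia.
  refine (runs_seq (runs_mv _ _ _) (m2 := 4) _ _) => //.
  case: (eqVneq (p a - k.*2) 1) => e1.
    exists 1 => //; apply: bs_if_true.
      by apply/eqP; rewrite scan_work //= /halved /upd eqxx e1.
    have -> : (halved p a b k.+1, out) =
      move_head (halved p a b k, out) a Left; last exact: bs_skip.
    congr pair; apply: funext => j; rewrite /halved /upd /= eqxx.
    by do !case: eqP => //= _; lia.
  exists 4 => //; apply: bs_if_false.
    by apply/eqP; rewrite scan_work //= /halved /upd eqxx; lia.
  have -> : (halved p a b k.+1, out) = move_head (move_head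
      (move_head (halved p a b k, out) a Left) a Left) b Right.
    congr pair; apply: funext => j; rewrite /=; updlia.
  by apply: (@bs_seq _ _ _ _ 1 _ 1); apply: bs_mv.
- by rewrite /halved /upd /= eqxx; lia.
- lia.
- congr pair; apply: funext => j; rewrite /halved /upd /=.
  by do !case: eqP => //= _; lia.
Qed.

Lemma map_upd (p : nat -> nat) d v rs : d \notin rs -> map (upd p d v) rs = map p rs.
Proof.
move=> hd; apply/eq_in_map => r hr; rewrite /upd; case: eqP => // e.
by rewrite -e hr in hd.
Qed.

Lemma runs_copy r d f p out : 1 < r -> 1 < f -> r != d -> r != f -> d != f ->
  p f = 0 -> runs (copy r d f) (p, out) (p r * 9 + 2) (upd p d (p d + p r), out).
Proof.
move=> hr hf rd rf df pf.
refine (runs_seq (m1 := (p r * 5).+1) (m2 := (p r * 4).+1) (runs_transfer _ hr _ _) _ _);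
  rewrite /= ?inE ?rf ?rd ?df //; try lia.
apply: runs_le (runs_transfer (m := (p r * 4).+1) _ hf _ _) (leqnn _) _;
  rewrite /= ?inE 1?eq_sym ?rf //.
- by rewrite /transferred !inE [f == r]eq_sym (negbTE rf) eqxx orbT pf.
- congr pair; apply: funext => j; updlia.
Qed.

(** Tape 1 as seen from its head. For a relation the head is at the start of the second input word.
    For a function it is at the end of the output written so far, where only blanks follow, so that
    the second word reads as empty. *)
Definition views (p : nat -> nat) (out : seq bool) (y : seq bool) : Prop :=
  [/\ p 0 = 0, p 2 = size x &
    forall i, (nth None (map Some out) (p 1 + i) == Some true) = nth false y i].

Lemma views_eq {p p' out y} : views p out y -> p' 0 = p 0 -> p' 1 = p 1 ->
  p' 2 = p 2 -> views p' out y.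
Proof. by case=> h1 h2 h3 e0 e1 e2; split; rewrite ?e0 ?e1 ?e2. Qed.

Lemma runs_probe (t d f v : nat) (b : bool) p out m : t < 2 -> 2 < d < f -> p f = v ->
  p f.+1 = 0 -> (nth None (map Some (content x out t)) (p t + v) == Some true) = b ->
  v * 9 + 5 <= m ->
  runs (probe t d f) (p, out) m (upd (upd p f 0) d (p d + b), out).
Proof.
move=> ht hdf pf pf1 hb hm.
have [ft f1t f1f] : [/\ f == t = false, f.+1 == t = false & (f.+1 == f) = false].
  by split; apply/eqP; lia.
have [df df1 dt] : [/\ d == f = false, d == f.+1 = false & d == t = false].
  by split; apply/eqP; lia.
refine (runs_seqs (m1 := (v * 5).+1) (m2 := v * 4 + 4) (runs_transfer _ _ _ _) _ _);
  rewrite ?pf /= ?inE ?negb_or ?f1t ?f1f ?ft //; try lia.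
set p1 := transferred _ _ _ _ _.
have p1t : p1 t = p t + v.
  by rewrite /p1 /transferred !inE eq_sym ft eqxx orbT.
have p1d : p1 d = p d by rewrite /p1 /transferred !inE df df1 dt.
have p1f1 : p1 f.+1 = v by rewrite /p1 /transferred !inE f1f eqxx pf1.
refine (runs_seq (m1 := 3) (m2 := (v * 4).+1) (s1 := (upd p1 d (p d + b), out)) _ _ _);
  last lia.
  case: b hb => hb.
    exists 2 => //; apply: bs_if_true; first by apply/eqP; rewrite /scan /= p1t hb.
    have -> : (upd p1 d (p d + true), out) = move_head (p1, out) d Right.
      by rewrite /move_head /= p1d addn1.
    exact: bs_mv.
  exists 2 => //; apply: bs_if_false; first by apply/eqP; rewrite /scan /= p1t hb.
  have -> : (upd p1 d (p d + false), out) = (p1, out); last exact: bs_skip.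
  congr pair; apply: funext => j; rewrite /upd addn0; case: eqP => // ->.
  by rewrite p1d.
have e : upd p1 d (p d + b) f.+1 = v by rewrite /upd eq_sym df1.
refine (runs_seq (m1 := (v * 4).+1) (m2 := 0) (runs_transfer _ _ _ _) _ _);
  rewrite ?e /= ?inE ?negb_or ?f1t //; try lia.
apply: runs_le (runs_skip _) (leqnn _) _.
congr pair; apply: funext => j; rewrite /p1; updlia.
Qed.

(** Induction on [e]. The final register file is the initial one except at [d]: all temporaries from
    [f] on are zero again, so that commands compose without a further invariant. A single [B] bounds
    the variables and the length of [x]. *)
Lemma compile_ok y e : forall rs d f p out B,
  all (fun r => 2 < r < f) rs -> 2 < d < f -> d \notin rs ->
  (forall r, f <= r -> p r = 0) -> views p out y ->
  all (leq^~ B) (map p rs) -> size x <= B ->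
  runs (compile e rs d f) (p, out) (tbound e B)
    (upd p d (p d + eval e (x, y, map p rs)), out).
Proof.
elim: e => /= [j|c||e IH|e IH|e1 IH1 e2 IH2|e1 IH1 e2 IH2|e1 IH1 e2 IH2|e1 IH1 e2 IH2]
  rs d f p out B hrs hd hdrs hf hv hB hx;
  have rs_in (r : nat) : r \in rs -> 2 < r < f by move/(allP hrs).
- case: ifP => [hj|hj]; last first.
    apply: runs_le (runs_skip _) (leq0n _) _; congr pair; apply: funext => i.
    rewrite nth_default ?size_map; last by rewrite leqNgt hj.
    by updlia.
  have hr : nth 0 rs j \in rs by apply: mem_nth.
  have h1 : 2 < nth 0 rs j < f by exact: rs_in hr.
  have h2 : nth 0 rs j != d by apply: contraNneq hdrs => <-.
  rewrite (nth_map 0) //.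
  apply: runs_le (runs_copy _ _ _ _ _ _ (hf f (leqnn f))) _ erefl; try lia.
  have /(allP hB) : p (nth 0 rs j) \in map p rs by apply: map_f.
  by lia.
- elim: c p {hf hv hB} => [|c IH] p /=.
    by apply: runs_le (runs_skip _) (leq0n _) _; congr pair; apply: funext => i; updlia.
  refine (runs_seq (m1 := 1) (m2 := c) (runs_mv _ _ _) _ _) => //.
  apply: runs_le (IH _) (leqnn _) _; congr pair; apply: funext => i; updlia.
- have [_ e2 _] := hv; rewrite -e2.
  apply: runs_le (runs_copy _ _ _ _ _ _ (hf f (leqnn f))) _ erefl; try lia.
- refine (runs_seq (IH rs f f.+2 p out B _ _ _ _ hv hB hx) _ (leqnn _)).
  + by apply: sub_all hrs => r; lia.
  + lia.
  + by apply: contraT => /negPn /rs_in; lia.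
  + by move=> r hr; apply: hf; lia.
  have hv' := @vboundP e (x, y, map p rs) B hB hx.
  set v := eval _ _ in hv' *; have [e0 e2 _] := hv.
  have -> : upd p d (p d + nth false x v) =
     upd (upd (upd p f (p f + v)) f 0) d (upd p f (p f + v) d + nth false x v).
    by apply: funext => j; have := hf f (leqnn _); updlia.
  apply: (runs_probe (v := v)) => //.
  + by rewrite /upd eqxx hf.
  + by have := hf f.+1 (leqnSn _); updlia.
  + have -> : upd p f (p f + v) 0 = 0 by updlia.
    by rewrite /content /= nth_map_Some.
  + lia.
- refine (runs_seq (IH rs f f.+2 p out B _ _ _ _ hv hB hx) _ (leqnn _)).
  + by apply: sub_all hrs => r; lia.
  + lia.
  + by apply: contraT => /negPn /rs_in; lia.
  + by move=> r hr; apply: hf; lia.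
  have hv' := @vboundP e (x, y, map p rs) B hB hx.
  set v := eval _ _ in hv' *; have [_ e2 e1] := hv.
  have -> : upd p d (p d + nth false y v) =
     upd (upd (upd p f (p f + v)) f 0) d (upd p f (p f + v) d + nth false y v).
    by apply: funext => j; have := hf f (leqnn _); updlia.
  apply: (runs_probe (v := v)) => //.
  + by rewrite /upd eqxx hf.
  + by have := hf f.+1 (leqnSn _); updlia.
  + have -> : upd p f (p f + v) 1 = p 1 by updlia.
    by rewrite -e1.
  + lia.
- refine (runs_seq (IH1 rs d f p out B _ _ _ _ hv hB hx)
    (runs_le (IH2 rs d f _ out B _ _ _ _ _ _ hx) (leqnn _) _) (leqnn _)) => //.
  + by move=> r hr; have := hf r hr; updlia.
  + by refine (views_eq hv _ _ _); updlia.
  + by rewrite map_upd.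
  + by rewrite map_upd //; congr pair; apply: funext => j; updlia.
- have hrs2 : all (fun r => 2 < r < f.+2) rs by apply: sub_all hrs => r; lia.
  have v1 := @vboundP e1 (x, y, map p rs) B hB hx.
  have v2 := @vboundP e2 (x, y, map p rs) B hB hx.
  have nf : f \notin rs by apply: contraT => /negPn /rs_in; lia.
  have nf1 : f.+1 \notin rs by apply: contraT => /negPn /rs_in; lia.
  refine (runs_seq (IH1 rs f f.+2 p out B _ _ _ _ hv hB hx) (m2 := tbound e2 B +
    (vbound e2 B * 4 + vbound e1 B * 4 + 2)) _ _) => //; try lia.
    by move=> r hr; apply: hf; lia.
  set p1 := upd p f _.
  refine (runs_seq (IH2 rs f.+1 f.+2 p1 out B _ _ _ _ _ _ hx) (m2 := vbound e2 B * 4 + vbound e1 B * 4 + 2) _ _) => //; try lia.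
  + by move=> r hr; have := hf r; rewrite /p1; updlia.
  + by refine (views_eq hv _ _ _); rewrite /p1; updlia.
  + by rewrite map_upd.
  rewrite {2}/p1 map_upd //; set p2 := upd p1 f.+1 _.
  have e2f : p2 f.+1 = eval e2 (x, y, map p rs).
    by rewrite /p2 /p1; have := hf f.+1; updlia.
  have e1f : p2 f = eval e1 (x, y, map p rs).
    by rewrite /p2 /p1; have := hf f; updlia.
  refine (runs_seq (m1 := vbound e2 B * 4 + 1) (m2 := vbound e1 B * 4 + 1) (runs_transfer _ _ _ _) _ _);
    rewrite ?e2f /= ?inE; try lia.
  set p3 := transferred _ _ _ _ _.
  have e3f : p3 f <= eval e1 (x, y, map p rs).
    by rewrite -e1f /p3; updlia.
  refine (runs_seq (m1 := vbound e1 B * 4 + 1) (m2 := 0) (runs_transfer _ _ _ _) _ _);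
    rewrite /= ?inE; try lia.
  apply: runs_le (runs_skip _) (leqnn _) _; congr pair; apply: funext => j.
  by have := hf f; have := hf f.+1; rewrite /p3 /p2 /p1; updlia.
- have hrs2 : all (fun r => 2 < r < f.+2) rs by apply: sub_all hrs => r; lia.
  have v1 := @vboundP e1 (x, y, map p rs) B hB hx.
  have nf : f \notin rs by apply: contraT => /negPn /rs_in; lia.
  have nf1 : f.+1 \notin rs by apply: contraT => /negPn /rs_in; lia.
  set V1 := vbound e1 B; set T2 := tbound e2 (B + V1).
  refine (runs_seq (IH1 rs f f.+2 p out B _ _ _ _ hv hB hx) (m2 := V1 * (T2 + 7) + 2) _ _) => //; try lia.
    by move=> r hr; apply: hf; lia.
  set n := eval e1 _ in v1 *; set g := fun i => eval e2 (push i (x, y, map p rs)).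
  (* Loop invariant: [f] counts the terms that remain and [f.+1] is the summation index. *)
  pose S k := (upd (upd (upd p d (p d + bsum k g)) f (n - k)) f.+1 k, out).
  have -> : (upd p f (p f + n), out) = S 0.
    congr pair; apply: funext => j; have := hf f; have := hf f.+1.
    by rewrite /bsum big_ord0; updlia.
  refine (runs_seq (m1 := (n * (T2 + 2 + 2)).+1) (m2 := n * 3 + 1)
    (runs_loop (n := n) (m := T2 + 2) _ _ _) _ _) => //=; try lia; last 2 first.
  + refine (runs_seq (m1 := n * 3 + 1) (m2 := 0) (runs_transfer _ _ _ _) _ _);
      rewrite /= ?inE ?/upd ?eqxx //; try lia.
    apply: runs_le (runs_skip _) (leqnn _) _; congr pair; apply: funext => j.
    by have := hf f; have := hf f.+1; updlia.
  + have : n * (T2 + 7) <= V1 * (T2 + 7) by rewrite leq_mul2r v1 orbT.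
    lia.
  + move=> k hk; split; first by rewrite /S /=; updlia.
    refine (runs_seq (m1 := 1) (m2 := T2 + 1) (runs_mv _ _ _) _ _) => //; last lia.
    refine (runs_seq (IH2 (f.+1 :: rs) d f.+2 _ out (B + V1) _ _ _ _ _ _ _) (m2 := 1) _ _);
      rewrite /= ?inE ?negb_or ?hrs2 ?hdrs //; try lia.
    * by move=> r hr; have := hf r; updlia.
    * by refine (views_eq hv _ _ _); updlia.
    * rewrite /= !map_upd // {1}/upd; apply/andP; split; first by updlia.
      by apply: sub_all hB => i; lia.
    refine (runs_seq (runs_mv _ _ _) (m2 := 0) _ _) => //.
    apply: runs_le (runs_skip _) (leqnn _) _; congr pair; apply: funext => j.
    rewrite /= !map_upd // /bsum big_ord_recr /=.
    set q0 := upd _ f.+1 k.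
    have -> : upd q0 f (q0 f).-1 f.+1 = k by rewrite /q0; updlia.
    by rewrite -/(g k) /q0; updlia.
  + by rewrite /S /=; updlia.
- have hrs4 : all (fun r => 2 < r < f.+4) rs by apply: sub_all hrs => r; lia.
  have v1 := @vboundP e1 (x, y, map p rs) B hB hx.
  have nf : f \notin rs by apply: contraT => /negPn /rs_in; lia.
  have nf1 : f.+1 \notin rs by apply: contraT => /negPn /rs_in; lia.
  have nf2 : f.+2 \notin rs by apply: contraT => /negPn /rs_in; lia.
  set V1 := vbound e1 B; set T2 := tbound e2 (B + V1); set V2 := vbound e2 (B + V1).
  refine (runs_seq (IH1 rs f f.+4 p out B _ _ _ _ hv hB hx)
    (m2 := V1 * (T2 + V2 * 16 + 20) + V2 * 4 + 3) _ _) => //; try lia.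
    by move=> r hr; apply: hf; lia.
  set n := eval e1 _ in v1 *; set g := fun i => eval e2 (push i (x, y, map p rs)).
  have hg k : k < n -> g k <= V2.
    move=> hk; apply: vboundP => /=; last lia.
    apply/andP; split; first lia.
    by apply: sub_all hB => i; lia.
  (* As for sums, with the current carry in [f.+2]; [d] is only changed after the loop. *)
  pose S k := (upd (upd (upd p f (n - k)) f.+1 k) f.+2 (carry g k), out).
  have -> : (upd p f (p f + n), out) = S 0.
    congr pair; apply: funext => j; have := hf f; have := hf f.+1; have := hf f.+2.
    by updlia.
  have hc : carry g n <= V2 by apply: carry_le.
  refine (runs_seq (m1 := (n * (T2 + V2 * 16 + 11 + 2)).+1) (m2 := n * 3 + V2 * 4 + 2)
    (runs_loop (n := n) (m := T2 + V2 * 16 + 11) _ _ _) _ _) => //=; try lia; last 2 first.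
  + refine (runs_seq (m1 := n * 3 + 1) (m2 := V2 * 4 + 1) (runs_transfer _ _ _ _) _ _);
      rewrite /= ?inE //; try lia.
      by updlia.
    set p1 := transferred _ _ _ _ _.
    have p1e : p1 f.+2 = carry g n by rewrite /p1; updlia.
    refine (runs_seq (m1 := V2 * 4 + 1) (m2 := 0) (runs_transfer _ _ _ _) _ _);
      rewrite /= ?inE ?p1e //; try lia.
    apply: runs_le (runs_skip _) (leqnn _) _; congr pair; apply: funext => j.
    by have := hf f; have := hf f.+1; have := hf f.+2; rewrite /p1; updlia.
  + have : n * (T2 + V2 * 16 + 20) <= V1 * (T2 + V2 * 16 + 20) by rewrite leq_mul2r v1 orbT.
    lia.
  + move=> k hk; split; first by rewrite /S /=; updlia.
    have hck : carry g k <= V2 by apply: carry_le => i hi; apply: hg; lia.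
    have hgk := hg k hk.
    refine (runs_seq (m1 := 1) (m2 := T2 + V2 * 16 + 10) (runs_mv _ _ _) _ _) => //; last lia.
    refine (runs_seq (IH2 (f.+1 :: rs) f.+2 f.+4 _ out (B + V1) _ _ _ _ _ _ _) (m2 := V2 * 16 + 10) _ _);
      rewrite /= ?inE ?negb_or ?hrs4 ?nf2 //; try lia.
    * by move=> r hr; have := hf r; updlia.
    * by refine (views_eq hv _ _ _); updlia.
    * rewrite /= !map_upd // {1}/upd; apply/andP; split; first by updlia.
      by apply: sub_all hB => i; lia.
    rewrite !map_upd //=.
    have -> : upd (upd (upd (upd p f (n - k)) f.+1 k) f.+2 (carry g k)) f
      (upd (upd (upd p f (n - k)) f.+1 k) f.+2 (carry g k) f).-1 f.+1 = k by updlia.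
    rewrite -/(g k).
    set p1 := upd _ f.+2 _.
    have e2f : p1 f.+2 = carry g k + g k by rewrite /p1; updlia.
    have e3f : p1 f.+3 = 0 by rewrite /p1; have := hf f.+3; updlia.
    have p1e : p1 = upd (upd (upd p f (n - k.+1)) f.+1 k) f.+2 (carry g k + g k).
      by apply: funext => j; rewrite /p1; updlia.
    refine (runs_seq (m1 := V2 * 12 + 7) (m2 := V2 * 4 + 3)
       (runs_le (runs_halve _ _ _ _ _) _ erefl) _ _); rewrite ?e2f; try lia.
    rewrite e3f add0n.
    refine (runs_seq (m1 := V2 * 4 + 1) (m2 := 2) (runs_transfer _ _ _ _) _ _);
      rewrite /= ?inE //; try lia.
      by updlia.
    refine (runs_seq (runs_mv _ _ _) (m2 := 0) _ _) => //.
    apply: runs_le (runs_skip _) (leqnn _) _; congr pair; apply: funext => j.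
    rewrite p1e -[carry g k.+1]/((carry g k + g k)./2).
    have {}hf := hf f.+3 (leq_addl 3 f); move: (carry g k + g k)./2 => c.
    clear -hf hk; rewrite /move_head /=; updlia.
  + by rewrite /S /=; updlia.
Qed.

End Compile.

(** * Polynomial bounds *)

Definition polybounded (f : nat -> nat) : Prop := exists k, forall n, f n <= n.+2 ^ k.

Lemma polybounded_le f g : polybounded g -> (forall n, f n <= g n) -> polybounded f.
Proof. by move=> [k h] l; exists k => n; apply: leq_trans (l n) (h n). Qed.

(** The base [n + 2] is at least 2 for every [n], so that some power of it exceeds any constant even
    at [n = 0]. *)
Lemma polybounded_const c : polybounded (fun=> c).
Proof.
exists c => n; apply: leq_trans (ltnW (ltn_expl c (ltnSn 1))) _.
by case: c => // c; rewrite leq_exp2r.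
Qed.

Lemma polybounded_id : polybounded id.
Proof. by exists 1 => n; rewrite expn1; lia. Qed.

Lemma polybounded_mul f g : polybounded f -> polybounded g ->
  polybounded (fun n => f n * g n).
Proof. by move=> [k h] [l h']; exists (k + l) => n; rewrite expnD leq_mul. Qed.

Lemma polybounded_add f g : polybounded f -> polybounded g ->
  polybounded (fun n => f n + g n).
Proof.
move=> [k h] [l h']; exists (k + l).+1 => n; rewrite expnS.
have a : f n <= n.+2 ^ (k + l).
  by apply: leq_trans (h n) _; rewrite leq_exp2l // leq_addr.
have b : g n <= n.+2 ^ (k + l).
  by apply: leq_trans (h' n) _; rewrite leq_exp2l // leq_addl.
nia.
Qed.

Lemma polybounded_comp f g : polybounded f -> polybounded g ->
  polybounded (fun n => f (g n)).
Proof.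
move=> hf [l hl]; have [m hm] : polybounded (fun n => (g n).+2).
  apply: polybounded_le (polybounded_add (ex_intro _ l hl) (polybounded_const 2)) _.
  by move=> n; rewrite addn2.
case: hf => k hk; exists (m * k) => n; apply: leq_trans (hk _) _.
by rewrite expnM; case: k {hk} => // k; rewrite leq_exp2r.
Qed.

Lemma polybounded_vbound e : polybounded (vbound e).
Proof.
elim: e => /= *; try exact: polybounded_const; try exact: polybounded_id.
- exact: polybounded_add.
- by [].
- apply: polybounded_mul => //; apply: polybounded_comp => //.
  by apply: polybounded_add => //; exact: polybounded_id.
- apply: polybounded_comp => //.
  by apply: polybounded_add => //; exact: polybounded_id.
Qed.

Lemma polybounded_tbound e : polybounded (tbound e).
Proof.
elim: e => /= *;
 repeat first [exact: polybounded_const | exact: polybounded_id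
  | exact: polybounded_vbound | assumption | apply: polybounded_add
  | apply: polybounded_mul
  | apply: (polybounded_comp (f := tbound _)) | apply: (polybounded_comp (f := vbound _)) ].
Qed.

(** * Machines for relations and functions given by expressions *)

Definition measure : cmd :=
  Seq (Until 0 None (seqs [:: Mv 2 Right; Mv 3 Right; Mv 0 Right]))
      (transfer 3 [::] [:: 0]).

Lemma scan_None x (p : nat -> nat) out : scan x (p, out) 0 = None <-> size x <= p 0.
Proof.
rewrite /scan /content /=; split=> [h|h].
  rewrite leqNgt; apply/negP => lt.
  by rewrite (nth_map false) in h.
by rewrite nth_default // size_map.
Qed.

Lemma runs_measure x out :
  runs x measure (fun=> 0, out) (size x * 9 + 2) (upd (fun=> 0) 2 (size x), out).
Proof.
pose S k : store := (upd (upd (upd (fun=> 0) 0 k) 2 k) 3 k, out).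
have -> : ((fun=> 0), out) = S 0 by congr pair; apply: funext => j; updlia.
refine (runs_seq (m1 := (size x * (3 + 2)).+1) (m2 := (size x * 4).+1) (runs_until (n := size x) (m := 3) _ _) _ _).
- move=> k hk; split; first by rewrite scan_None /S /upd /=; lia.
  refine (runs_seq (runs_mv _ _ _ _) (m2 := 2) _ _) => //.
  refine (runs_seq (runs_mv _ _ _ _) (m2 := 1) _ _) => //.
  refine (runs_seq (runs_mv _ _ _ _) (m2 := 0) _ _) => //.
  apply: runs_le (runs_skip _ _) (leqnn _) _; congr pair; apply: funext => j.
  by rewrite /S /=; updlia.
- by rewrite scan_None /S /upd.
- apply: runs_le (runs_transfer (m := (size x * 4).+1) _ _ _ _ _) _ _ => //.
  congr pair; apply: funext => j; updlia.
- lia.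
Qed.

Lemma views_start x out y p : p 0 = 0 -> p 2 = size x ->
  (y = out /\ p 1 = 0 \/ y = [::] /\ p 1 = size out) -> views x p out y.
Proof.
move=> h0 h2 h; split=> // i; case: h => -[-> ->].
  by rewrite add0n nth_map_Some.
by rewrite nth_map_Some nth_nil nth_default // leq_addr.
Qed.

Definition poly_of (k : nat) : {poly nat} := (('X + 2%:P) ^+ k)%R.

Lemma poly_ofE k n : (poly_of k).[n]%R = n.+2 ^ k.
Proof.
rewrite /poly_of !hornerE !natrE; congr (_ ^ _).
by rewrite -[LHS]/(n + 1 + 1) -addnA addn2.
Qed.

Lemma halting_asm code pc : pc <= (size code).+1 ->
  @halting (asm_machine code) (Some (inord pc)) = (size code <= pc).
Proof. by move=> h; rewrite /= inordK. Qed.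

Lemma accepting_asm code pc : pc <= (size code).+1 ->
  @accepting (asm_machine code) (Some (inord pc)) = (size code == pc).
Proof. by move=> h; rewrite /= inordK. Qed.

Theorem polytime_relation_eval (e : expr) :
  polytime_relation (fun x y => 0 < eval e (x, y, [::])).
Proof.
pose body := Seq measure (compile e [::] 3 4).
(* When register 3 is positive, the final test falls through to the accepting address [size code];
   when it is zero, the test jumps one further, to the rejecting address. *)
pose code := assemble 0 body ++ [:: IJump 3 (Some true) (len body).+2].
have [k hk] : polybounded (fun n => n * 9 + 2 + tbound e n + 3).
  by repeat first [exact: polybounded_const | exact: polybounded_id
  | exact: polybounded_tbound | apply: polybounded_add | apply: polybounded_mul].
exists (asm_machine code), (poly_of k) => x y; cbv zeta.
have sz : size code = (len body).+1 by rewrite size_cat size_assemble addn1.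
set v := eval e _.
have [m hm hb] : runs x body (fun=> 0, y) (size x * 9 + 2 + tbound e (size x))
    (upd (upd (fun=> 0) 2 (size x)) 3 v, y).
  refine (runs_seq (runs_measure x y) _ (leqnn _)).
  apply: runs_le (@compile_ok x y e [::] 3 4 _ y (size x) _ _ _ _ _ _ _) (leqnn _) _ => //.
    by move=> r hr; updlia.
  by apply: views_start; [..|left].
set s := (upd _ 3 v, y) in hb.
have h1 : aexec x code m (0, (fun=> 0, y)) (len body, s).
  by apply: (@assemble_ok x body _ m _ hb code 0); exists [::], [:: IJump 3 (Some true) (len body).+2].
have lt : len body < size code by rewrite sz.
have hj := astep_jump x s lt (_ : nth _ code _ = IJump 3 (Some true) (len body).+2).
have {hj} : aexec x code (m + 1) (0, (fun=> 0, y))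
    (if v == 0 then (len body).+2 else (len body).+1, s).
  apply: aexec_trans h1 _; apply: aexec1; rewrite -(_ : (scan x s 3 == Some true) = (v == 0)).
    by apply: hj; rewrite nth_cat size_assemble ltnn subnn.
  by rewrite scan_work.
move=> /run_halt h.
have /h {h} : size code <= (if v == 0 then (len body).+2 else (len body).+1) <= (size code).+1.
  by rewrite sz; case: eqP; lia.
(* The running time is bounded in terms of [x] alone, since [y] is only read at computed
   positions. *)
have lt2 : m + 1 < (poly_of k).[size x + size y]%R.
  rewrite poly_ofE; apply: (@leq_trans ((size x).+2 ^ k)).
    by apply: leq_trans (hk (size x)); lia.
  by case: (k) => // k'; rewrite leq_exp2r //; lia.
move=> /(_ _ lt2) [-> _ _].
rewrite /fst; case: eqP => hv; rewrite halting_asm ?accepting_asm sz; lia.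
Qed.

Definition emit_bits (eL eb : expr) : cmd :=
  seqs [:: measure; compile eL [::] 3 4;
    loop 3 (seqs [:: Mv 3 Left; compile eb [:: 4] 5 6;
                     If 5 (Some true) (Emit false)
                        (Seq (transfer 5 [::] [::]) (Emit true));
                     Mv 4 Right])].

(** The bits are computed one after the other from their position and emitted at once, so that the
    word is never stored in a counter. *)
Theorem polytime_function_eval (eL eb : expr) :
  polytime_function (fun x =>
    mkseq (fun i => 0 < eval eb (x, [::], [:: i])) (eval eL (x, [::], [::]))).
Proof.
pose body := emit_bits eL eb.
pose code := assemble 0 body.
pose T n := n * 9 + 2 + tbound eL n +
  (vbound eL n * (tbound eb (n + vbound eL n) + vbound eb (n + vbound eL n) * 3 + 10) + 1).
have [k hk] : polybounded (fun n => T n + 2).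
  rewrite /T; repeat first [exact: polybounded_const | exact: polybounded_id
  | exact: polybounded_tbound | exact: polybounded_vbound
  | apply: polybounded_add | apply: polybounded_mul
  | apply: (polybounded_comp (f := tbound _))
  | apply: (polybounded_comp (f := vbound _))].
exists (asm_machine code), (poly_of k) => x; cbv zeta.
have sz : size code = len body by rewrite size_assemble.
set L := eval eL _; pose b i := 0 < eval eb (x, [::], [:: i]).
have hL : L <= vbound eL (size x) by apply: vboundP.
pose B := size x + vbound eL (size x).
pose S i : store := (upd (upd (upd (upd (fun=> 0) 2 (size x)) 3 (L - i)) 4 i) 1 i, mkseq b i).
have [m hm hb] : runs x body (fun=> 0, [::]) (T (size x)) (S L).
  refine (runs_seq (runs_measure x [::]) (m2 := tbound eL (size x) + (vbound eL (size x) * (tbound eb B + vbound eb B * 3 + 10) + 1)) _ _); last by rewrite /T /B; lia.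
  refine (runs_seq (@compile_ok x [::] eL [::] 3 4 _ _ (size x) _ _ _ _ _ _ _) _ (leqnn _)) => //.
  + by move=> r hr; updlia.
  + by apply: views_start; [..|left].
  rewrite /= -/L.
  have -> : (upd (upd (fun=> 0) 2 (size x)) 3 (upd (fun=> 0) 2 (size x) 3 + L), [::]) = S 0.
    by congr pair; apply: funext => j; updlia.
  refine (runs_seq (m1 := (L * (tbound eb B + vbound eb B * 3 + 8 + 2)).+1) (m2 := 0)
    (runs_loop (n := L) _ _ _) (runs_skip _ _) _) => //; last 2 first.
  + by rewrite /S /upd /= subnn.
  + have : L * (tbound eb B + vbound eb B * 3 + 10) <= vbound eL (size x) * (tbound eb B + vbound eb B * 3 + 10).
      by rewrite leq_mul2r hL orbT.
    by lia.
  move=> i hi; split; first by rewrite /S /upd /=; lia.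
  refine (runs_seq (runs_mv _ _ _ _) (m2 := tbound eb B + vbound eb B * 3 + 7) _ _); last lia.
  refine (runs_seq (@compile_ok x [::] eb [:: 4] 5 6 _ _ B _ _ _ _ _ _ _) (m2 := vbound eb B * 3 + 7) _ _) => //; last lia.
  + by move=> r hr; rewrite /S /=; updlia.
  + by apply: views_start; rewrite /S /upd //=; right; rewrite size_mkseq.
  + by rewrite /S /upd /= /B andbT; lia.
  + by rewrite /B leq_addr.
  rewrite /=.
  have -> : upd (S i).1 3 (move Left ((S i).1 3)) 4 = i by rewrite /S /upd /=.
  set v := eval eb _; set q := upd _ 5 _.
  have hv : v <= vbound eb B.
    by apply: vboundP; rewrite /B /= ?leq_addr // andbT; lia.
  have qe : q = upd (upd (upd (upd (upd (fun=> 0) 2 (size x)) 3 (L - i.+1)) 4 i) 1 i) 5 v.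
    by apply: funext => j; rewrite /q /S /=; updlia.
  pose q' := upd (upd (upd (upd (fun=> 0) 2 (size x)) 3 (L - i.+1)) 4 i) 1 i.+1.
  refine (runs_seq (m1 := vbound eb B * 3 + 6) (m2 := 1) (s1 := (q', mkseq b i.+1)) _ _ _); last lia.
    have hs : (q, mkseq b i).1 1 = size (mkseq b i) by rewrite qe /upd /= size_mkseq.
    case: (posnP v) => v0.
      exists 2; first lia.
      apply: bs_if_true; first by apply/eqP; rewrite scan_work // qe /upd /= v0.
      have -> : (q', mkseq b i.+1) = emit (q, mkseq b i) false; last exact: bs_emit.
      rewrite mkseqS /b -/v v0 /=; congr pair; apply: funext => j.
      by rewrite qe /q' /=; updlia.
    have h5 : q 5 = v by rewrite qe /upd.
    have [m hm hb] : runs x (transfer 5 [::] [::]) (q, mkseq b i) (v * 3).+1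
        (transferred q 5 [::] [::] (q 5), mkseq b i).
      by apply: runs_transfer => //=; rewrite h5; lia.
    exists (m + 1).+2; first lia.
    apply: bs_if_false; first by apply/eqP; rewrite scan_work //= h5; lia.
    apply: bs_seq hb _.
    set q2 := transferred _ _ _ _ _.
    have -> : (q', mkseq b i.+1) = emit (q2, mkseq b i) true; last first.
      by apply: bs_emit; rewrite /q2 qe size_mkseq; updlia.
    rewrite mkseqS /b -/v v0 /=; congr pair; apply: funext => j.
    by rewrite /q2 qe /q' /=; updlia.
  refine (runs_seq (runs_mv _ _ _ _) (m2 := 0) _ _) => //.
  apply: runs_le (runs_skip _ _) (leqnn _) _; congr pair; apply: funext => j.
  by rewrite /q' /=; updlia.
have h1 : aexec x code m (0, (fun=> 0, [::])) (len body, S L).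
  by apply: (@assemble_ok x body _ m _ hb code 0); exists [::], [::]; rewrite cats0.
have lt2 : m < (poly_of k).[size x]%R.
  by rewrite poly_ofE; apply: leq_trans (hk (size x)); lia.
have [|-> e2 _] := run_halt h1 _ lt2; first by rewrite sz /=; lia.
by split=> [|i]; [rewrite halting_asm sz /=; lia|rewrite e2].
Qed.

(** * Closure properties of the functions given by expressions *)

Definition definable (F : env -> nat) : Prop := exists e, forall r, F r = eval e r.

Definition lift_var (f : nat -> nat) (j : nat) : nat := if j is j'.+1 then (f j').+1 else 0.

Fixpoint rename (f : nat -> nat) (e : expr) : expr :=
  match e with
  | EVar j => EVar (f j)
  | EConst n => EConst n
  | ESize => ESize
  | EX e => EX (rename f e)
  | EY e => EY (rename f e)
  | EAdd e1 e2 => EAdd (rename f e1) (rename f e2)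
  | ESub e1 e2 => ESub (rename f e1) (rename f e2)
  | ESum e1 e2 => ESum (rename f e1) (rename (lift_var f) e2)
  | ECarry e1 e2 => ECarry (rename f e1) (rename (lift_var f) e2)
  end.

Lemma eq_bsum n f g : f =1 g -> bsum n f = bsum n g.
Proof. by move=> h; apply: eq_bigr => i _; apply: h. Qed.

Lemma eq_carry n f g : f =1 g -> carry f n = carry g n.
Proof. by move=> h; elim: n => //= n ->; rewrite h. Qed.

Lemma eval_rename e f b l l' : (forall j, nth 0 l' j = nth 0 l (f j)) ->
  eval (rename f e) (b, l) = eval e (b, l').
Proof.
elim: e f l l' => //= [e IH|e IH|e1 IH1 e2 IH2|e1 IH1 e2 IH2|e1 IH1 e2 IH2|
  e1 IH1 e2 IH2] f l l' h; rewrite ?(IH _ _ _ h) ?(IH1 _ _ _ h) ?(IH2 _ _ _ h) //.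
- by apply: eq_bsum => i; apply: IH2 => -[|j] /=.
- by apply: eq_carry => i; apply: IH2 => -[|j] /=.
Qed.

Lemma def_ext F G : (forall r, F r = G r) -> definable G -> definable F.
Proof. by move=> h [e he]; exists e => r; rewrite h. Qed.

Lemma def_rename f F (L : env -> seq nat) : definable F ->
  (forall r j, nth 0 (L r) j = nth 0 r.2 (f j)) -> definable (fun r => F (r.1, L r)).
Proof.
move=> [e he] h; exists (rename f e) => -[b l]; rewrite he; apply/esym.
exact: eval_rename (h (b, l)).
Qed.

Lemma nth_pops k (l : seq nat) j : nth 0 (iter k behead l) j = nth 0 l (k + j).
Proof. by elim: k j => //= k IH j; rewrite nth_behead IH addnS. Qed.

Lemma def_popn k F : definable F -> definable (fun r => F (r.1, iter k behead r.2)).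
Proof. by move=> h; apply: (def_rename (f := addn k)) => // r j; exact: nth_pops. Qed.

Lemma def_pop F : definable F -> definable (fun r => F (r.1, behead r.2)).
Proof. exact: (@def_popn 1). Qed.

Lemma def_nth k : definable (fun r => nth 0 r.2 k).
Proof. by exists (EVar k). Qed.

(** Variables take this form, rather than that of [def_nth], after repeated use of lemmas on binders
    such as [def_bsum], each of which replaces [r.2] by [behead r.2]. *)
Lemma def_var k : definable (fun r => head 0 (iter k behead r.2)).
Proof.
apply: def_ext (def_nth k) => r.
by rewrite -nth0 nth_pops addn0.
Qed.

Lemma def_const c : definable (fun=> c).
Proof. by exists (EConst c). Qed.

Lemma def_size : definable (fun r => size r.1.1).
Proof. by exists ESize. Qed.

Lemma def_x F : definable F -> definable (fun r => nth false r.1.1 (F r)).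
Proof. by move=> [e he]; exists (EX e) => r /=; rewrite he. Qed.

Lemma def_y F : definable F -> definable (fun r => nth false r.1.2 (F r)).
Proof. by move=> [e he]; exists (EY e) => r /=; rewrite he. Qed.

Lemma def_add F G : definable F -> definable G -> definable (fun r => F r + G r).
Proof. by move=> [e he] [e' he']; exists (EAdd e e') => r /=; rewrite he he'. Qed.

Lemma def_sub F G : definable F -> definable G -> definable (fun r => F r - G r).
Proof. by move=> [e he] [e' he']; exists (ESub e e') => r /=; rewrite he he'. Qed.

Lemma def_S F : definable F -> definable (fun r => (F r).+1).
Proof. by move=> h; apply: def_ext (def_add h (def_const 1)) => r; rewrite addn1. Qed.

(* Under a binder, [head 0 r.2] is the bound variable. *)
Lemma def_bsum F G : definable F -> definable (fun r => G (r.1, behead r.2) (head 0 r.2)) ->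
  definable (fun r => bsum (F r) (fun i => G r i)).
Proof.
move=> [e he] [e' he']; exists (ESum e e') => r /=; rewrite he.
by apply: eq_bsum => i; rewrite -he'; case: r {he he'}.
Qed.

Lemma def_carry F G : definable F -> definable (fun r => G (r.1, behead r.2) (head 0 r.2)) ->
  definable (fun r => carry (fun i => G r i) (F r)).
Proof.
move=> [e he] [e' he']; exists (ECarry e e') => r /=; rewrite he.
by apply: eq_carry => i; rewrite -he'; case: r {he he'}.
Qed.

Lemma def_mul F G : definable F -> definable G -> definable (fun r => F r * G r).
Proof.
move=> hF hG; apply: def_ext (def_bsum (G := fun r _ => G r) hF (def_pop hG)) => r.
by rewrite /bsum sum_nat_const card_ord.
Qed.

Lemma def_not P : definable (fun r => nat_of_bool (P r)) -> definable (fun r => ~~ P r).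
Proof.
by move=> h; apply: def_ext (def_sub (def_const 1) h) => r; case: (P r).
Qed.

Lemma def_and P Q : definable (fun r => nat_of_bool (P r)) -> definable (fun r => nat_of_bool (Q r)) ->
  definable (fun r => P r && Q r).
Proof. by move=> h h'; apply: def_ext (def_mul h h') => r; case: (P r); case: (Q r). Qed.

Lemma def_or P Q : definable (fun r => nat_of_bool (P r)) -> definable (fun r => nat_of_bool (Q r)) ->
  definable (fun r => P r || Q r).
Proof.
move=> h h'; apply: def_ext (def_not (def_and (def_not h) (def_not h'))) => r.
by case: (P r); case: (Q r).
Qed.

Lemma def_imp P Q : definable (fun r => nat_of_bool (P r)) -> definable (fun r => nat_of_bool (Q r)) ->
  definable (fun r => P r ==> Q r).
Proof.
move=> h h'; apply: def_ext (def_or (def_not h) h') => r.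
by case: (P r).
Qed.

Lemma def_leq F G : definable F -> definable G -> definable (fun r => F r <= G r).
Proof.
move=> h h'; apply: def_ext (def_sub (def_const 1) (def_sub h h')) => r.
by case: leqP => hl; lia.
Qed.

Lemma def_eqn F G : definable F -> definable G -> definable (fun r => F r == G r).
Proof.
move=> h h'; apply: def_ext (def_and (def_leq h h') (def_leq h' h)) => r.
by rewrite eqn_leq.
Qed.

Lemma def_if P F G : definable (fun r => nat_of_bool (P r)) -> definable F -> definable G ->
  definable (fun r => if P r then F r else G r).
Proof.
move=> hP hF hG; apply: def_ext (def_add (def_mul hP hF) (def_mul (def_not hP) hG)) => r.
by case: (P r); rewrite !(mul1n, mul0n, addn0).
Qed.

Lemma def_ifb P Q S : definable (fun r => nat_of_bool (P r)) -> definable (fun r => nat_of_bool (Q r)) ->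
  definable (fun r => nat_of_bool (S r)) -> definable (fun r => nat_of_bool (if P r then Q r else S r)).
Proof.
by move=> hP hQ hS; apply: def_ext (def_if hP hQ hS) => r; case: (P r).
Qed.

Definition ball (n : nat) (P : nat -> bool) : bool := [forall i : 'I_n, P i].
Definition bex (n : nat) (P : nat -> bool) : bool := [exists i : 'I_n, P i].

Lemma ballP n (P : nat -> bool) : reflect (forall i, i < n -> P i) (ball n P).
Proof.
apply: (iffP forallP) => h i; last exact: h.
by move=> hi; apply: (h (Ordinal hi)).
Qed.

Lemma bexP n (P : nat -> bool) : reflect (exists2 i, i < n & P i) (bex n P).
Proof.
apply: (iffP existsP) => [[i hi]|[i hi h]]; first by exists i.
by exists (Ordinal hi).
Qed.

Lemma def_bex F P : definable F ->
  definable (fun r => nat_of_bool (P (r.1, behead r.2) (head 0 r.2))) ->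
  definable (fun r => bex (F r) (fun i => P r i)).
Proof.
move=> hF hP.
have h := def_bsum (G := fun r i => nat_of_bool (P r i)) hF hP.
apply: def_ext (def_leq (def_const 1) h) => r; congr nat_of_bool.
rewrite /bsum lt0n sum_nat_eq0 negb_forall; apply: eq_existsb => i /=.
by case: (P r i).
Qed.

Lemma def_ball F P : definable F ->
  definable (fun r => nat_of_bool (P (r.1, behead r.2) (head 0 r.2))) ->
  definable (fun r => ball (F r) (fun i => P r i)).
Proof.
move=> hF hP; have := def_not (def_bex (P := fun r i => ~~ P r i) hF (def_not hP)).
apply: def_ext => r; congr nat_of_bool; rewrite /ball /bex negb_exists.
by apply: eq_forallb => i /=; rewrite negbK.
Qed.

(** The number [n.*2] put into position 0 travels through the carries and is halved at every
    position. This gives access to the binary digits of [n] without computing [2 ^ j], which may be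
    exponentially large. *)
Lemma carry_halve n j : carry (fun i => if i == 0 then n.*2 else 0) j.+1 = n %/ 2 ^ j.
Proof.
elim: j => [|j IH]; first by rewrite /= add0n doubleK divn1.
rewrite -[LHS]/((carry _ j.+1 + 0)./2) IH addn0 expnSr divnMA.
by rewrite divn2.
Qed.

Lemma def_shiftr F G : definable F -> definable G -> definable (fun r => F r %/ 2 ^ G r).
Proof.
move=> hF hG.
have := def_carry (F := fun r => (G r).+1)
  (G := fun r i => if i == 0 then F r + F r else 0) (def_S hG)
  (def_if (def_eqn (def_var 0) (def_const 0)) (def_add (def_pop hF) (def_pop hF)) (def_const 0)).
apply: def_ext => r; rewrite -carry_halve; apply: eq_carry => i.
by rewrite addnn.
Qed.

Lemma def_odd F : definable F -> definable (fun r => odd (F r)).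
Proof.
move=> hF; have h := def_shiftr hF (def_const 1).
apply: def_ext (def_sub hF (def_add h h)) => r.
by rewrite divn2; have := odd_double_half (F r); lia.
Qed.

Lemma sum_ltn n q : \sum_(i < n) (i < q : nat) = minn n q.
Proof.
elim: n => [|n IH]; first by rewrite big_ord0 min0n.
by rewrite big_ord_recr /= IH; case: ltnP => h; lia.
Qed.

Lemma def_div F G : definable F -> definable G -> definable (fun r => F r %/ G r).
Proof.
move=> hF hG; have h := def_bsum (G := fun r i => nat_of_bool (i.+1 * G r <= F r)) hF
  (def_leq (def_mul (def_S (def_var 0)) (def_pop hG)) (def_pop hF)).
apply: def_ext (def_if (def_leq (def_const 1) hG) h (def_const 0)) => r.
case: posnP => [->|g0]; first by rewrite divn0.
rewrite /bsum (eq_bigr (fun i : 'I_(F r) => nat_of_bool (i < F r %/ G r))).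
  by rewrite sum_ltn; apply/esym/minn_idPr; apply: leq_div.
by move=> i _; rewrite leq_divRL.
Qed.

Lemma def_mod F G : definable F -> definable G -> definable (fun r => F r %% G r).
Proof.
move=> hF hG; apply: def_ext (def_sub hF (def_mul (def_div hF hG) hG)) => r.
by rewrite {2}(divn_eq (F r) (G r)) addKn.
Qed.

(** Finite case distinction on a value bounded by a constant; [F c] may depend on [c] in an
    arbitrary way. This is how functions on finite alphabets become expressions. *)
Lemma def_table q (F : nat -> env -> nat) G : (forall c, definable (F c)) -> definable G ->
  (forall r, G r < q) -> definable (fun r => F (G r) r).
Proof.
move=> hF hG hq.
suff : definable (fun r => if G r < q then F (G r) r else 0).
  by apply: def_ext => r; rewrite hq.
elim: q {hq} => [|q IH]; first exact: (def_ext _ (def_const 0)).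
apply: def_ext (def_if (def_eqn hG (def_const q)) (hF q) IH) => r.
by rewrite ltnS leq_eqVlt; case: eqP => [->|].
Qed.

Lemma def_horner (p : {poly nat}) F : definable F -> definable (fun r => p.[F r]%R).
Proof.
move=> hF; elim/poly_ind: p => [|p c IH].
  by apply: def_ext (def_const 0) => r; rewrite horner0.
by apply: def_ext (def_add (def_mul IH hF) (def_const c)) => r; rewrite hornerMXaddC.
Qed.

(** * Definable words *)

Definition definable_word (G : env -> seq bool) : Prop :=
  definable (fun r => size (G r)) /\
  definable (fun r => nat_of_bool (nth false (G (r.1, behead r.2)) (head 0 r.2))).

Lemma defs_ext F G : (forall r, F r = G r) -> definable_word G -> definable_word F.
Proof.
by move=> h [h1 h2]; split; [apply: def_ext h1|apply: def_ext h2] => r; rewrite h.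
Qed.

(** Substitution of [G r] for a variable, obtained as a sum over [i <= G r] in which only the term
    of [i = G r] is kept. *)
Lemma def_let k F G : definable F -> definable G ->
  definable (fun r => F (r.1, G r :: iter k behead r.2)).
Proof.
move=> hF hG.
have hF' : definable (fun r => F (r.1, head 0 r.2 :: iter k.+1 behead r.2)).
  apply: (def_rename (f := fun j => if j is j'.+1 then (k + j').+1 else 0)) => // r [|j] /=.
    by rewrite nth0.
  by rewrite nth_behead nth_pops addnS.
have := def_bsum (G := fun r i => if i == G r then F (r.1, i :: iter k behead r.2) else 0)
  (def_S hG) (def_if (def_eqn (def_var 0) (def_pop hG)) (def_ext _ hF') (def_const 0)).
move=> h; apply: (def_ext _ (h _)) => r; last by rewrite /= -iterSr.
rewrite /bsum big_ord_recr /= eqxx big1 // => i _.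
by rewrite ltn_eqF.
Qed.

Lemma defs_bit P : definable (fun r => nat_of_bool (P r)) -> definable_word (fun r => [:: P r]).
Proof.
move=> h; split; first by apply: def_ext (def_const 1).
apply: def_ext (def_and (def_eqn (def_var 0) (def_const 0)) (def_pop h)) => r /=.
by case: (head 0 r.2) => //= n; rewrite nth_nil.
Qed.

Lemma defs_cat F G : definable_word F -> definable_word G -> definable_word (fun r => F r ++ G r).
Proof.
move=> hF hG; split.
  by apply: def_ext (def_add hF.1 hG.1) => r; rewrite size_cat.
have hs := def_pop hF.1.
have := def_ifb (def_leq (def_S (def_var 0)) hs) hF.2
  (def_let 1 hG.2 (def_sub (def_var 0) hs)).
by apply: def_ext => r; rewrite /= nth_cat.
Qed.

Definition concat (n : nat) (g : nat -> seq bool) : seq bool :=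
  flatten [seq g i | i <- iota 0 n].

Lemma concatS n g : concat n.+1 g = concat n g ++ g n.
Proof. by rewrite /concat -addn1 iotaD map_cat flatten_cat /= cats0. Qed.

Lemma size_concat n g : size (concat n g) = bsum n (fun i => size (g i)).
Proof.
rewrite /bsum; elim: n => [|n IH]; first by rewrite big_ord0.
by rewrite concatS size_cat big_ord_recr IH.
Qed.

(** Only the block that contains position [p] contributes: later blocks fail the test [s <= p], and
    earlier ones are read beyond their end, where [nth] gives [false]. *)
Lemma nth_concat n g p :
  nat_of_bool (nth false (concat n g) p) =
  bsum n (fun i => let s := bsum i (fun j => size (g j)) in
    if s <= p then nat_of_bool (nth false (g i) (p - s)) else 0).
Proof.
rewrite {1}/bsum; elim: n => [|n IH]; first by rewrite big_ord0 nth_nil.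
rewrite concatS nth_cat big_ord_recr /= -IH size_concat.
case: (ltnP p (bsum n _)) => h; first by rewrite addn0.
by rewrite [X in _ = X + _](_ : _ = 0) // nth_default // size_concat.
Qed.

Lemma defs_concat N g : definable N ->
  definable_word (fun r => g (r.1, behead r.2) (head 0 r.2)) ->
  definable_word (fun r => concat (N r) (fun i => g r i)).
Proof.
move=> hN hg.
have hst k : definable (fun r => bsum (head 0 r.2) (fun j => size (g (r.1, iter k behead r.2) j))).
  apply: (def_bsum (G := fun r j => size (g (r.1, iter k behead r.2) j)) (def_var 0)).
  apply: def_ext (def_let k.+1 hg.1 (def_var 0)) => r /=.
  by rewrite -iterSr.
split.
  apply: def_ext (def_bsum (G := fun r i => size (g r i)) hN hg.1) => r.
  exact: size_concat.
apply: (def_ext (fun r => nth_concat _ _ _)).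
apply: (def_bsum (G := fun r i => let s := bsum i (fun j => size (g (r.1, behead r.2) j)) in
   if s <= head 0 r.2 then nat_of_bool (nth false (g (r.1, behead r.2) i) (head 0 r.2 - s)) else 0)
  (def_pop hN)).
have h1 : definable (fun r => nth false (g (r.1, iter 3 behead r.2) (head 0 (behead r.2))) (head 0 r.2)).
  apply: def_ext (def_rename (f := fun j => if j is j'.+2 then j'.+3 else j)
    (L := fun r => head 0 r.2 :: head 0 (behead r.2) :: iter 3 behead r.2) hg.2 _) => // r.
  move=> [|[|j]] /=; rewrite ?nth0 -?nth0 ?nth_behead //.
have := def_if (def_leq (hst 2) (def_var 1))
  (def_let 0 h1 (def_sub (def_var 1) (hst 2))) (def_const 0).
by apply: def_ext => r /=.
Qed.

Lemma defs_nseq F b : definable F -> definable_word (fun r => nseq (F r) b).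
Proof.
move=> h; split; first by apply: def_ext h => r; rewrite size_nseq.
case: b; last by apply: def_ext (def_const 0) => r; rewrite nth_nseq if_same.
apply: def_ext (def_leq (def_S (def_var 0)) (def_pop h)) => r.
by rewrite nth_nseq; case: ltnP.
Qed.

Lemma defs_x : definable_word (fun r => r.1.1).
Proof. by split; [exact: def_size|exact: def_x (def_var 0)]. Qed.

Lemma def_eqs F G : definable_word F -> definable_word G -> definable (fun r => F r == G r).
Proof.
move=> hF hG.
have h := def_and (def_eqn hF.1 hG.1)
  (def_ball (P := fun r i => nth false (F r) i == nth false (G r) i) hF.1
    (def_ext _ (def_eqn hF.2 hG.2))).
apply: (def_ext _ (h _)) => r.
  congr nat_of_bool; apply/eqP/andP => [->|[/eqP h1 /ballP h2]].
    by split=> //; apply/ballP.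
  by apply: (@eq_from_nth _ false) => // i hi; apply/eqP/h2.
by case: (nth _ _ _); case: (nth _ _ _).
Qed.

Lemma polytime_function_def (G : env -> seq bool) : definable_word G ->
  polytime_function (fun x => G (x, [::], [::])).
Proof.
move=> [[eL hL] [eb hb]]; have [M [p h]] := polytime_function_eval eL eb.
exists M, p => x; have [h1 h2] := h x; split=> //.
suff -> : G (x, [::], [::]) = mkseq (fun i => 0 < eval eb (x, [::], [:: i])) (eval eL (x, [::], [::])) by [].
rewrite -hL; apply: (@eq_from_nth _ false) => [|i hi]; first by rewrite size_mkseq.
by rewrite nth_mkseq // -hb /=; case: nth.
Qed.

Lemma polytime_relation_def (P : env -> bool) : definable (fun r => nat_of_bool (P r)) ->
  polytime_relation (fun x y => P (x, y, [::])).
Proof.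
move=> [e he]; have [M [p h]] := polytime_relation_eval e.
exists M, p => x y; have [h1 h2] := h x y; split=> //.
by rewrite h2 -he; case: (P _).
Qed.

(** * Integral flows *)

Section Integrality.
Import Order.TTheory GRing.Theory Num.Theory classical_sets.
Variables (R : realType) (G : digraph) (w : edge G -> nat) (s t : vertex G).
Local Open Scope ring_scope.

Definition net (h : edge G -> R) (v : vertex G) : R :=
  \sum_(e | edge_tail e == v) h e - \sum_(e | edge_head e == v) h e.

Definition residual (F : edge G -> nat) : rel (vertex G) := fun u v =>
  [exists e, [&& edge_tail e == u, edge_head e == v & (F e < w e)%N] ||
             [&& edge_tail e == v, edge_head e == u & (0 < F e)%N]].

Lemma net_update (h : edge G -> R) e c v :
  net (fun e' => h e' + c *+ (e' == e)) v =
  net h v + c * ((edge_tail e == v)%:R - (edge_head e == v)%:R).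
Proof.
have key (P : pred (edge G)) :
    \sum_(e' | P e') (h e' + c *+ (e' == e)) = \sum_(e' | P e') h e' + c * (P e)%:R.
  rewrite big_split /=; congr (_ + _); case: (boolP (P e)) => he.
    rewrite (bigD1 e) //= eqxx mulr1 big1 ?addr0 // => i /andP[_ /negbTE ->].
    by rewrite mulr0n.
  rewrite mulr0 big1 // => i hi; case: eqP => [ei|]; last by rewrite mulr0n.
  by rewrite ei (negbTE he) in hi.
by rewrite /net !key; lra.
Qed.

(** One unit is pushed along the path, edge by edge. As the path does not return to [a], the edge
    changed first, which has [a] as an end, is not among the residual edges of the remaining path,
    so these are still available. *)
Lemma augment p a (F : edge G -> nat) : (forall e, F e <= w e)%N ->
  path (residual F) a p -> uniq (a :: p) ->
  exists F' : edge G -> nat, (forall e, F' e <= w e)%N /\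
    forall v, net (fun e => (F' e)%:R) v =
      net (fun e => (F e)%:R) v + (v == a)%:R - (v == last a p)%:R.
Proof.
elim: p a F => [|b p IH] a F hF.
  by move=> _ _; exists F; split => // v; rewrite addrK.
move=> /= /andP[/existsP[e he] hp] /andP[na ub].
suff [F1 [h1 h2 h3]] : exists F1 : edge G -> nat, [/\ forall e, (F1 e <= w e)%N,
    forall e', e' != e -> F1 e' = F e' &
    forall v, net (fun e => (F1 e)%:R) v =
      net (fun e => (F e)%:R) v + (v == a)%:R - (v == b)%:R].
  have [] := IH b F1 h1 _ ub.
    apply: sub_in_path (hp) => [u v hu hv /existsP[e' he']|].
      2: exact: (allss (b :: p)).
    apply/existsP; exists e'; rewrite h2 //; apply: contraNneq na => ee.
    case/orP: he => /and3P[/eqP e1 /eqP e2 _]; case/orP: he' => /and3P[/eqP e3 /eqP e4 _];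
      subst e'; rewrite ?e1 ?e2 in e3 e4; by subst.
  move=> F' [g1 g2]; exists F'; split=> // v; rewrite g2 h3; lra.
case/orP: he => /and3P[/eqP e1 /eqP e2 lt].
- exists (fun e' => F e' + (e' == e))%N; split=> [e'|e' /negbTE ->|v].
  + by case: eqP => [->|_]; rewrite ?addn1 ?addn0.
  + by rewrite addn0.
  under [X in net X]funext => e' do rewrite natrD.
  have := net_update (fun e => (F e)%:R) e 1 v.
  rewrite /net => ->; rewrite e1 e2 ![_ == v]eq_sym; lra.
- exists (fun e' => F e' - (e' == e))%N; split=> [e'|e' /negbTE ->|v].
  + by apply: leq_trans (leq_subr _ _) _.
  + by rewrite subn0.
  have := net_update (fun e => (F e)%:R) e (-1) v.
  rewrite e1 e2 ![_ == v]eq_sym => h; transitivity (net (fun e => (F e)%:R) v + -1 * ((v == b)%:R - (v == a)%:R)); last lra.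
  rewrite -h; congr net; apply: funext => e'.
  case: eqP => [->|_]; last by rewrite subn0 mulr0n addr0.
  by rewrite natrB // mulr1n.
Qed.

Definition conserves (h : edge G -> R) : Prop :=
  forall v, v != s -> v != t -> net h v = 0.

Lemma cut_value (h : edge G -> R) (S : {set vertex G}) : conserves h ->
  s \in S -> t \notin S ->
  net h s = \sum_e h e * ((edge_tail e \in S)%:R - (edge_head e \in S)%:R).
Proof.
move=> hc hs ht.
have -> : net h s = \sum_(v in S) net h v.
  rewrite (bigD1 s) //= big1 ?addr0 // => v /andP[vS vs]; apply: hc => //.
  by apply: contraNneq ht => <-.
rewrite /net sumrB.
have key (g : edge G -> vertex G) :
    \sum_(v in S) \sum_(e | g e == v) h e = \sum_e h e * (g e \in S)%:R.
  rewrite (exchange_big_dep xpredT) //=; apply: eq_bigr => e _.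
  case: (boolP (g e \in S)) => he.
    rewrite mulr1 (big_pred1 (g e)) // => v; rewrite [g e == v]eq_sym.
    by rewrite andb_idl // => /eqP ->.
  rewrite mulr0 big1 // => v /andP[hv /eqP ev].
  by rewrite ev hv in he.
by rewrite !key -sumrB; apply: eq_bigr => e _; rewrite mulrBr.
Qed.

(** Augmenting paths raise the value of an integral flow by one at a time. If [t] is not reachable
    in the residual graph at a value of at most [k], the reachable vertices form a cut that the
    integral flow saturates, so that the real flow [g] cannot exceed [k] either. *)
Lemma integral_flow (g : edge G -> R) (k : nat) : s != t ->
  (forall e, 0 <= g e <= (w e)%:R) -> conserves g -> k%:R < net g s ->
  exists F : edge G -> nat, [/\ forall e, (F e <= w e)%N,
    conserves (fun e => (F e)%:R) & net (fun e => (F e)%:R) s = k.+1%:R].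
Proof.
move=> st hg hc hk.
suff : forall n, (n <= k.+1)%N -> exists F : edge G -> nat, [/\ forall e, (F e <= w e)%N,
    conserves (fun e => (F e)%:R) & net (fun e => (F e)%:R) s = n%:R].
  by apply.
elim=> [_|n IH hn].
  exists (fun=> 0%N); split=> // [v _ _|]; rewrite /net !big1 ?subrr //.
have [F [h1 h2 h3]] := IH (ltnW hn).
case: (boolP (connect (residual F) s t)) => [|nc]; last first.
  exfalso; pose S := [set v | connect (residual F) s v].
  have hs : s \in S by rewrite inE connect0.
  have ht : t \notin S by rewrite inE.
  suff : net g s <= net (fun e => (F e)%:R) s.
    rewrite h3 leNgt => /negP; apply; apply: le_lt_trans hk.
    by rewrite ler_nat.
  rewrite (cut_value hc hs ht) (cut_value h2 hs ht); apply: ler_sum => e _.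
  have /andP[g0 gw] := hg e.
  case: (boolP (edge_tail e \in S)) => ht'; case: (boolP (edge_head e \in S)) => hh;
    rewrite ?subrr ?mulr0 ?subr0 ?mulr1 ?sub0r ?mulrN1 //.
    have -> : F e = w e; last by [].
    apply/eqP; rewrite eqn_leq h1 leqNgt; apply: contra hh => lt.
    rewrite inE; rewrite inE in ht'; apply: connect_trans ht' (connect1 _).
    by apply/existsP; exists e; rewrite !eqxx lt.
  have -> : F e = 0%N; last by lra.
  apply/eqP; rewrite -leqn0 leqNgt; apply: contra ht' => lt.
  rewrite inE; rewrite inE in hh; apply: connect_trans hh (connect1 _).
  by apply/existsP; exists e; rewrite !eqxx lt orbT.
case/connectP => p hp et; case: (shortenP hp) et => p' hp' up' _ et.
have [F' [g1 g2]] := augment h1 hp' up'.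
exists F'; split=> // [v vs vt|].
  by rewrite g2 -et (negbTE vs) (negbTE vt) h2 //; lra.
by rewrite g2 -et eqxx (negbTE st) h3 subr0 -[in RHS]addn1 natrD.
Qed.

End Integrality.

(** * Yes-instances as integral flows whose support is within the budget *)

Section Yes.
Import Order.TTheory GRing.Theory Num.Theory classical_sets.
Local Open Scope nat_scope.

Definition nat_flow (G : digraph) (w : edge G -> nat) (s t : vertex G)
    (f : edge G -> nat) : Prop :=
  (forall e, f e <= w e) /\
  forall v, v != s -> v != t ->
    \sum_(e | edge_head e == v) f e = \sum_(e | edge_tail e == v) f e.

(** The edge set [I] is left implicit: the support of [f] is the cheapest set that carries [f]. *)
Definition nat_yes (X : flow_instance) : Prop :=
  exists f : edge (graph X) -> nat,
  [/\ nat_flow (@capacity X) (source X) (sink X) f,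
      \sum_(e | 0 < f e) cost e <= budget X &
      \sum_(e | edge_head e == source X) f e + threshold X <
      \sum_(e | edge_tail e == source X) f e].

Lemma net_nat (R : realType) (G : digraph) (f : edge G -> nat) v :
  net (fun e => (f e)%:R : R)%R v =
  ((\sum_(e | edge_tail e == v) f e)%:R - (\sum_(e | edge_head e == v) f e)%:R)%R.
Proof. by rewrite /net !natr_sum. Qed.

Lemma sum_out_in (G : digraph) (f : edge G -> nat) :
  \sum_v \sum_(e | edge_tail e == v) f e = \sum_v \sum_(e | edge_head e == v) f e.
Proof.
have key (g : edge G -> vertex G) : \sum_v \sum_(e | g e == v) f e = \sum_e f e.
  rewrite (exchange_big_dep xpredT) //=; apply: eq_bigr => e _.
  by rewrite (big_pred1 (g e)) // => v; rewrite eq_sym.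
by rewrite !key.
Qed.

Lemma balance_sink (T : finType) (s t : T) (O N : T -> nat) : s != t ->
  \sum_v O v = \sum_v N v -> (forall v, v != s -> v != t -> N v = O v) ->
  N s < O s -> 0 < N t.
Proof.
move=> st; rewrite (bigD1 s) //= (bigD1 t) 1?eq_sym //=.
rewrite [in RHS](bigD1 s) //= [in RHS](bigD1 t) 1?eq_sym //= => e h.
have e' : \sum_(v | (v != s) && (v != t)) N v = \sum_(v | (v != s) && (v != t)) O v.
  by apply: eq_bigr => v /andP[]; apply: h.
by rewrite e' in e; lia.
Qed.

(** Total inflow equals total outflow, so the surplus at [s] is absorbed at [t]. This shows that [t]
    is an endpoint of a support edge; otherwise [max_flow] would be 0 by definition. *)
Lemma inflow_sink (G : digraph) (w : edge G -> nat) (s t : vertex G) f : s != t ->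
  @nat_flow G w s t f ->
  \sum_(e | edge_head e == s) f e < \sum_(e | edge_tail e == s) f e ->
  0 < \sum_(e | edge_head e == t) f e.
Proof. by move=> st [_ hc]; apply: balance_sink (sum_out_in f) hc. Qed.

Lemma sum_restrict (R : realType) (G : digraph) (I : {set edge G}) (P : pred (edge G)) (g : edge G -> R) :
  (forall e, e \notin I -> g e = 0)%R ->
  (\sum_(e in I | P e) g e = \sum_(e | P e) g e)%R.
Proof.
move=> h; rewrite [RHS](bigID (mem I)) /= [X in (_ = _ + X)%R]big1 ?addr0.
  by apply: eq_bigl => e; rewrite andbC.
by move=> e /andP[_ /h].
Qed.

Lemma budget_max_flowP (R : realType) (G : digraph) (w c : edge G -> nat) B (s t : vertex G) k :
  s != t -> ((k%:R < budget_max_flow R w c B s t)%R <->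
  exists f, [/\ nat_flow w s t f, \sum_(e | 0 < f e) c e <= B &
      \sum_(e | edge_head e == s) f e + k < \sum_(e | edge_tail e == s) f e]).
Proof.
move=> st; split; last first.
  move=> [f [hf hB hk]]; set I := [set e | 0 < f e].
  have hI e : e \notin I -> ((f e)%:R = 0 :> R)%R by rewrite inE lt0n negbK => /eqP ->.
  apply: (@lt_le_trans _ _ (k.+1)%:R%R); first by rewrite ltr_nat.
  apply: (@le_trans _ _ (max_flow R w (edge_induced I) s t)); last first.
    rewrite /budget_max_flow (bigD1 I) /=; last first.
      by apply: leq_trans hB; rewrite leq_eqVlt; apply/orP; left; apply/eqP/eq_bigl => e; rewrite inE.
    by rewrite le_max lexx.
  have hs : s \in sub_vertices (edge_induced I).
    rewrite /= inE; apply/orP; left; apply/imsetP.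
    have : 0 < \sum_(e | edge_tail e == s) f e by lia.
    rewrite lt0n sum_nat_eq0 negb_forall => /existsP[e].
    rewrite negb_imply => /andP[/eqP es ef]; exists e => //.
    by rewrite inE lt0n.
  have ht : t \in sub_vertices (edge_induced I).
    rewrite /= inE; apply/orP; right; apply/imsetP.
    have : 0 < \sum_(e | edge_head e == t) f e.
      by apply: inflow_sink st hf _; lia.
    rewrite lt0n sum_nat_eq0 negb_forall => /existsP[e].
    rewrite negb_imply => /andP[/eqP es ef]; exists e => //.
    by rewrite inE lt0n.
  rewrite /max_flow hs ht /=.
  set A := (X in sup X); pose v := flow_value (edge_induced I) s (fun e => (f e)%:R : R)%R.
  have fl : is_flow w (edge_induced I) s t (fun e => (f e)%:R : R)%R.
    split=> [e _|u _ us ut]; first by rewrite ler0n ler_nat (hf.1 e).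
    rewrite /inflow /outflow !sum_restrict // -!natr_sum; congr (_%:R)%R.
    by case: hf => _ ->.
  apply: (@le_trans _ _ v).
    rewrite /v /flow_value /outflow /inflow !sum_restrict // -!natr_sum.
    by rewrite lerBrDr -natrD ler_nat; lia.
  apply: ub_le_sup; last by exists (fun e => (f e)%:R : R)%R.
  exists (\sum_e (w e)%:R)%R => _ [g [hg _] <-]; rewrite /flow_value.
  apply: (@le_trans _ _ (outflow (edge_induced I) g s)).
    by rewrite gerBl; apply: sumr_ge0 => e /andP[he _]; case/andP: (hg e he).
  rewrite /outflow big_mkcond /=; apply: ler_sum => e _.
  by case: ifP => [/andP[he _]|]; [case/andP: (hg e he)|rewrite ler0n].
move=> hk.
have [I [hI hm]] : exists I : {set edge G}, \sum_(e in I) c e <= B /\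
    (k%:R < max_flow R w (edge_induced I) s t)%R.
  apply: contrapT => hn; move: hk; rewrite ltNge => /negP; apply.
  apply/bigmax_leP; split; first by rewrite ler0n.
  move=> I hI; rewrite leNgt; apply/negP => lt; apply: hn; exists I; split => //.
move: hm; rewrite /max_flow; case: ifP => _; last by rewrite ltNge ler0n.
set A := (X in sup X) => hm.
have A0 : (A !=set0)%classic.
  exists 0%R, (fun=> 0)%R; last by rewrite /flow_value /outflow /inflow !big1 ?subrr.
  by split=> [e _|v _ _ _]; rewrite ?lexx ?ler0n // /outflow /inflow !big1.
(* The inequality is strict, so an element of the set already exceeds [k]. *)
have [_ [g hg <-] lt] := sup_gt A0 hm.
(* Flow and capacities are extended by 0 outside [I], in order to apply [integral_flow] to the whole
   graph. *)
pose g' e := (if e \in I then g e else 0)%R; pose w' e := if e \in I then w e else 0.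
have g'0 e : e \notin I -> g' e = 0%R by rewrite /g' => /negbTE ->.
have sumE (P : pred (edge G)) : (\sum_(e in I | P e) g e = \sum_(e | P e) g' e)%R.
  rewrite -(sum_restrict P g'0); apply: eq_bigr => e /andP[he _].
  by rewrite /g' he.
have [] := @integral_flow R G w' s t g' k st.
- move=> e; rewrite /g' /w'; case: ifP => he; last by rewrite lexx.
  by case: hg => /(_ e he).
- move=> v vs vt; rewrite /net -!sumE; apply/eqP; rewrite subr_eq0; apply/eqP.
  case: (boolP (v \in sub_vertices (edge_induced I))) => hv.
    by rewrite -[LHS]/(outflow (edge_induced I) g v) -(hg.2 v hv vs vt).
  by rewrite !big1 // => e /andP[he /eqP ev]; case/negP: hv; rewrite /= inE -ev;
    apply/orP; [right|left]; apply/imsetP; exists e.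
- by rewrite /net -!sumE.
move=> F [h1 h2 h3]; exists F; split.
- split=> [e|v vs vt].
    by apply: leq_trans (h1 e) _; rewrite /w'; case: ifP.
  have := h2 v vs vt; rewrite net_nat => /eqP; rewrite subr_eq0 eqr_nat.
  by move/eqP.
- apply: leq_trans hI; rewrite big_mkcond [X in _ <= X]big_mkcond.
  apply: leq_sum => e _; case: ifP => // lt'; case: ifP => // he.
  by have := h1 e; rewrite /w' he; lia.
- move: h3; rewrite net_nat => /eqP; rewrite subr_eq -natrD eqr_nat => /eqP ->.
  by lia.
Qed.

Lemma is_yesP (R : realType) (X : flow_instance) : source X <> sink X ->
  (@is_yes (flow_improvement R) X <-> nat_yes X).
Proof. by move=> /eqP; apply: budget_max_flowP. Qed.

End Yes.

(** * Hitting sets as flows on a grid *)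

(* [h r c] and [v r c] are the flows on the edges that lead to the right and
   downwards from the vertex in row [r] and column [c]. The edges from column
   [2 j + 1] to [2 j + 2] cross the set [j], the edges from [2 j] to [2 j + 1]
   lie in a gap between two sets. *)
Section GridSound.
Variables (N Q M : nat) (A : nat -> nat -> bool) (h v : nat -> nat -> nat).
Let K := N * M + 1.
Hypothesis row_end : h 0 M.*2 = 0.
Hypothesis bottom_start : h Q.+1 0 = 0.
Hypothesis gap_cap : forall r j, 0 < r <= Q -> j <= M -> h r j.*2 <= 2.
Hypothesis lane_cap : forall r j, 0 < r <= Q -> j < M -> h r j.*2.+1 <= 2 + A j r.-1.
Hypothesis left_cap : forall r j, r <= Q -> j < M -> v r j.*2.+1 <= (r < Q).
Hypothesis right_cap : forall r j, r <= Q -> j < M -> v r j.*2.+2 <= (0 < r).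
Hypothesis below : forall c, v Q.+1 c = 0.
Hypothesis conserve_top : forall c, c < M.*2 -> h 0 c = h 0 c.+1 + v 0 c.+1.
Hypothesis conserve_left : forall r, r <= Q -> v r 0 = h r.+1 0 + v r.+1 0.
Hypothesis conserve : forall r c, r <= Q -> c < M.*2 ->
  h r.+1 c + v r c.+1 = h r.+1 c.+1 + v r.+1 c.+1.
Hypothesis value : 2 * N + M <= h 0 0 + v 0 0.
Hypothesis price : \sum_(j < M.+1) K * (\sum_(1 <= r < Q.+1) (0 < h r j.*2)) +
  \sum_(j < M) \sum_(1 <= r < Q.+1) (0 < h r j.*2.+1) <= K * (N * M.+1) + N * M.

(** [D r c] is the flow that leaves column [c] to the right below row [r]. From one column to the
    next it grows by the flow that comes down from row [r], which is [D_step]. *)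
Let D r c := \sum_(r.+1 <= r' < Q.+2) h r' c.
Let lanes c := \sum_(1 <= r < Q.+1) h r c.
Let used c := \sum_(1 <= r < Q.+1) (0 < h r c : nat).

Lemma D_rec r c : r <= Q -> D r c = h r.+1 c + D r.+1 c.
Proof. by move=> hr; rewrite /D big_ltn. Qed.

Lemma D_end c : D Q.+1 c = 0.
Proof. by rewrite /D big_geq. Qed.

Lemma D_step r c : r <= Q.+1 -> c < M.*2 -> D r c + v r c.+1 = D r c.+1.
Proof.
move=> hr hc; rewrite -(subKn hr); elim: (Q.+1 - r) (leq_subr r Q.+1) => [_|k IH hk].
  by rewrite subn0 !D_end below.
have e : Q.+1 - k.+1 < Q.+1 by lia.
have e2 : (Q.+1 - k.+1).+1 = Q.+1 - k by lia.
have := IH (ltnW hk); rewrite -e2 => {}IH; rewrite (D_rec c e) (D_rec c.+1 e).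
by have := @conserve _ c e hc; lia.
Qed.

Lemma D_left r : r <= Q.+1 -> v r 0 = D r 0.
Proof.
move=> hr; rewrite -(subKn hr); elim: (Q.+1 - r) (leq_subr r Q.+1) => [_|k IH hk].
  by rewrite subn0 !D_end below.
have e : Q.+1 - k.+1 < Q.+1 by lia.
have e2 : (Q.+1 - k.+1).+1 = Q.+1 - k by lia.
by rewrite (D_rec 0 e) conserve_left // e2 IH // ltnW.
Qed.

Lemma D_lanes c : D 0 c = lanes c + h Q.+1 c.
Proof. by rewrite /D /lanes big_nat_recr. Qed.

Lemma D_bottom c : D Q c = h Q.+1 c.
Proof. by rewrite (D_rec c (leqnn Q)) D_end addn0. Qed.

Lemma top_le j : j <= M -> h 0 j.*2 <= M - j.
Proof.
move=> hj; rewrite -{1}(subKn hj); elim: (M - j) (leq_subr j M) => [_|k IH hk].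
  by rewrite subn0 row_end.
have {IH} := IH (ltnW hk).
have e : (M - k).*2 = (M - k.+1).*2.+2 by lia.
have h1 := @conserve_top (M - k.+1).*2; have h2 := @conserve_top (M - k.+1).*2.+1.
have := @left_cap 0 (M - k.+1); have := @right_cap 0 (M - k.+1).
rewrite e h1 ?h2; try lia.
Qed.

Lemma bottom_le j : j <= M -> h Q.+1 j.*2 <= j.
Proof.
elim: j => [|j IH] hj; first by rewrite bottom_start.
have := @D_step Q j.*2; have := @D_step Q j.*2.+1; rewrite !D_bottom.
have := @left_cap Q j; have := @right_cap Q j; have := IH (ltnW hj).
rewrite doubleS; lia.
Qed.

Lemma D_top c : c <= M.*2 -> D 0 c + h 0 c = h 0 0 + v 0 0.
Proof.
elim: c => [|c IH] hc; first by rewrite D_left // addnC.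
by have := IH (ltnW hc); rewrite -(@D_step 0 c) // (conserve_top hc); lia.
Qed.

Lemma sum_eq_le m n (a b : nat -> nat) : (forall i, m <= i < n -> a i <= b i) ->
  \sum_(m <= i < n) b i <= \sum_(m <= i < n) a i -> forall i, m <= i < n -> a i = b i.
Proof.
move=> hab hs i hi; apply/eqP; rewrite eqn_leq hab //=.
have split f : \sum_(m <= j < n) f j =
    \sum_(m <= j < i) f j + (f i + \sum_(i.+1 <= j < n) f j).
  by rewrite (@big_cat_nat _ _ _ i) /=; [rewrite [X in _ + X]big_ltn|..]; lia.
move: hs; rewrite !split.
have : \sum_(m <= j < i) a j <= \sum_(m <= j < i) b j.
  by rewrite big_nat [X in _ <= X]big_nat; apply: leq_sum => j hj; apply: hab; lia.
have : \sum_(i.+1 <= j < n) a j <= \sum_(i.+1 <= j < n) b j.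
  by rewrite big_nat [X in _ <= X]big_nat; apply: leq_sum => j hj; apply: hab; lia.
lia.
Qed.

(** Of the [2 * N + M] units that cross the gap, at most [M - j] are on the top row and at most [j]
    on the bottom row. *)
Lemma lanes_ge j : j <= M -> 2 * N <= lanes j.*2.
Proof.
move=> hj; have := @D_top j.*2; have := top_le hj; have := bottom_le hj.
by rewrite D_lanes; move: value; lia.
Qed.

Lemma lanes_le j : j <= M -> lanes j.*2 <= 2 * used j.*2.
Proof.
move=> hj; rewrite /lanes /used big_distrr /=.
rewrite big_nat [X in _ <= X]big_nat; apply: leq_sum => r hr.
by have := @gap_cap r j; lia.
Qed.

Lemma used_ge j : j <= M -> N <= used j.*2.
Proof. by move=> hj; have := lanes_le hj; have := lanes_ge hj; lia. Qed.

(** Each of the [M + 1] gaps needs [N] lanes. One lane more in any of them costs another [K], which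
    exceeds the remainder [N * M] of the budget; so all gaps use exactly [N] lanes and the remainder
    bounds the edges inside the sets. *)
Lemma used_gap_inside :
  (forall j, j <= M -> used j.*2 = N) /\ \sum_(j < M) used j.*2.+1 <= N * M.
Proof.
have h1 : \sum_(j < M.+1) used j.*2 <= N * M.+1.
  rewrite leqNgt; apply/negP => lt.
  move: price; rewrite -big_distrr /= => hp.
  have : K * (N * M.+1).+1 <= K * \sum_(j < M.+1) used j.*2 by rewrite leq_mul2l lt orbT.
  have hK : N * M < K by rewrite /K addn1.
  move: hp; rewrite -[X in K * X + _]/(\sum_(j < M.+1) used j.*2) [K * (N * M.+1).+1]mulnS.
  by move: (K * (N * M.+1)) (K * \sum_(j < M.+1) used j.*2) => a b; lia.
have h2 j : j <= M -> used j.*2 = N.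
  move=> hj; apply/esym; apply: (@sum_eq_le 0 M.+1 (fun=> N) (fun j => used j.*2)) => //.
    by move=> i hi; apply: used_ge; lia.
  by rewrite !big_mkord sum_nat_const card_ord mulnC.
split=> //.
move: price; rewrite (eq_bigr (fun=> K * N)); last by move=> j _; rewrite -(h2 j) // -ltnS.
by rewrite sum_nat_const card_ord mulnCA [M.+1 * N]mulnC leq_add2l.
Qed.

Lemma lanes_eq j : j <= M -> lanes j.*2 = 2 * N.
Proof.
move=> hj; have [hu _] := used_gap_inside.
by have := lanes_le hj; have := lanes_ge hj; rewrite hu //; lia.
Qed.

Lemma gap_full r j : 0 < r <= Q -> j <= M -> h r j.*2 = 2 * (0 < h r j.*2).
Proof.
move=> hr hj; have [hu _] := used_gap_inside.
apply: (@sum_eq_le 1 Q.+1 (fun r => h r j.*2) (fun r => 2 * (0 < h r j.*2))) => //.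
  by move=> i hi; have := @gap_cap i j; lia.
have := lanes_eq hj; rewrite /lanes => ->.
by have := hu j hj; rewrite /used -big_distrr /= => ->.
Qed.

Lemma bottom_eq j : j <= M -> h Q.+1 j.*2 = j.
Proof.
move=> hj; have := @D_top j.*2; have := top_le hj; have := bottom_le hj.
by rewrite D_lanes lanes_eq //; move: value; lia.
Qed.

Lemma D_gap r j : r <= Q -> j <= M ->
  D r j.*2 = 2 * (\sum_(r.+1 <= r' < Q.+1) (0 < h r' j.*2)) + j.
Proof.
move=> hr hj; rewrite /D big_nat_recr //= bottom_eq // big_distrr /=; congr (_ + _).
by apply: eq_big_nat => i hi; apply: gap_full => //; lia.
Qed.

(** By [D_gap], the flow below row [r] has the parity of [j] in gap [j]. Across set [j] it therefore
    grows by an odd number, which is at most 2 as the two sides have capacity at most 1. *)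
Lemma D_next r j : r <= Q -> j < M -> D r j.+1.*2 = (D r j.*2).+1.
Proof.
move=> hr hj; have := @D_step r j.*2; have := @D_step r j.*2.+1.
have := @left_cap r j; have := @right_cap r j.
have := @D_gap r j; have := @D_gap r j.+1; rewrite doubleS.
by lia.
Qed.

(** The flow on lane [r] is the difference of the flows below rows [r - 1] and [r], and both grow by
    one across a set. *)
Lemma gap_next r j : 0 < r <= Q -> j <= M -> h r j.*2 = h r 0.
Proof.
move=> hr; elim: j => // j IH hj; rewrite -IH; last lia.
have := @D_next r j; have := @D_next r.-1 j.
have := @D_rec r.-1 j.*2; have := @D_rec r.-1 j.+1.*2.
by rewrite prednK; lia.
Qed.

Lemma grid_sound : \sum_(1 <= r < Q.+1) (0 < h r 0) = N /\
  forall j, j < M -> exists2 r, 0 < r <= Q & (0 < h r 0) && A j r.-1.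
Proof.
have [hu hi] := used_gap_inside; split; first exact: (hu 0).
(* A lane that reaches set [j] with 2 units loses at most one of them down the left side, so it is
   used inside the set as well. *)
have pos r j : 0 < r <= Q -> j < M -> (0 < h r 0) <= (0 < h r j.*2.+1).
  move=> hr hj; case: (posnP (h r 0)) => // h0.
  have g := gap_full hr (ltnW hj); rewrite (gap_next hr (ltnW hj)) h0 in g.
  have hr' : r.-1 <= Q by lia.
  have c := @conserve r.-1 j.*2 hr'; rewrite prednK in c; last lia.
  rewrite (gap_next hr (ltnW hj)) in c.
  by have := @left_cap r j; lia.
have ui j : j < M -> used j.*2.+1 = N.
  move=> hj; apply/esym; apply: (@sum_eq_le 0 M (fun=> N) (fun j => used j.*2.+1)) => //.
    move=> i hij; rewrite -(hu 0) // /used big_nat [X in _ <= X]big_nat.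
    by apply: leq_sum => r hr; apply: pos; lia.
  by rewrite !big_mkord sum_nat_const card_ord mulnC.
have same r j : 0 < r <= Q -> j < M -> (0 < h r 0) = (0 < h r j.*2.+1).
  move=> hr hj; have : nat_of_bool (0 < h r 0) = (0 < h r j.*2.+1).
    apply: (@sum_eq_le 1 Q.+1 (fun r => nat_of_bool (0 < h r 0))
      (fun r => nat_of_bool (0 < h r j.*2.+1))); last lia.
      by move=> i hir; apply: pos; lia.
    by have := ui j hj; have := hu 0 isT; rewrite /used => -> ->.
  by case: (0 < h r 0); case: (0 < h r j.*2.+1).
move=> j hj.
have v0 : v 0 j.*2.+1 = 1.
  have := @D_next 0 j; have := @D_step 0 j.*2; have := @D_step 0 j.*2.+1.
  have := @right_cap 0 j; rewrite doubleS; lia.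
have vQ : v Q j.*2.+1 = 0 by have := @left_cap Q j; lia.
(* The left side carries one unit below the top row and none above the bottom row, so somewhere this
   unit leaves it for a lane. *)
have [r hr [h1 h2]] : exists2 r, r < Q & v r j.*2.+1 = 1 /\ v r.+1 j.*2.+1 = 0.
  have lc r : r <= Q -> v r j.*2.+1 <= 1 by move=> hr; have := @left_cap r j; lia.
  elim: (Q) vQ lc => [|q IH] vq lc; first by rewrite v0 in vq.
  case: (posnP (v q j.*2.+1)) => [e|e].
    by have [r hr hh] := IH e (fun r hr => lc r (leqW hr)); exists r => //; lia.
  by exists q => //; split=> //; have := lc q (leqnSn q); lia.
(* On this lane the flow inside the set is one more than in the gap. On an unpaid lane it would be
   1, against [same]; on a paid lane it is 3, which the capacity allows only for a member of the
   set. *)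
exists r.+1; first lia.
have c1 := @conserve r j.*2; have e1 := @gap_full r.+1 j.
have e2 := @same r.+1 j; have c2 := @lane_cap r.+1 j.
have e3 := @gap_next r.+1 j.
move: c1 e1 e2 c2 e3; rewrite /=; case: (A j r) => //=; last by lia.
by case: (posnP (h r.+1 0)) => //= e0; rewrite e0; lia.
Qed.

End GridSound.

(** * Flow sums at the vertices of a helical grid *)

Section Spiral.
Variables (n C : nat) (flipped : nat -> bool).

(* The vertices 0, ..., n run along a helix on a cylinder of circumference
   [C]: edge [e < n] joins [e] to [e + 1], edge [n + m] joins [m] and [m + C],
   downwards unless [flipped m]. *)
Definition spiral_tail (e : nat) : nat :=
  if e < n then e else if flipped (e - n) then e - n + C else e - n.

Definition spiral_head (e : nat) : nat :=
  if e < n then e.+1 else if flipped (e - n) then e - n else e - n + C.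

Definition spiral : digraph :=
  {| nb_vertices := n.+1; nb_edges := n + (n.+1 - C);
     edge_tail := fun e => inord (spiral_tail e);
     edge_head := fun e => inord (spiral_head e) |}.

Hypothesis C_gt1 : 1 < C.

Lemma spiral_tailE (e : edge spiral) : edge_tail e = spiral_tail e :> nat.
Proof. by rewrite /= inordK // /spiral_tail; have /= lt := ltn_ord e; do 2?case: ifP => ?; lia. Qed.

Lemma spiral_headE (e : edge spiral) : edge_head e = spiral_head e :> nat.
Proof. by rewrite /= inordK // /spiral_head; have /= lt := ltn_ord e; do 2?case: ifP => ?; lia. Qed.

Lemma spiral_simple : simple spiral.
Proof.
move=> e e' E; apply: val_inj.
have h1 : edge_tail e = edge_tail e' := congr1 fst E.
have h2 : edge_head e = edge_head e' := congr1 snd E.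
have : spiral_tail e = spiral_tail e' by rewrite -!spiral_tailE h1.
have : spiral_head e = spiral_head e' by rewrite -!spiral_headE h2.
by rewrite /spiral_tail /spiral_head /=; do ?case: ifP => ?; lia.
Qed.

Definition helix (f : nat -> nat) (m : nat) : nat := if m < n then f m else 0.
Definition axial (f : nat -> nat) (m : nat) : nat := if m < n.+1 - C then f (n + m) else 0.

Lemma sum_pick (m a : nat) (F : nat -> nat) :
  \sum_(i < m) (if i == a :> nat then F i else 0) = if a < m then F a else 0.
Proof.
rewrite -big_mkcond /=; case: ltnP => h; first by rewrite (big_pred1 (Ordinal h)).
by rewrite big1 // => i /eqP e; move: (ltn_ord i); rewrite e ltnNge h.
Qed.

Lemma spiral_sum (P : nat -> bool) (f : nat -> nat) :
  \sum_(e < n + (n.+1 - C) | P e) f e =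
  \sum_(m < n) (if P m then helix f m else 0) +
  \sum_(m < n.+1 - C) (if P (n + m) then axial f m else 0).
Proof.
rewrite big_mkcond big_split_ord /=; congr (_ + _); apply: eq_bigr => m _ /=.
  by rewrite /helix ltn_ord.
by rewrite /axial ltn_ord.
Qed.

Lemma spiral_out_nat (f : nat -> nat) (v : nat) :
  \sum_(e < n + (n.+1 - C) | spiral_tail e == v) f e =
  helix f v + (if flipped v then 0 else axial f v) +
  (if (C <= v) && flipped (v - C) then axial f (v - C) else 0).
Proof.
rewrite (spiral_sum (fun e => spiral_tail e == v)) -addnA; congr (_ + _).
  transitivity (\sum_(m < n) (if m == v :> nat then helix f m else 0)).
    by apply: eq_bigr => m _; rewrite /spiral_tail ltn_ord.
  by rewrite sum_pick /helix; case: (ltnP v n).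
transitivity (\sum_(m < n.+1 - C) ((if m == v :> nat then if flipped v then 0 else axial f v else 0) +
   (if m == v - C :> nat then if (C <= v) && flipped (v - C) then axial f (v - C) else 0 else 0))).
  apply: eq_bigr => m _; rewrite /spiral_tail ltnNge leq_addr /= addKn.
  case: (eqVneq (m : nat) v) => [e1|n1].
    (* With truncated subtraction, [v - C] equals [v] only for [v = 0], where the test [C <= v]
       fails. *)
    have -> : (if m == v - C :> nat then if (C <= v) && flipped (v - C)
        then axial f (v - C) else 0 else 0) = 0.
      by case: eqP => // ?; case: (leqP C v) => //= ?; exfalso; lia.
    rewrite addn0 e1; case: (flipped v); last by rewrite eqxx.
    by case: eqP => //; lia.
  case: (eqVneq (m : nat) (v - C)) => [e2|n2].
    rewrite -e2; case: (flipped m); rewrite ?andbT ?andbF ?(negbTE n1) //.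
    have -> : (m + C == v) = (C <= v) by apply/eqP/idP; lia.
    by [].
  case: ifP => //; case: (flipped m); rewrite ?(negbTE n1) // => /eqP.
  by move: n2; lia.
rewrite big_split /= (sum_pick _ _ (fun=> if flipped v then 0 else axial f v)).
rewrite (sum_pick _ _ (fun=> if (C <= v) && flipped (v - C) then axial f (v - C) else 0)).
by congr (_ + _); [rewrite {1}/axial|rewrite {1}/axial]; case: ifP => // h;
  rewrite /axial h ?if_same.
Qed.

Lemma spiral_out (f : nat -> nat) (v : vertex spiral) :
  \sum_(e : edge spiral | edge_tail e == v) f e =
  helix f v + (if flipped v then 0 else axial f v) +
  (if (C <= v) && flipped (v - C) then axial f (v - C) else 0).
Proof.
rewrite (eq_bigl (fun e : edge spiral => spiral_tail e == v)); last first.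
  by move=> e; rewrite -val_eqE -spiral_tailE.
exact: spiral_out_nat.
Qed.

Lemma spiral_in_nat (f : nat -> nat) (v : nat) :
  \sum_(e < n + (n.+1 - C) | spiral_head e == v) f e =
  (if 0 < v then helix f v.-1 else 0) + (if flipped v then axial f v else 0) +
  (if (C <= v) && ~~ flipped (v - C) then axial f (v - C) else 0).
Proof.
rewrite (spiral_sum (fun e => spiral_head e == v)) -addnA; congr (_ + _).
  transitivity (\sum_(m < n) (if m == v.-1 :> nat then if 0 < v then helix f v.-1 else 0 else 0)).
    apply: eq_bigr => m _; rewrite /spiral_head ltn_ord.
    case: (posnP v) => hv; first by rewrite hv if_same.
    by rewrite -{1}(prednK hv) eqSS; case: eqP => [->|].
  rewrite (sum_pick _ _ (fun=> if 0 < v then helix f v.-1 else 0)).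
  by rewrite /helix; case: (ltnP v.-1 n); case: (0 < v).
transitivity (\sum_(m < n.+1 - C) ((if m == v :> nat then if flipped v then axial f v else 0 else 0) +
   (if m == v - C :> nat then if (C <= v) && ~~ flipped (v - C) then axial f (v - C) else 0 else 0))).
  apply: eq_bigr => m _; rewrite /spiral_head ltnNge leq_addr /= addKn.
  case: (eqVneq (m : nat) v) => [e1|n1].
    have -> : (if m == v - C :> nat then if (C <= v) && ~~ flipped (v - C)
        then axial f (v - C) else 0 else 0) = 0.
      by case: eqP => // ?; case: (leqP C v) => //= ?; exfalso; lia.
    rewrite addn0 e1; case: (flipped v); first by rewrite eqxx.
    by case: eqP => //; lia.
  case: (eqVneq (m : nat) (v - C)) => [e2|n2].
    rewrite -e2; case: (flipped m); rewrite ?andbT ?andbF ?(negbTE n1) //.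
    have -> : (m + C == v) = (C <= v) by apply/eqP/idP; lia.
    by [].
  case: ifP => //; case: (flipped m); rewrite ?(negbTE n1) // => /eqP.
  by move: n2; lia.
rewrite big_split /= (sum_pick _ _ (fun=> if flipped v then axial f v else 0)).
rewrite (sum_pick _ _ (fun=> if (C <= v) && ~~ flipped (v - C) then axial f (v - C) else 0)).
by congr (_ + _); [rewrite {1}/axial|rewrite {1}/axial]; case: ifP => // h;
  rewrite /axial h ?if_same.
Qed.

Lemma spiral_in (f : nat -> nat) (v : vertex spiral) :
  \sum_(e : edge spiral | edge_head e == v) f e =
  (if 0 < v then helix f v.-1 else 0) + (if flipped v then axial f v else 0) +
  (if (C <= v) && ~~ flipped (v - C) then axial f (v - C) else 0).
Proof.
rewrite (eq_bigl (fun e : edge spiral => spiral_head e == v)); last first.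
  by move=> e; rewrite -val_eqE -spiral_headE.
exact: spiral_in_nat.
Qed.

End Spiral.

Lemma sum_mul R C (F : nat -> nat) :
  \sum_(m < R * C) F m = \sum_(i < R) \sum_(j < C) F (i * C + j).
Proof.
elim: R F => [|R IH] F; first by rewrite !big_ord0.
by rewrite mulSnr big_split_ord /= IH big_ord_recr.
Qed.

(** * The flow instance of a hitting set problem *)

Section Grid.
Variables (N Q M : nat) (A : nat -> nat -> bool).
Let C := M.*2.+2.
Let n := (Q.+2 * C).-1.
Let K := N * M + 1.

(* The last column leads upwards, to the sink at its top. The edges from it to
   the next row only close the helix. *)
Definition on_last (m : nat) : bool := m %% C == M.*2.+1.

(** The bound [2 * N + M] stands for infinity, being the required value. The top row is cut after
    its last set and the bottom row before its first one, so that the flow passes from one to the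
    other only through the sets. *)
Definition hcap (i j : nat) : nat :=
  if j == M.*2.+1 then 0
  else if i == 0 then if j == M.*2 then 0 else 2 * N + M
  else if i == Q.+1 then if j == 0 then 0 else 2 * N + M
  else if odd j then 2 + A j./2 i.-1 else 2.

Definition hcost (i j : nat) : nat :=
  if [|| j == M.*2.+1, i == 0 | i == Q.+1] then 0 else if odd j then 1 else K.

Definition vcap (i j : nat) : nat :=
  if j == M.*2.+1 then 2 * N + M
  else if j == 0 then if i == Q then 0 else 2 * N + M
  else if odd j then (i < Q : nat) else (0 < i : nat).

Definition grid_capacity (e : nat) : nat :=
  if e < n then hcap (e %/ C) (e %% C) else vcap ((e - n) %/ C) ((e - n) %% C).

Definition grid_cost (e : nat) : nat :=
  if e < n then hcost (e %/ C) (e %% C) else 0.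

Definition grid_budget : nat := K * (N * M.+1) + N * M.

(** The threshold is one less than the required value, because the comparison with it is strict. The
    sink at the top of the last column shares with the source the face at the end of the
    cylinder. *)
Definition grid_instance : flow_instance :=
  @FlowInstance (spiral n C on_last) (fun e => grid_capacity e)
    (fun e => grid_cost e) grid_budget (inord 0) (inord M.*2.+1) (2 * N + M).-1.

Lemma C_gt1 : 1 < C. Proof. by []. Qed.

Lemma last_lt : M.*2.+1 < C. Proof. exact: ltnSn. Qed.

Lemma gap_lt : M.*2 < C. Proof. exact: leqnSn. Qed.

Lemma n1E : n.+1 = Q.+2 * C.
Proof. by rewrite /n prednK // muln_gt0. Qed.

Lemma n1C : n.+1 - C = Q.+1 * C.
Proof. by rewrite n1E mulSn addKn. Qed.

Lemma div_cell i j : j < C -> (i * C + j) %/ C = i.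
Proof. by move=> h; rewrite divnMDl // divn_small // addn0. Qed.

Lemma mod_cell i j : j < C -> (i * C + j) %% C = j.
Proof. by move=> h; rewrite modnMDl modn_small. Qed.

Lemma on_last_cell i j : j < C -> on_last (i * C + j) = (j == M.*2.+1).
Proof. by move=> h; rewrite /on_last mod_cell. Qed.

Lemma cell_lt i j R : i < R -> j < C -> i * C + j < R * C.
Proof. by move=> hi hj; apply: (@leq_trans (i.+1 * C)); [rewrite mulSnr ltn_add2l|rewrite leq_mul2r hi orbT]. Qed.

Definition grid_h (f : nat -> nat) (i j : nat) : nat := helix n f (i * C + j).
Definition grid_v (f : nat -> nat) (i j : nat) : nat := axial n C f (i * C + j).

Definition cell_in (f : nat -> nat) (i j : nat) : nat :=
  (if j is j'.+1 then grid_h f i j' else 0) +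
  (if j == M.*2.+1 then grid_v f i j else if i is i'.+1 then grid_v f i' j else 0).

Definition cell_out (f : nat -> nat) (i j : nat) : nat :=
  grid_h f i j +
  (if j == M.*2.+1 then if i is i'.+1 then grid_v f i' j else 0 else grid_v f i j).

(** On the helix, column 0 is entered from the last column of the row above. These closing edges
    have capacity 0, which is the source of the hypothesis on [grid_h]. *)
Lemma grid_in (f : nat -> nat) i j : j < C -> (forall i, grid_h f i M.*2.+1 = 0) ->
  let u := i * C + j in
  (if 0 < u then helix n f u.-1 else 0) + (if on_last u then axial n C f u else 0) +
  (if (C <= u) && ~~ on_last (u - C) then axial n C f (u - C) else 0) = cell_in f i j.
Proof.
move=> hj hl /=; rewrite on_last_cell // /cell_in -addnA; congr (_ + _).
  case: j hj => [|j] hj; last by rewrite addnS.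
  rewrite addn0; case: i => [|i]; first by rewrite mul0n.
  have -> : 0 < i.+1 * C by rewrite muln_gt0.
  by rewrite -[RHS](hl i) /grid_h; congr helix; rewrite mulSn /C; lia.
case: i => [|i].
  rewrite mul0n add0n leqNgt hj /= addn0.
  by case: eqP.
have -> : i.+1 * C + j - C = i * C + j by rewrite mulSn; lia.
have -> : C <= i.+1 * C + j by rewrite mulSn; lia.
by rewrite on_last_cell //; case: eqP; rewrite ?addn0.
Qed.

Lemma grid_out (f : nat -> nat) i j : j < C ->
  let u := i * C + j in
  helix n f u + (if on_last u then 0 else axial n C f u) +
  (if (C <= u) && on_last (u - C) then axial n C f (u - C) else 0) = cell_out f i j.
Proof.
move=> hj /=; rewrite on_last_cell // /cell_out -addnA; congr (_ + _).
case: i => [|i].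
  rewrite mul0n add0n leqNgt hj /= addn0.
  by case: eqP.
have -> : i.+1 * C + j - C = i * C + j by rewrite mulSn; lia.
have -> : C <= i.+1 * C + j by rewrite mulSn; lia.
by rewrite on_last_cell //; case: eqP; rewrite ?addn0.
Qed.

Lemma grid_total_cost (f : nat -> nat) :
  \sum_(e < n + (n.+1 - C) | 0 < f e) grid_cost e =
  \sum_(j < M.+1) K * (\sum_(1 <= r < Q.+1) (0 < grid_h f r j.*2)) +
  \sum_(j < M) \sum_(1 <= r < Q.+1) (0 < grid_h f r j.*2.+1).
Proof.
rewrite (spiral_sum n C (fun e => 0 < f e)) [X in _ + X]big1 ?addn0; last first.
  move=> m _; rewrite /axial /grid_cost ltn_ord [n + m < n]ltnNge leq_addr /=.
  by case: ifP.
pose G m := (0 < helix n f m) * hcost (m %/ C) (m %% C).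
transitivity (\sum_(m < Q.+2 * C) G m).
  (* The last vertex has no helix edge; a zero term for it completes the rectangle of cells. *)
  have Gn : G (@ord_max n) = 0 by rewrite /G /helix /= ltnn.
  rewrite -n1E [RHS]big_ord_recr Gn /= addn0.
  apply: eq_bigr => m _; rewrite ?/G /helix /= /grid_cost ltn_ord.
  by case: (0 < f m); rewrite ?mul1n ?mul0n.
rewrite sum_mul.
have zero i : (i == 0) || (i == Q.+1) -> \sum_(j < C) G (i * C + j) = 0.
  move=> hi; rewrite big1 // => j _; rewrite /G div_cell // /hcost hi orbT.
  by rewrite muln0.
rewrite -(big_mkord xpredT (fun i => \sum_(j < C) G (i * C + j))).
rewrite big_nat_recr //= [X in _ + X]zero ?eqxx ?orbT // addn0.
rewrite big_ltn // zero // add0n.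
have row i : 0 < i < Q.+1 -> \sum_(j < C) G (i * C + j) =
   \sum_(j < M.+1) K * (0 < grid_h f i j.*2) + \sum_(j < M) (0 < grid_h f i j.*2.+1).
  move=> hi; have cost_at j : j < C -> G (i * C + j) =
      (0 < grid_h f i j) * (if j == M.*2.+1 then 0 else if odd j then 1 else K).
    move=> hj; rewrite /G div_cell // mod_cell // /hcost /grid_h.
    by have [-> ->] : (i == 0) = false /\ (i == Q.+1) = false; [lia|rewrite !orbF].
  rewrite (eq_bigr (fun j : 'I_C => (0 < grid_h f i j) *
     (if j == M.*2.+1 :> nat then 0 else if odd j then 1 else K))); last by move=> j _; exact: cost_at.
  rewrite /C big_ord_recr /= eqxx muln0 addn0.
  have split (F : nat -> nat) m : \sum_(j < m.*2.+1) F j =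
      \sum_(j < m.+1) F j.*2 + \sum_(j < m) F j.*2.+1.
    elim: m => [|m IH]; first by rewrite big_ord0 addn0 !big_ord_recl !big_ord0.
    rewrite doubleS big_ord_recr big_ord_recr /= IH [\sum_(j < m.+2) _]big_ord_recr /=.
    by rewrite [\sum_(j < m.+1) F j.*2.+1]big_ord_recr /= doubleS; lia.
  rewrite (split (fun j => (0 < grid_h f i j) * (if j == M.*2.+1 then 0 else if odd j then 1 else K))).
  congr (_ + _); apply: eq_bigr => j _.
    rewrite odd_double mulnC; case: eqP => // e; have := ltn_ord j; lia.
  rewrite /= odd_double /=; case: eqP => e; last by rewrite muln1.
  by have := ltn_ord j; lia.
rewrite (eq_big_nat _ _ row) big_split /=; congr (_ + _); rewrite exchange_big /=.
  by apply: eq_bigr => j _; rewrite big_distrr.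
by [].
Qed.

Lemma grid_vE f i j : i < Q.+1 -> j < C -> grid_v f i j = f (n + (i * C + j)).
Proof. by move=> hi hj; rewrite /grid_v /axial n1C (cell_lt hi hj). Qed.

Lemma grid_v_out f j : grid_v f Q.+1 j = 0.
Proof. by rewrite /grid_v /axial n1C ltnNge leq_addr. Qed.

Lemma grid_h_cap f i j : (forall e, e < n + (n.+1 - C) -> f e <= grid_capacity e) ->
  i < Q.+2 -> j < C -> grid_h f i j <= hcap i j.
Proof.
move=> hf hi hj; rewrite /grid_h /helix; case: ltnP => // lt.
have := hf (i * C + j); rewrite /grid_capacity lt div_cell // mod_cell //.
by apply; rewrite ltn_addr.
Qed.

Lemma grid_v_cap f i j : (forall e, e < n + (n.+1 - C) -> f e <= grid_capacity e) ->
  i < Q.+1 -> j < C -> grid_v f i j <= vcap i j.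
Proof.
move=> hf hi hj; rewrite grid_vE //; have lt := cell_lt hi hj.
have := hf (n + (i * C + j)); rewrite n1C ltn_add2l lt => /(_ isT).
by rewrite /grid_capacity ltnNge leq_addr /= addKn div_cell // mod_cell.
Qed.

Definition hits (P : nat -> bool) : Prop :=
  \sum_(p < Q) P p = N /\ forall j, j < M -> exists2 p, p < Q & P p && A j p.

Lemma hits_of_yes : nat_yes grid_instance -> exists P, hits P.
Proof.
case=> f0 [[hcap0 hcons] hcost hval].
pose f k := if insub k is Some e then f0 e else 0.
have fE (e : edge (spiral n C on_last)) : f0 e = f e by rewrite /f valK.
have hf e : e < n + (n.+1 - C) -> f e <= grid_capacity e.
  by move=> lt; have := hcap0 (Ordinal lt); rewrite fE.
have sumE (P : pred (edge (spiral n C on_last))) : \sum_(e | P e) f0 e = \sum_(e | P e) f e.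
  by apply: eq_bigr => e _; exact: fE.
have hlast i : grid_h f i M.*2.+1 = 0.
  case: (ltnP i Q.+2) => hi.
    by have := @grid_h_cap f i M.*2.+1 hf hi (ltnSn _); rewrite /hcap eqxx; case: grid_h.
  rewrite /grid_h /helix ltnNge -ltnS n1E.
  have : Q.+2 * C <= i * C by rewrite leq_mul2r hi orbT.
  by move=> h; have -> : Q.+2 * C <= (i * C + M.*2.+1).+1 by apply: leq_trans h _; lia.
have cons i j : i < Q.+2 -> j <= M.*2 -> (i != 0) || (j != 0) ->
    cell_in f i j = cell_out f i j.
  move=> hi hj hij; have hjC : j < C by rewrite /C; lia.
  have lt := cell_lt hi hjC; rewrite -n1E in lt.
  have := hcons (Ordinal lt); rewrite !sumE spiral_in // spiral_out //=.
  rewrite grid_in // grid_out //; apply.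
    by rewrite -val_eqE /= inordK // addn_eq0 muln_eq0; move: hij; case: (i) (j) => [|?] [|?].
  rewrite -val_eqE /= inordK; last by rewrite n1E /C mulSn; lia.
  apply/eqP; case: (i) => [|i']; first by rewrite mul0n; lia.
  by rewrite mulSn /C; lia.
have hval2 : 2 * N + M <= grid_h f 0 0 + grid_v f 0 0.
  move: hval; rewrite !sumE spiral_in // spiral_out //= inordK //.
  rewrite /on_last mod0n /= /grid_h /grid_v. rewrite mul0n !addn0 !add0n. lia.
have hpr := grid_total_cost f.
rewrite (eq_bigl (fun e : edge (spiral n C on_last) => 0 < f e)) in hcost; last by move=> e; rewrite fE.
have hprice : \sum_(j < M.+1) K * (\sum_(1 <= r < Q.+1) (0 < grid_h f r j.*2)) +
  \sum_(j < M) \sum_(1 <= r < Q.+1) (0 < grid_h f r j.*2.+1) <= K * (N * M.+1) + N * M.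
  by rewrite -hpr; exact: hcost.
have hc := @grid_h_cap f _ _ hf; have vc := @grid_v_cap f _ _ hf.
have [] := @grid_sound N Q M A (grid_h f) (grid_v f) _ _ _ _ _ _ _ _ _ _ hval2 hprice.
- have := hc 0 M.*2 isT; rewrite /hcap /= eqxx ltn_eqF //.
  by case: grid_h => // k /(_ (leqnSn _)).
- have := hc Q.+1 0 (ltnSn _); rewrite /hcap /= eqxx.
  by case: grid_h => // k /(_ isT).
- move=> r j hr hj; have := hc r j.*2; rewrite /hcap odd_double.
  have -> : (j.*2 == M.*2.+1) = false by apply/eqP; lia.
  have -> : (r == 0) = false by apply/eqP; lia.
  have -> : (r == Q.+1) = false by apply/eqP; lia.
  by apply; rewrite /C; lia.
- move=> r j hr hj; have := hc r j.*2.+1; rewrite /hcap /= odd_double /=.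
  have -> : (j.*2.+1 == M.*2.+1) = false by apply/eqP; lia.
  have -> : (r == 0) = false by apply/eqP; lia.
  have -> : (r == Q.+1) = false by apply/eqP; lia.
  by rewrite uphalf_double; apply; rewrite /C; lia.
- move=> r j hr hj; have := vc r j.*2.+1; rewrite /vcap /= odd_double /=.
  have -> : (j.*2.+1 == M.*2.+1) = false by apply/eqP; lia.
  by apply; rewrite /C; lia.
- move=> r j hr hj; have := vc r j.*2.+2; rewrite /vcap /= odd_double /=.
  have -> : (j.*2.+2 == M.*2.+1) = false by apply/eqP; lia.
  by apply; rewrite /C; lia.
- exact: grid_v_out.
- move=> c hcm; have := @cons 0 c.+1 isT hcm isT; rewrite /cell_in /cell_out.
  by have -> : (c.+1 == M.*2.+1) = false; [apply/eqP; lia|rewrite addn0].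
- move=> r hr; have := @cons r.+1 0 hr isT isT; rewrite /cell_in /cell_out /=.
  by rewrite add0n.
- move=> r c hr hcm; have := @cons r.+1 c.+1 hr hcm isT; rewrite /cell_in /cell_out.
  by have -> : (c.+1 == M.*2.+1) = false; [apply/eqP; lia|].
(* Lane [p] is row [p + 1], since row 0 is the top row. *)
move=> h1 h2; exists (fun p => 0 < grid_h f p.+1 0); split.
  by rewrite -h1 big_add1 /= big_mkord.
move=> j /h2 [[|r] // hr hA]; by exists r.
Qed.

(** * The flow defined by a hitting set *)

Section Witness.
Variables (P : nat -> bool) (c : nat -> nat).
Hypothesis P_sum : \sum_(p < Q) P p = N.
Hypothesis c_lt : forall j, j < M -> c j < Q.
Hypothesis c_P : forall j, j < M -> P (c j).
Hypothesis c_A : forall j, j < M -> A j (c j).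

Definition rest (i : nat) : nat := \sum_(i <= p < Q) 2 * P p.

(** Chosen lanes carry 2 units from end to end. The unit for set [k] descends on the left side to
    row [c k + 1], crosses the set on that lane and descends on the right side to the bottom row. In
    the first and the last column, [rest i] is the flow of the lanes below row [i]. *)
Definition wh (i j : nat) : nat :=
  if j == M.*2.+1 then 0 else if i == 0 then M - uphalf j
  else if i == Q.+1 then j./2
  else 2 * P i.-1 + (odd j && (i == (c j./2).+1)).

Definition wv (i j : nat) : nat :=
  if j == M.*2.+1 then rest i + M else if j == 0 then rest i
  else if odd j then (i <= c j./2 : nat) else (c j./2.-1 < i : nat).

Definition wflow (e : nat) : nat :=
  if e < n then wh (e %/ C) (e %% C) else wv ((e - n) %/ C) ((e - n) %% C).

Lemma restS i : i < Q -> rest i = 2 * P i + rest i.+1.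
Proof. by move=> h; rewrite /rest big_ltn. Qed.

Lemma rest_end : rest Q = 0.
Proof. by rewrite /rest big_geq. Qed.

Lemma rest0 : rest 0 = 2 * N.
Proof. by rewrite /rest big_mkord -big_distrr /= P_sum. Qed.

Lemma rest_le i : i <= Q -> rest i <= 2 * N.
Proof.
move=> h; rewrite -rest0 /rest [X in _ <= X](@big_cat_nat _ _ _ i) //=.
by rewrite leq_addl.
Qed.

Lemma wflow_h i j : i < Q.+2 -> j < C -> grid_h wflow i j = wh i j.
Proof.
clear P_sum c_lt c_P c_A; move=> hi hj.
rewrite /grid_h /helix /wflow; have := cell_lt hi hj.
rewrite -n1E ltnS leq_eqVlt; case: ltnP => h.
  by rewrite div_cell // mod_cell.
rewrite orbF => /eqP e; have : i * C + j = Q.+1 * C + M.*2.+1.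
  by rewrite e -[n]/(n.+1.-1) n1E mulSn /C; lia.
by move=> /(congr1 (modn^~ C)); rewrite !mod_cell // => ->; rewrite /wh eqxx.
Qed.

Lemma wflow_v i j : i <= Q -> j < C -> grid_v wflow i j = wv i j.
Proof.
clear P_sum c_lt c_P c_A; move=> hi hj; rewrite grid_vE // /wflow ltnNge leq_addr /= addKn.
by rewrite div_cell // mod_cell.
Qed.

Lemma wh_cap i j : i < Q.+2 -> j < C -> wh i j <= hcap i j.
Proof.
move=> hi hj; rewrite /wh /hcap; case: eqP => // hj'.
case: eqP => [|i0]; first by case: eqP => [->|]; rewrite ?uphalf_double; lia.
case: eqP => [|iQ]; first by case: eqP => [->|] //; move: hj; rewrite /C; lia.
case: (boolP (odd j)) => oj /=; last by case: (P _).
case: eqP => [e|_] /=; last by case: (P _); lia.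
have hM : j./2 < M by move: hj oj hj'; rewrite /C; lia.
by rewrite e /= c_A // c_P.
Qed.

Lemma wv_cap i j : i <= Q -> j < C -> wv i j <= vcap i j.
Proof.
move=> hi hj; rewrite /wv /vcap; have hr := rest_le hi.
case: eqP => [|hj']; first by lia.
case: eqP => [|j0]; first by case: eqP => [->|]; rewrite ?rest_end; lia.
case: (boolP (odd j)) => oj /=.
  have hM : j./2 < M by move: hj oj hj'; rewrite /C; lia.
  by have := c_lt hM; lia.
by case: (i) => // i'; exact: leq_b1.
Qed.

Lemma wflow_hlast i : grid_h wflow i M.*2.+1 = 0.
Proof.
clear P_sum c_lt c_P c_A.
case: (ltnP i Q.+2) => hi; first by rewrite wflow_h // /wh eqxx.
rewrite /grid_h /helix ltnNge -ltnS n1E.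
have h : Q.+2 * C <= i * C by rewrite leq_mul2r hi orbT.
by have -> : Q.+2 * C <= (i * C + M.*2.+1).+1 by apply: leq_trans h _; lia.
Qed.

Lemma wflow_balance i j : i < Q.+2 -> j < C -> (i != 0) || (j != 0) ->
  (i != 0) || (j != M.*2.+1) -> cell_in wflow i j = cell_out wflow i j.
Proof.
move=> hi hj h0 h1; rewrite /cell_in /cell_out.
case: (eqVneq j M.*2.+1) => [ej|nj].
  have hl := last_lt; have hg := gap_lt.
  rewrite ej wflow_hlast; case: i hi h0 h1 => [|i] hi h0 h1; first by move: h1; rewrite ej !eqxx.
  rewrite wflow_h // (wflow_v (i := i)) //.
  rewrite /wh /wv eqxx ltn_eqF // odd_double /= addn0 doubleK.
  case: (eqVneq i.+1 Q.+1) => [[->]|ne]; first by rewrite rest_end grid_v_out; lia.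
  rewrite wflow_v //; last lia.
  by rewrite /wv eqxx (restS (i := i)); lia.
rewrite [X in _ = X + _]wflow_h //.
case: i hi h0 h1 => [|i] hi h0 h1.
  case: j hj nj h0 h1 => [|j] hj nj h0 h1 //.
  rewrite wflow_h ?wflow_v /wh /wv //; last lia.
  rewrite (negbTE nj) /= ltn_eqF; last by move: hj; rewrite /C; lia.
  move: hj nj; rewrite /C; case: (boolP (odd j)) => oj /=; lia.
rewrite (wflow_v (i := i)) //.
have -> : grid_v wflow i.+1 j = if i.+1 == Q.+1 then 0 else wv i.+1 j.
  case: eqP => [->|ne]; first exact: grid_v_out.
  by rewrite wflow_v //; lia.
case: j hj nj {h0 h1} => [|j] hj nj.
  rewrite /wh /wv /=; case: eqP => [[->]|ne]; first by rewrite rest_end.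
  by rewrite addn0 (restS (i := i)); lia.
rewrite wflow_h //; last lia.
rewrite /wh /wv (negbTE nj) /= ltn_eqF; last by move: hj; rewrite /C; lia.
have cM k : k < M -> c k < Q by exact: c_lt.
case: (boolP (odd j)) => oj /=.
  have hM : j./2 < M by move: hj oj nj; rewrite /C; lia.
  have e1 : uphalf j = j./2.+1 by lia.
  have := c_lt hM; rewrite e1 /=.
  by case: eqP => [[->]|ne]; [|case: eqP => [e|ne']]; lia.
have hM : j./2 < M by move: hj oj nj; rewrite /C; lia.
have e1 : uphalf j = j./2 by lia.
have := c_lt hM; rewrite e1 addn0.
by case: eqP => [[->]|ne]; [|case: eqP => [e|ne']]; lia.
Qed.

End Witness.

Lemma yes_of_hits P : 0 < N -> hits P -> nat_yes grid_instance.
Proof.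
move=> N0 [hN hA].
have /boolp.choice[c hc] : forall j, exists p, j < M -> p < Q /\ P p && A j p.
  move=> j; case: (ltnP j M) => [/hA[p h1 h2]|h]; last by exists 0.
  by exists p.
have c_lt j : j < M -> c j < Q by case/hc.
have c_P j : j < M -> P (c j) by case/hc => _ /andP[].
have c_A j : j < M -> A j (c j) by case/hc => _ /andP[].
pose f := wflow P c.
exists (fun e => f e); split.
- split=> [e|v vs vt].
    have /= lt := ltn_ord e; rewrite /= /f /wflow /grid_capacity.
    case: ifP => hn.
      apply: wh_cap => //; last by rewrite ltn_mod.
      by rewrite ltn_divLR // -n1E; lia.
    apply: wv_cap => //; last by rewrite ltn_mod.
    by rewrite -ltnS ltn_divLR // -n1C; lia.
  have lt : v < Q.+2 * C by rewrite -n1E; exact: (ltn_ord v).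
  rewrite spiral_in // spiral_out //=.
  rewrite (divn_eq v C) grid_in ?grid_out ?ltn_mod //; last exact: wflow_hlast.
  apply: wflow_balance; rewrite ?ltn_mod ?ltn_divLR //.
    move: vs; rewrite -val_eqE /= inordK // {1}(divn_eq v C).
    by rewrite addn_eq0 muln_eq0 orbF negb_and.
  move: vt; rewrite -val_eqE /= inordK; last by rewrite n1E /C mulSn; lia.
  rewrite {1}(divn_eq v C); case: (eqVneq (v %/ C) 0) => // ->.
  by rewrite mul0n.
- rewrite -[X in X <= _]/(\sum_(e < n + (n.+1 - C) | 0 < f e) grid_cost e) grid_total_cost.
  (* The budget is used up exactly: [N] edges in each of the [M + 1] gaps and in each of the [M]
     sets. *)
  rewrite leq_eqVlt; apply/orP; left; apply/eqP; rewrite /= /grid_budget.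
  have Psum : \sum_(1 <= r < Q.+1) P r.-1 = N by rewrite big_add1 /= big_mkord.
  rewrite (eq_bigr (fun=> K * N)); last first.
    move=> j _; rewrite -Psum; congr (_ * _); apply: eq_big_nat => r hr.
    rewrite wflow_h; [|lia|by have := ltn_ord j; rewrite /C; lia].
    rewrite /wh odd_double /=.
    have -> : (j.*2 == M.*2.+1) = false by apply/eqP; lia.
    have -> : (r == 0) = false by apply/eqP; lia.
    have -> : (r == Q.+1) = false by apply/eqP; lia.
    by case: (P _).
  rewrite [X in _ + X](eq_bigr (fun=> N)); last first.
    move=> j _; rewrite -Psum; apply: eq_big_nat => r hr.
    have hj := ltn_ord j.
    rewrite wflow_h; [|lia|by rewrite /C; lia].
    rewrite /wh /= odd_double /= uphalf_double.
    have -> : (j.*2.+1 == M.*2.+1) = false by apply/eqP; lia.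
    have -> : (r == 0) = false by apply/eqP; lia.
    have -> : (r == Q.+1) = false by apply/eqP; lia.
    case: eqP => [->|_] /=; first by rewrite c_P.
    by case: (P _).
  by rewrite !sum_nat_const !card_ord; lia.
- rewrite spiral_in // spiral_out //= inordK // /on_last mod0n /=.
  rewrite !add0n !addn0.
  have h1 := @wflow_h P c 0 0 isT isT; have h2 := @wflow_v P c 0 0 isT isT.
  move: h1 h2; rewrite /grid_h /grid_v mul0n addn0 => -> ->.
  by rewrite /wh /wv /= subn0 (rest0 hN); lia.
Qed.

Lemma grid_instanceP : 0 < N -> (nat_yes grid_instance <-> exists P, hits P).
Proof. by move=> N0; split=> [|[P]]; [exact: hits_of_yes|exact: yes_of_hits]. Qed.

End Grid.

(** * Counting connected components *)

Section Components.
Variables (T : finType) (e : rel T).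
Hypothesis e_sym : connect_sym e.

Lemma connect_label (U : Type) (r : T -> U) : (forall x y, e x y -> r x = r y) ->
  forall x y, connect e x y -> r x = r y.
Proof.
move=> h x y /connectP[p hp ->]; elim: p x hp => //= z p IH x /andP[hz hp].
by rewrite (h _ _ hz); apply: IH.
Qed.

(** Replaces the canonical roots of the library by any choice of representatives. The same count is
    performed on certificates by [labelled_sound]. *)
Lemma n_comp_roots (r : T -> T) : (forall x y, e x y -> r x = r y) ->
  (forall x, connect e x (r x)) -> n_comp e predT = #|[pred x | r x == x]|.
Proof.
move=> h1 h2; have hc := connect_label h1.
have inj : {in roots e &, injective r}.
  move=> x y /eqP hx /eqP hy hr; rewrite -hx -hy; apply/eqP; rewrite root_connect //.
  by apply: connect_trans (h2 x) _; rewrite hr e_sym.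
have -> : n_comp e predT = #|image r (roots e)|.
  rewrite (card_in_image inj) /n_comp_mem; apply: eq_card => x.
  by rewrite !inE andbT.
apply: eq_card => y; rewrite [RHS]inE; apply/imageP/eqP => [[x _ ->]|hy].
  exact/esym/hc/h2.
exists (fingraph.root e y); first exact: roots_root.
by rewrite -(hc _ _ (connect_root e y)).
Qed.

(** Invariant labels give at least [N] components, and paths to the canonical points give at most
    [N]. It is applied to the vertices, the faces and the single component of the grid. *)
Lemma n_comp_labels N (lab : T -> nat) (canon : nat -> T) :
  (forall x y, e x y -> lab x = lab y) -> (forall x, lab x < N) ->
  (forall i, i < N -> lab (canon i) = i) -> (forall x, connect e x (canon (lab x))) ->
  n_comp e predT = N.
Proof.
move=> h1 h2 h3 h4; rewrite (n_comp_roots (r := fun x => canon (lab x))) //; last first.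
  by move=> x y /h1 ->.
have inj : injective (fun i : 'I_N => canon i).
  by move=> i j E; apply: val_inj; rewrite /= -(h3 i) // -(h3 j) // E.
rewrite -[RHS](card_ord N) -(card_codom inj); apply: eq_card => x.
rewrite inE; apply/eqP/codomP => [hx|[i ->]]; last by rewrite h3.
by exists (Ordinal (h2 x)).
Qed.

End Components.

(** * Planarity of the grid *)

Section SpiralPlanar.
Variables (n C : nat) (flipped : nat -> bool).
Hypotheses (C_gt1 : 1 < C) (C_le : C <= n).
Let G := spiral n C flipped.

Inductive side := East | North | West | South.

(* A dart is identified by the direction in which it leaves its vertex. *)
Definition key : Type := (side * nat)%type.

Definition valid (k : key) : bool :=
  match k with
  | (East, v) => v < n | (North, v) => C <= v <= n
  | (West, v) => 0 < v <= n | (South, v) => v + C <= n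
  end.

Definition key_of (d : dart G) : key :=
  let e := val d.1 in
  if e < n then if d.2 then (West, e.+1) else (East, e)
  else if d.2 == flipped (e - n) then (South, e - n) else (North, e - n + C).

Lemma edge0_lt : 0 < nb_edges G.
Proof. by rewrite /= addn_gt0; apply/orP; left; lia. Qed.

Definition dart_of (k : key) : dart G :=
  match k with
  | (East, v) => (insubd (Ordinal edge0_lt) v, false)
  | (North, v) => (insubd (Ordinal edge0_lt) (n + (v - C)), ~~ flipped (v - C))
  | (West, v) => (insubd (Ordinal edge0_lt) v.-1, true)
  | (South, v) => (insubd (Ordinal edge0_lt) (n + v), flipped v)
  end.

Arguments dart_of : simpl never.

Lemma key_valid d : valid (key_of d).
Proof.
rewrite /key_of; have /= lt := ltn_ord d.1.
by case: ifP => h1; [case: ifP|case: ifP]; rewrite /valid; lia.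
Qed.

Lemma dart_ofK k : valid k -> key_of (dart_of k) = k.
Proof.
case: k => -[] v /= hv; rewrite /key_of /dart_of /= val_insubd /=.
- by have -> : v < n + (n.+1 - C) by [lia]; rewrite hv.
- have -> : n + (v - C) < n + (n.+1 - C) by lia.
  rewrite ltnNge leq_addr /= addKn subnK; last lia.
  by case: (flipped _).
- have -> : v.-1 < n + (n.+1 - C) by lia.
  have -> : v.-1 < n by lia.
  by rewrite prednK //; lia.
- have -> : n + v < n + (n.+1 - C) by lia.
  by rewrite ltnNge leq_addr /= addKn eqxx.
Qed.

Lemma key_ofK d : dart_of (key_of d) = d.
Proof.
case: d => e b; rewrite /key_of /dart_of /=; have /= lt := ltn_ord e.
case: ltnP => h.
  by case: b => /=; congr pair; apply: val_inj; rewrite val_insubd /= lt.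
case: eqP => hb /=; rewrite ?addnK subnKC //; congr pair; rewrite ?hb //;
  try by apply: val_inj; rewrite val_insubd /= lt.
by move: hb; case: b; case: (flipped _).
Qed.

Lemma key_inj d d' : key_of d = key_of d' -> d = d'.
Proof. by move=> h; rewrite -(key_ofK d) h key_ofK. Qed.

Lemma key_vertex d : dart_vertex d = (key_of d).2 :> nat.
Proof.
case: d => e b; rewrite /dart_vertex /key_of; case: b.
  rewrite spiral_headE // /spiral_head /=.
  by case: ifP => // _; case: (flipped _).
rewrite spiral_tailE // /spiral_tail /=.
by case: ifP => // _; case: (flipped _).
Qed.

Definition flip_key (k : key) : key :=
  match k with
  | (East, v) => (West, v.+1) | (North, v) => (South, v - C)
  | (West, v) => (East, v.-1) | (South, v) => (North, v + C)
  end.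

Lemma key_flip d : key_of (flip d) = flip_key (key_of d).
Proof.
case: d => e b; rewrite /flip /key_of /=.
case: ltnP => h; first by case: b.
by case: b; case: (flipped _) => //=; rewrite addnK.
Qed.

(** The next dart counterclockwise, skipping the directions in which the vertex has no edge. *)
Definition turn (k : key) : key :=
  match k with
  | (East, v) => (if C <= v then North else if 0 < v then West else South, v)
  | (North, v) => (West, v)
  | (West, v) => (if v + C <= n then South else if v < n then East else North, v)
  | (South, v) => (East, v)
  end.

Lemma turn_valid k : valid k -> valid (turn k).
Proof. by case: k => -[] v /=; do 2?[case: ifP => ?]; rewrite /valid; lia. Qed.

Lemma turn_inj k k' : valid k -> valid k' -> turn k = turn k' -> k = k'.
Proof.
case: k k' => -[] v [[] v'] hv hv' /=; do 4?[case: ifP => ?]; move=> [] // e;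
  subst; try congruence; exfalso; move: hv hv'; rewrite /valid; lia.
Qed.

Definition turn_dart (d : dart G) : dart G := dart_of (turn (key_of d)).

Lemma key_turn d : key_of (turn_dart d) = turn (key_of d).
Proof. by rewrite dart_ofK // turn_valid // key_valid. Qed.

Lemma turn_dart_inj : injective turn_dart.
Proof.
move=> d d' /(congr1 key_of); rewrite !key_turn => /turn_inj h.
by apply: key_inj; apply: h; apply: key_valid.
Qed.

Definition spiral_rotation : {perm dart G} := perm turn_dart_inj.

Lemma key_rotation d : key_of (spiral_rotation d) = turn (key_of d).
Proof. by rewrite permE key_turn. Qed.

Lemma key_face d : key_of (face_step spiral_rotation d) = turn (flip_key (key_of d)).
Proof. by rewrite /face_step key_rotation key_flip. Qed.

Lemma face_step_inj : injective (face_step spiral_rotation).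
Proof.
move=> d d' /perm_inj /(congr1 key_of); rewrite !key_flip => h; apply: key_inj.
move: h (key_valid d) (key_valid d').
case: (key_of d) (key_of d') => -[] v [[] v'] //= [e]; rewrite /valid => *;
  congr pair; lia.
Qed.

Definition vertex_key (v : nat) : key := if v < n then (East, v) else (North, n).

Lemma vertex_key_valid v : v <= n -> valid (vertex_key v).
Proof. by rewrite /vertex_key; case: ifP => ? ?; rewrite /valid; lia. Qed.

Lemma vertex_connect d :
  fconnect spiral_rotation d (dart_of (vertex_key (key_of d).2)).
Proof.
have step d1 : fconnect spiral_rotation d1 (dart_of (turn (key_of d1))).
  by rewrite -key_rotation key_ofK; apply: fconnect1.
have south v : v + C <= n -> fconnect spiral_rotation (dart_of (South, v)) (dart_of (East, v)).
  by move=> hv; have := step (dart_of (South, v)); rewrite dart_ofK.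
have west v : 0 < v <= n -> fconnect spiral_rotation (dart_of (West, v)) (dart_of (vertex_key v)).
  move=> hv; have := step (dart_of (West, v)); rewrite dart_ofK //= /vertex_key.
  case: ifP => h1; first by move=> h; have -> : v < n by [lia]; apply: connect_trans h (south _ h1).
  case: ifP => h2 //; have -> : v = n by lia.
  by [].
have := key_valid d; rewrite -{2}(key_ofK d); case: (key_of d) => -[] v hv.
- by rewrite /vertex_key /=; have -> : v < n by []; apply: connect0.
- have := step (dart_of (North, v)); rewrite dart_ofK //= => h.
  by apply: connect_trans h (west _ _); move: hv; rewrite /valid; lia.
- exact: west.
- have -> : (vertex_key (South, v).2) = (East, v); last exact: south.
  by rewrite /vertex_key /=; move: hv; rewrite /valid; case: ltnP => //; lia.
Qed.

Lemma vertex_turn k : (turn k).2 = k.2.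
Proof. by case: k => -[]. Qed.

Lemma spiral_vertices : fcard spiral_rotation predT = n.+1.
Proof.
apply: (@n_comp_labels _ _ _ n.+1 (fun d => (key_of d).2) (fun v => dart_of (vertex_key v))).
- exact/fconnect_sym/perm_inj.
- by move=> d d' /eqP <-; rewrite key_rotation vertex_turn.
- move=> d; have := key_valid d; case: (key_of d) => -[] v; rewrite /valid /=; lia.
- move=> i hi; rewrite dart_ofK ?vertex_key_valid // /vertex_key; case: ifP => //=; lia.
- exact: vertex_connect.
Qed.

Lemma spiral_rotation_system : rotation_system spiral_rotation.
Proof.
move=> d d'; apply/idP/eqP => [h|h].
  apply: val_inj; rewrite /= !key_vertex.
  apply: (connect_label (r := fun d => (key_of d).2) _ h) => x y /eqP <-.
  by rewrite key_rotation vertex_turn.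
apply: connect_trans (vertex_connect d) _; rewrite fconnect_sym; last exact: perm_inj.
by rewrite -key_vertex h key_vertex; apply: vertex_connect.
Qed.

(** A face with four sides is labelled by its smallest vertex [v], where [v + 1 + C <= n]. The
    labels [n - C] and [n - C + 1] are those of the two ends of the cylinder, near the vertices 0
    and [n]. *)
Definition face_label (k : key) : nat :=
  match k with
  | (East, v) => if v.+1 + C <= n then v else n - C + 1
  | (South, v) => if 0 < v then v.-1 else n - C
  | (West, v) => if C < v then v - C.+1 else n - C
  | (North, v) => if v < n then v - C else n - C + 1
  end.

Definition face_key (i : nat) : key :=
  if i < n - C then (East, i) else if i == n - C then (South, 0) else (North, n).

Lemma face_key_valid i : i < n - C + 2 -> valid (face_key i).
Proof. by rewrite /face_key; do 2?[case: ifP => ?]; rewrite /valid; lia. Qed.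

Lemma face_label_step k : valid k -> face_label (turn (flip_key k)) = face_label k.
Proof.
by case: k => -[] v /=; do 3?[case: ifP => ?]; rewrite /valid /face_label //=;
  do 2?[case: ifP => ?]; lia.
Qed.

(** Within a face with four sides, a few steps lead to its [East] dart. Around an end of the
    cylinder, the walk goes west down to vertex 0 or east up to vertex [n], hence the two
    inductions. *)
Lemma face_connect d :
  fconnect (face_step spiral_rotation) d (dart_of (face_key (face_label (key_of d)))).
Proof.
have step k : valid k ->
    fconnect (face_step spiral_rotation) (dart_of k) (dart_of (turn (flip_key k))).
  move=> hk; rewrite -{2}(dart_ofK hk) -key_face key_ofK; exact: fconnect1.
have north v : C <= v <= n -> fconnect (face_step spiral_rotation) (dart_of (North, v))
   (dart_of (face_key (face_label (North, v)))).
  move=> hv; rewrite /face_label /face_key; case: (ltnP v n) => h1.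
    have -> : v - C < n - C by lia.
    exact: (step (North, v)).
  have -> : v = n by lia.
  by have [-> ->] : (n - C + 1 < n - C) = false /\ (n - C + 1 == n - C) = false by split; lia.
have west v : 0 < v <= n -> fconnect (face_step spiral_rotation) (dart_of (West, v))
   (dart_of (face_key (face_label (West, v)))).
  elim: v => // v IH hv; have h := step (West, v.+1) hv.
  case: (leqP C v) => h1.
    have e1 : turn (flip_key (West, v.+1)) = (North, v) by rewrite /= h1.
    have -> : face_label (West, v.+1) = face_label (North, v).
      by rewrite /=; do 2?[case: ifP => ?]; lia.
    by rewrite e1 in h; apply: connect_trans h (north _ _); lia.
  case: (posnP v) => v0.
    have e1 : turn (flip_key (West, v.+1)) = (South, 0) by rewrite /= leqNgt h1 /= v0.
    have -> : face_key (face_label (West, v.+1)) = (South, 0); last by rewrite -e1.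
    by rewrite /= ltnS leqNgt h1 /face_key ltnn eqxx.
  have e1 : turn (flip_key (West, v.+1)) = (West, v) by rewrite /= leqNgt h1 /= v0.
  have -> : face_label (West, v.+1) = face_label (West, v).
    by rewrite /=; do 2?[case: ifP => ?]; lia.
  by rewrite e1 in h; apply: connect_trans h (IH _); lia.
have south v : v + C <= n -> fconnect (face_step spiral_rotation) (dart_of (South, v))
   (dart_of (face_key (face_label (South, v)))).
  move=> hv; have h := step (South, v) hv; case: (posnP v) => v0.
    have -> : face_key (face_label (South, v)) = (South, v); last exact: connect0.
    by rewrite v0 /= /face_key ltnn eqxx.
  have -> : face_label (South, v) = face_label (West, v + C).
    by rewrite /=; do 2?[case: ifP => ?]; lia.
  by apply: connect_trans h (west _ _); lia.
have east k : forall v, v + k.+1 = n -> fconnect (face_step spiral_rotation) (dart_of (East, v))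
   (dart_of (face_key (face_label (East, v)))).
  elim: k => [|k IH] v hv; have hvn : valid (East, v) by [rewrite /valid; lia];
    have h := step (East, v) hvn; case: (leqP (v.+1 + C) n) => h1; try lia.
  - have e1 : turn (flip_key (East, v)) = (North, n).
      by rewrite /= [_ <= n]leqNgt h1 /=; have -> : v.+1 = n by [lia]; rewrite ltnn.
    have -> : face_key (face_label (East, v)) = (North, n); last by rewrite -e1.
    rewrite /= [_ <= n]leqNgt h1 /face_key.
    by have [-> ->] : (n - C + 1 < n - C) = false /\ (n - C + 1 == n - C) = false by split; lia.
  - have e1 : turn (flip_key (East, v)) = (South, v.+1) by rewrite /= h1.
    have -> : face_label (East, v) = face_label (South, v.+1) by rewrite /= h1.
    by rewrite e1 in h; apply: connect_trans h (south _ _).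
  - have e1 : turn (flip_key (East, v)) = (East, v.+1).
      by rewrite /= [_ <= n]leqNgt h1 /=; have -> : v.+1 < n by lia.
    have -> : face_label (East, v) = face_label (East, v.+1).
      by rewrite /=; do 2?[case: ifP => ?]; lia.
    by rewrite e1 in h; apply: connect_trans h (IH _ _); lia.
have := key_valid d; rewrite -{2}(key_ofK d); case: (key_of d) => -[] v hv.
- by apply: (east (n - v).-1); move: hv; rewrite /valid; lia.
- exact: north.
- exact: west.
- exact: south.
Qed.

Lemma spiral_faces : fcard (face_step spiral_rotation) predT = n - C + 2.
Proof.
apply: (@n_comp_labels _ _ _ (n - C + 2) (fun d => face_label (key_of d)) (fun v => dart_of (face_key v))).
- exact/fconnect_sym/face_step_inj.
- by move=> d d' /eqP <-; rewrite key_face face_label_step // key_valid.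
- move=> d; have := key_valid d; case: (key_of d) => -[] v; rewrite /valid /=; case: ifP; lia.
- move=> i hi; rewrite dart_ofK ?face_key_valid // /face_key.
  by case: ifP => h1 /=; [|case: ifP => h2 /=; rewrite ?ltnn]; try case: ifP; lia.
- exact: face_connect.
Qed.

End SpiralPlanar.

(** The relation itself is not symmetric, but a step along the permutation [rot] is undone by
    completing its cycle. *)
Lemma dart_link_sym (G : digraph) (rot : {perm dart G}) : connect_sym (dart_link rot).
Proof.
have sub d d' : fconnect rot d d' -> connect (dart_link rot) d d'.
  by apply: connect_sub => x y /eqP <-; apply: connect1; rewrite /dart_link eqxx.
suff h d d' : connect (dart_link rot) d d' -> connect (dart_link rot) d' d.
  by move=> d d'; apply/idP/idP; apply: h.
case/connectP => p hp ->; elim: p d hp => [|d1 p IH] d /=; first by rewrite connect0.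
case/andP => h1 /IH hp; apply: connect_trans hp _.
case/orP: h1 => /eqP <-.
  by apply: sub; rewrite fconnect_sym; [exact: fconnect1|exact: perm_inj].
by apply: connect1; rewrite /dart_link /flip /= negbK orbC -surjective_pairing eqxx.
Qed.

(** * Connectedness, Euler's formula and the common face of the grid *)

Section SpiralPlanar2.
Variables (n C : nat) (flipped : nat -> bool).
Hypotheses (C_gt1 : 1 < C) (C_le : C <= n).
Let rot := spiral_rotation flipped C_gt1 C_le.
Let mk := @dart_of n C flipped C_gt1 C_le.

Lemma spiral_linked : n_comp (dart_link rot) predT = 1.
Proof.
pose start := mk (vertex_key n 0).
apply: (@n_comp_labels _ _ (dart_link_sym rot) 1 (fun=> 0) (fun=> start)) => //.
  by case.
have to_vertex d : connect (dart_link rot) d (mk (vertex_key n (key_of d).2)).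
  have := vertex_connect C_gt1 C_le d.
  by apply: connect_sub => x y /eqP <-; apply: connect1; rewrite /dart_link eqxx.
move=> d; apply: connect_trans (to_vertex d) _.
have : (key_of d).2 <= n.
  have := key_valid C_gt1 C_le d; case: (key_of d) => -[] v; rewrite /valid /=; lia.
elim: (key_of d).2 => [|v IH] hv; first exact: connect0.
apply: connect_trans (IH (ltnW hv)); rewrite dart_link_sym.
have -> : vertex_key n v = (East, v) by rewrite /vertex_key hv.
have h1 : connect (dart_link rot) (mk (East, v)) (flip (mk (East, v))).
  by apply: connect1; rewrite /dart_link eqxx orbT.
apply: connect_trans h1 _.
have := to_vertex (flip (mk (East, v))).
by rewrite key_flip dart_ofK.
Qed.

Lemma spiral_planar : planar_rotation rot.
Proof.
split; first exact: spiral_rotation_system.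
rewrite spiral_vertices spiral_faces spiral_linked /=; lia.
Qed.

(** The end of the cylinder with label [n - C] touches all vertices from 0 to [C]. *)
Lemma spiral_common_face (s t : vertex (spiral n C flipped)) : s = 0 :> nat -> 0 < t <= C ->
  on_common_face rot s t.
Proof.
move=> hs ht _; have hT := @face_connect n C flipped C_gt1 C_le.
exists (mk (South, 0)), (mk (West, nat_of_ord t)).
have v1 : valid n C (South, 0) by rewrite /valid add0n.
have v2 : valid n C (West, nat_of_ord t) by rewrite /valid; move: (nat_of_ord t) ht; lia.
have hv k : valid n C k -> dart_vertex (mk k) = k.2 :> nat.
  by move=> vk; rewrite (key_vertex C_gt1); congr snd; exact: dart_ofK.
split.
- by apply: val_inj; apply: etrans (hv _ v1) (esym hs).
- by apply: val_inj; apply: hv v2.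
have h1 := hT (mk (South, 0)); have h2 := hT (mk (West, nat_of_ord t)).
rewrite dart_ofK // in h1; rewrite dart_ofK // in h2.
apply: connect_trans h1 _; rewrite fconnect_sym; last exact: face_step_inj.
move: h2; rewrite /face_label; have -> : (C < t) = false; last by [].
by move: (nat_of_ord t) ht; lia.
Qed.

End SpiralPlanar2.

(** * Hitting sets for local constraints *)

Section Constraints.
Variables (N q : nat) (nb : nat -> nat -> nat) (rel : nat -> nat -> bool).
Hypotheses (N_gt0 : 0 < N) (nb_lt : forall k j, j < N -> nb k j < N).

Definition digit (k code : nat) : nat := code %/ q ^ k %% q.

Definition code4 (w : nat -> nat) : nat := w 0 + (w 1 + (w 2 + w 3 * q) * q) * q.

Lemma digit_code4 w k : (forall k, w k < q) -> k < 4 -> digit k (code4 w) = w k.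
Proof.
move=> h; have q0 : 0 < q := leq_ltn_trans (leq0n _) (h 0).
have e a b : a < q -> (a + b * q) %/ q = b.
  by move=> ha; rewrite addnC divnMDl // divn_small // addn0.
have e' a b : a < q -> (a + b * q) %% q = a by move=> ha; rewrite addnC modnMDl modn_small.
rewrite /digit /code4; case: k => [|[|[|[|//]]]] _; rewrite ?expn0 ?divn1 ?e' //.
- by rewrite expn1 e // e'.
- by rewrite expnS expn1 divnMA !e // e'.
- by rewrite !expnS expn0 muln1 !divnMA !e // modn_small.
Qed.

Lemma code4_lt w : (forall k, w k < q) -> code4 w < q ^ 4.
Proof.
move=> h; have e a b m : a < q -> b < m -> a + b * q < m * q.
  by move=> ha hb; apply: (@leq_trans (b.+1 * q)); [rewrite mulSn ltn_add2r|rewrite leq_mul2r hb orbT].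
by rewrite /code4 !expnSr expn0 mul1n; do 3![apply: (e) => //].
Qed.

(* The first [N] columns force one value per variable, every other column
   excludes one combination of values of four variables. *)
Definition clause (j p : nat) : bool :=
  if j < N then p %/ q == j
  else let j' := (j - N) %/ q ^ 4 in let code := (j - N) %% q ^ 4 in
    rel j' code || bex 4 (fun k => (p %/ q == nb k j') && (p %% q != digit k code)).

(** Lane [a * q + b] means that variable [a] has value [b]. The first [N] sets are disjoint and only
    [N] lanes are chosen, so every variable gets exactly one value. The set of an excluded
    combination is then missed only if the four values are those of the combination. *)
Lemma clauseP :
  (exists P, hits N (N * q) (N + N * q ^ 4) clause P) <->
  (exists g : nat -> nat, (forall j, g j < q) /\
     forall j, j < N -> rel j (code4 (fun k => g (nb k j)))).
Proof.
split=> [[P [hP hit]]|[g [gq hg]]]; last first.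
  have q0 : 0 < q := leq_ltn_trans (leq0n _) (gq 0).
  have cell j : j < N -> j * q + g j < N * q.
    by move=> hj; apply: (@leq_trans (j.+1 * q)); [rewrite mulSnr ltn_add2l|rewrite leq_mul2r hj orbT].
  have dv j : (j * q + g j) %/ q = j by rewrite divnMDl // divn_small // addn0.
  have md j : (j * q + g j) %% q = g j by rewrite modnMDl modn_small.
  exists (fun p => p %% q == g (p %/ q)); split.
    rewrite (@sum_mul N q (fun p => nat_of_bool (p %% q == g (p %/ q)))).
    rewrite -[RHS]muln1 -[X in X * _]card_ord -sum_nat_const; apply: eq_bigr => i _.
    rewrite (bigD1 (Ordinal (gq i))) //= md dv eqxx big1 ?addn0 // => a ha.
    rewrite modnMDl modn_small // divnMDl // divn_small // addn0.
    by move: ha; rewrite -val_eqE /=; case: (_ == _).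
  move=> j hj; rewrite /clause; case: ltnP => hjN.
    by exists (j * q + g j); rewrite ?cell // md dv !eqxx.
  set j' := _ %/ _; set code := _ %% _.
  have hj' : j' < N by rewrite ltn_divLR ?expn_gt0 ?q0 // ltn_subLR.
  case hr: (rel j' code).
    (* The set of an admissible combination contains all lanes, so any chosen lane hits it. *)
    by exists (0 * q + g 0); rewrite ?cell // md dv !eqxx.
  have [k k4 hk] : exists2 k, k < 4 & g (nb k j') != digit k code.
    apply/bexP; apply: contraFT hr => /existsPn h.
    suff -> : code = code4 (fun k => g (nb k j')) by apply: hg.
    have e k : k < 4 -> g (nb k j') = digit k code.
      by move=> k4; apply/eqP; have := h (Ordinal k4); rewrite negbK.
    rewrite /code4 !e // /digit expn0 divn1 expn1.
    have c4 : code < q ^ 4 by rewrite ltn_mod expn_gt0 q0.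
    have e3 : code %/ q ^ 3 %% q = code %/ q ^ 3.
      by rewrite modn_small // ltn_divLR ?expn_gt0 ?q0 // -expnS.
    have e2 : code %/ q ^ 3 = code %/ q ^ 2 %/ q by rewrite -divnMA -expnSr.
    have e1 : code %/ q ^ 2 = code %/ q %/ q by rewrite -divnMA.
    rewrite e3 e2.
    have d m : m %% q + m %/ q * q = m by rewrite addnC -divn_eq.
    by rewrite d e1 d d.
  exists (nb k j' * q + g (nb k j')); first by rewrite cell // nb_lt.
  by rewrite md dv eqxx /=; apply/bexP; exists k; rewrite // eqxx.
have q0 : 0 < q.
  by case: (posnP q) hP => // ->; rewrite muln0 big_ord0; move: N_gt0; case: N.
pose s j := \sum_(a < q) P (j * q + a).
have sge j : j < N -> 0 < s j.
  move=> hj; have [|p hp /andP[Pp]] := hit j; first by rewrite ltn_addr.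
  rewrite /clause hj => /eqP ej.
  rewrite /s (bigD1 (Ordinal (ltn_pmod p q0))) //= -{1}ej -divn_eq Pp.
  by [].
have s1 j : j < N -> s j = 1.
  move: hP; rewrite (@sum_mul N q (fun p => nat_of_bool (P p))) => hP hj.
  have hle : \sum_(i < N) (s i - 1) = 0.
    apply: (@addIn (\sum_(i < N) 1)); rewrite -big_split /= add0n sum_nat_const card_ord muln1 -[RHS]hP.
    by apply: eq_bigr => i _; rewrite subnK // sge.
  move: hle; rewrite (bigD1 (Ordinal hj)) //= => /eqP.
  by rewrite addn_eq0 => /andP[/eqP h _]; have := sge j hj; lia.
have hex j : j < N -> exists a : 'I_q, P (j * q + a).
  move=> hj; have := sge j hj; rewrite /s lt0n sum_nat_eq0 negb_forall => /existsP[a ha].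
  by exists a; move: ha; case: (P _).
pose g j := if j < N then if [pick a : 'I_q | P (j * q + a)] is Some a then nat_of_ord a else 0 else 0.
have gq j : g j < q by rewrite /g; case: ifP => // _; case: pickP.
exists g; split=> // j hj.
set w := fun k => g (nb k j).
have cw : code4 w < q ^ 4 by apply: code4_lt => k; apply: gq.
have [|p hp /andP[Pp]] := hit (N + (j * q ^ 4 + code4 w)).
  rewrite ltn_add2l; apply: (@leq_trans (j.+1 * q ^ 4)); first by rewrite mulSnr ltn_add2l.
  by rewrite leq_mul2r hj orbT.
rewrite /clause ltnNge leq_addr /= addKn divnMDl ?expn_gt0 ?q0 // divn_small // addn0 modnMDl modn_small //.
case/orP => // /bexP[k k4 /andP[/eqP ep]].
rewrite digit_code4 // => [|k']; last exact: gq.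
rewrite /w /g nb_lt //; case: pickP => [a ha|/(_ (Ordinal (ltn_pmod p q0)))]; last first.
  by rewrite /= -ep -divn_eq Pp.
case/eqP; have := s1 _ (nb_lt k hj); rewrite /s (bigD1 a) //= ha.
case: (eqVneq a (Ordinal (ltn_pmod p q0))) => [-> //|ne].
rewrite (bigD1 (Ordinal (ltn_pmod p q0))) /= 1?eq_sym // -{1}ep -divn_eq Pp.
by [].
Qed.

End Constraints.

(** * Computation tables *)

Lemma horner_leq (p : {poly nat}) m n : m <= n -> p.[m]%R <= p.[n]%R.
Proof.
move=> h; elim/poly_ind: p => [|p c IH]; first by rewrite !horner0.
rewrite !hornerMXaddC; exact: leq_add (leq_mul IH h) (leqnn _).
Qed.

Lemma run_leq (M : machine) m n x y : m <= n -> halting (@run M m x y).1 ->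
  @run M n x y = @run M m x y.
Proof.
move=> h; rewrite -(subnK h) /run iterD; elim: (n - m) => //= k IH hh.
by rewrite IH // {1}/step hh.
Qed.

(** This recovers the certificate from tape 1 in the first row of a table, where local constraints
    forbid a bit after a blank. *)
Lemma symbols_word (G : finType) (s : seq (symbol G)) :
  (forall i, i < size s -> nth None s i = None \/ exists b, nth None s i = Some (inl b)) ->
  (forall i, i.+1 < size s -> nth None s i = None -> nth None s i.+1 = None) ->
  exists y : seq bool, forall i, i < size s ->
    nth None s i = nth None [seq Some (inl b) | b <- y] i.
Proof.
elim: s => [|a s IH] h1 h2; first by exists [::].
have [y hy] : exists y : seq bool, forall i, i < size s ->
    nth None s i = nth None [seq Some (inl b) | b <- y] i.
  apply: IH => i hi; [exact: (h1 i.+1)|exact: (h2 i.+1)].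
case: (h1 0) => //= [ea|[b ->]]; last by exists (b :: y) => -[|i] //=; exact: hy.
exists [::] => i hi; rewrite nth_nil; elim: i hi => // i IHi hi.
by apply: h2 => //; apply: IHi; apply: ltnW.
Qed.

Section Tableau.
Variable M : machine.
Let S := state M.
Let sym := symbol (extra_symbol M).
Let tapes := 'I_(work_tapes M).+2.

(* One square of the computation table records, at a given time, the state,
   the symbols under all heads, and for every tape the symbol of one cell
   together with the presence of the head. *)
Definition square : finType := (S * {ffun tapes -> sym} * {ffun tapes -> sym * bool})%type.

Definition sq_state (d : square) : S := d.1.1.
Definition sq_read (d : square) : {ffun tapes -> sym} := d.1.2.
Definition sq_symbol (d : square) (u : tapes) : sym := (d.2 u).1.
Definition sq_head (d : square) (u : tapes) : bool := (d.2 u).2.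

Definition next_state (d : square) : S :=
  if halting (sq_state d) then sq_state d else (transition (sq_state d) (sq_read d)).1.

Definition next_symbol (d : square) (u : tapes) : sym :=
  if halting (sq_state d) then sq_symbol d u
  else if sq_head d u then ((transition (sq_state d) (sq_read d)).2 u).1 else sq_symbol d u.

(** In a border column the missing neighbour is replaced by the square itself, hence the guards. A
    head that moves left from cell 0 stays there. *)
Definition next_head (leftmost rightmost : bool) (l d r : square) (u : tapes) : bool :=
  if halting (sq_state d) then sq_head d u
  else match ((transition (sq_state d) (sq_read d)).2 u).2 with
  | Left => ~~ rightmost && sq_head r u || leftmost && sq_head d u
  | Stay => sq_head d u
  | Right => ~~ leftmost && sq_head l u
  end.

Definition word_symbol (inside b : bool) : sym := if inside then Some (inl b) else None.

(* [k] lists: first column, last column, first row, last row, column within x,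
   bit of x, column within the certificate. *)
Definition square_ok (k : nat -> bool) (l d r next : square) : bool :=
  [&& ~~ k 1 ==> (sq_state d == sq_state r) && (sq_read d == sq_read r),
      [forall u, sq_head d u ==> (sq_read d u == sq_symbol d u)],
      ~~ k 3 ==> (sq_state next == next_state d) &&
         [forall u, (sq_symbol next u == next_symbol d u) &&
                    (sq_head next u == next_head (k 0) (k 1) l d r u)],
      k 2 ==> (sq_state d == start M) &&
         [forall u : tapes, (sq_head d u == k 0) &&
           (if nat_of_ord u == 0 then sq_symbol d u == word_symbol (k 4) (k 5)
            else if nat_of_ord u == 1 then
              [|| sq_symbol d u == None | k 6 && [exists b, sq_symbol d u == Some (inl b)]] &&
              (~~ k 1 ==> (sq_symbol d u == None) ==> (sq_symbol r u == None))
            else sq_symbol d u == None)] &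
      k 3 ==> accepting (sq_state d)].

Variables (x : seq bool) (q T : nat).

Definition kind (t i k : nat) : bool :=
  nth false [:: i == 0; i == T; t == 0; t == T; i < size x; nth false x i; i < q] k.

Definition table_ok (g : nat -> nat -> square) : Prop :=
  forall t i, t <= T -> i <= T ->
    square_ok (kind t i) (g t i.-1) (g t i) (g t (minn i.+1 T)) (g (minn t.+1 T) i).

Let conf y t := @run M t x y.

Lemma confS y t : conf y t.+1 = step (conf y t).
Proof. by []. Qed.

(** A head advances by at most one cell per step, so the columns up to [T] contain all heads up to
    time [T]. *)
Lemma run_head y t u : ((conf y t).2 u).2 <= t.
Proof.
elim: t => [//|t IH]; rewrite confS /step.
case: ifP => _; first exact: leqW.
have mv d h : move d h <= h.+1 by case: d => /=; lia.
by apply: (@leq_trans ((conf y t).2 u).2.+1); [exact: mv|].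
Qed.

Definition true_square y (t i : nat) : square :=
  ((conf y t).1, [ffun u => cell ((conf y t).2 u) ((conf y t).2 u).2],
   [ffun u => (cell ((conf y t).2 u) i, ((conf y t).2 u).2 == i)]).

Lemma step_symbol y t i u :
  cell ((conf y t.+1).2 u) i = next_symbol (true_square y t i) u.
Proof.
rewrite confS /step /next_symbol /sq_state /sq_head /sq_symbol /sq_read /= !ffunE /=.
case: ifP => // _; rewrite /= /cell /write /= nth_set_nth /= eq_sym.
by [].
Qed.

Lemma step_head y t i u : t < T -> i <= T ->
  (((conf y t.+1).2 u).2 == i) =
  next_head (i == 0) (i == T) (true_square y t i.-1) (true_square y t i)
    (true_square y t (minn i.+1 T)) u.
Proof.
move=> ht hi; have := run_head y t u.
rewrite confS /step /next_head /sq_state /sq_head /sq_read /= !ffunE /=.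
case: ifP => // _; rewrite /=.
move: ((conf y t).2 u).2 => h hh.
case: (_ u).2 => /=; lia.
Qed.

Lemma step_state y t i : (conf y t.+1).1 = next_state (true_square y t i).
Proof.
by rewrite confS /step /next_state /sq_state /sq_read /=; case: ifP.
Qed.

Lemma table_complete y : size y <= q -> accepting (conf y T).1 ->
  table_ok (true_square y).
Proof.
move=> hy acc t i ht hi; apply/and5P; split; rewrite /kind /=.
- by rewrite /sq_state /sq_read /= !eqxx implybT.
- by apply/forallP => u; rewrite /sq_head /sq_read /sq_symbol !ffunE /=; apply/implyP => /eqP ->.
- apply/implyP => hT; have lt : t < T by rewrite ltn_neqAle hT.
  rewrite (minn_idPl lt) -(step_state y t i) /sq_state eqxx /=.
  apply/forallP => u; rewrite -step_symbol // -step_head //.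
  by rewrite /sq_symbol /sq_head !ffunE /= !eqxx.
- apply/implyP => /eqP ->; rewrite /sq_state /= eqxx /=.
  apply/forallP => u; rewrite /sq_head /sq_symbol !ffunE /= [0 == i]eq_sym eqxx /=.
  case: u => -[|[|u]] hu; rewrite /cell /=.
  + rewrite /bits_on_tape /word_symbol; case: ltnP => h; first by rewrite (nth_map false).
    by rewrite nth_default // size_map.
  + rewrite /bits_on_tape.
    case: (ltnP i (size y)) => h.
      rewrite (nth_map false) // (leq_trans h hy) /=.
      apply/andP; split; last by rewrite implybT.
      by apply/existsP; exists (nth false y i).
    rewrite nth_default ?size_map // eqxx /=.
    by apply/implyP => h1; rewrite nth_default ?eqxx // size_map; move: h1; lia.
  + by rewrite nth_nil /= nth_nil.
- by apply/implyP => /eqP ->.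
Qed.

Lemma table_sound g : table_ok g ->
  exists2 y : seq bool, size y <= q & accepting (conf y T).1.
Proof.
move=> ok.
have okp t i : t <= T -> i <= T -> _ := fun ht hi => and5P (ok t i ht hi).
have one : 1 < (work_tapes M).+2 by [].
pose u1 : tapes := Ordinal one.
have row0 i : i <= T -> (forall u, sq_head (g 0 i) u = (i == 0)) /\
    [/\ sq_state (g 0 i) = start M,
      forall u : tapes, nat_of_ord u = 0 -> sq_symbol (g 0 i) u = word_symbol (i < size x) (nth false x i),
      forall u : tapes, 1 < u -> sq_symbol (g 0 i) u = None,
      sq_symbol (g 0 i) u1 = None \/ i < q /\ exists b, sq_symbol (g 0 i) u1 = Some (inl b)
    & i < T -> sq_symbol (g 0 i) u1 = None -> sq_symbol (g 0 i.+1) u1 = None].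
  move=> hi; case: (okp 0 i) => // _ _ _ + _.
  rewrite /kind /= => /andP[/eqP hst /forallP h].
  split; first by move=> u; case/andP: (h u) => /eqP.
  split=> //.
  - by move=> u hu; case/andP: (h u) => _; rewrite hu /= => /eqP.
  - by move=> u hu; case/andP: (h u) => _; case: (nat_of_ord u) hu => [|[|v]] //= _ /eqP.
  - case/andP: (h u1) => _ /= /andP[+ _].
    case/orP => [/eqP|/andP[hq /existsP[b /eqP]]]; first by left.
    by right; split=> //; exists b.
  - move=> lt e; case/andP: (h u1) => _ /= /andP[_].
    by rewrite e eqxx /= (minn_idPl lt) neq_ltn lt /= => /eqP.
pose s := mkseq (fun i => sq_symbol (g 0 i) u1) T.+1.
have [||y hy] := @symbols_word _ s.
- move=> i; rewrite size_mkseq => hi; rewrite nth_mkseq //.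
  by have [_ [_ _ _ [h|[_ h]] _]] := row0 i hi; [left|right].
- move=> i; rewrite size_mkseq => hi; rewrite !nth_mkseq // ?(ltnW hi) //.
  by have [_ [_ _ _ _]] := row0 i (ltnW hi); apply.
(* Columns from [q] on hold blanks on tape 1, so the truncated word still agrees with this tape in
   all columns of the table. *)
pose z := take (minn q T.+1) y.
have hz i : i <= T -> sq_symbol (g 0 i) u1 = nth None (bits_on_tape M z) i.
  move=> hi; have := hy i; rewrite size_mkseq => /(_ hi); rewrite nth_mkseq // => e.
  rewrite e /bits_on_tape /z map_take.
  case: (ltnP i q) => hq; first by rewrite nth_take // leq_min hq.
  rewrite [RHS]nth_default; last by rewrite size_take_min; lia.
  by have [_ [_ _ _ [h|[hq' _]] _]] := row0 i hi; [rewrite -e|move: hq'; rewrite ltnNge hq].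
exists z; first by rewrite size_take_min; lia.
have inv t : t <= T -> forall i, i <= T -> sq_state (g t i) = (conf z t).1 /\
    forall u, (sq_symbol (g t i) u = cell ((conf z t).2 u) i) /\
      (sq_head (g t i) u = (((conf z t).2 u).2 == i)).
  elim: t => [_ i hi|t IH lt i hi].
    have [hh [hst h0 h2 _ _]] := row0 i hi; split=> // u; split; last by rewrite hh eq_sym.
    case: (ltngtP u 1) => hu.
    - have hu0 : nat_of_ord u = 0 by lia.
      rewrite h0 // /cell /= hu0 /= /word_symbol /bits_on_tape.
      case: ltnP => h; first by rewrite (nth_map false).
      by rewrite nth_default // size_map.
    - rewrite h2 // /cell /=; case: (nat_of_ord u) hu => [|[|v]] //= _.
      by rewrite !nth_nil.
    - have -> : u = u1 by apply: val_inj.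
      by rewrite hz.
  have htT := ltnW lt.
  have same i' : i' <= T -> g t i' = true_square z t i'.
    (* The recorded scanned symbols are constant along a row and correct in the column of each head,
       which lies within the table. *)
    move=> hi'; have bcast j : j <= T -> sq_read (g t j) = sq_read (g t 0).
      elim: j => // j IHj hj; rewrite -IHj; last exact: ltnW.
      case: (okp t j) => //; first exact: ltnW.
      by rewrite /kind /= neq_ltn hj /= (minn_idPl hj) => /andP[_ /eqP ->].
    have hr : sq_read (g t i') = [ffun u => cell ((conf z t).2 u) ((conf z t).2 u).2].
      apply/ffunP => u; rewrite ffunE.
      have hd : ((conf z t).2 u).2 <= T by apply: leq_trans (run_head _ _ _) htT.
      have [_ hu] := IH htT _ hd; have [hs hh] := hu u.
      case: (okp t _ htT hd) => _ /forallP /(_ u).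
      rewrite hh eqxx /= hs => /eqP <- _ _ _.
      by rewrite bcast // -(bcast _ hd).
    have [hst hu] := IH htT _ hi'.
    rewrite /true_square -hr -hst; case: (g t i') hu => -[a b] c hu.
    congr (_, _, _); apply/ffunP => u; rewrite ffunE.
    have [<- <-] := hu u; rewrite /sq_symbol /sq_head /=.
    exact: surjective_pairing.
  case: (okp t i htT hi) => _ _ + _ _.
  rewrite /kind /= neq_ltn lt /= (minn_idPl lt) => /andP[/eqP hst /forallP h].
  rewrite (same i) // in hst h; rewrite (same i.-1) in h; last by lia.
  rewrite (same (minn i.+1 T)) in h; last exact: geq_minr.
  split; first by rewrite hst (step_state z t i).
  move=> u; case/andP: (h u) => /eqP -> /eqP ->.
  by rewrite step_symbol step_head.
have [hst _] := inv T (leqnn _) 0 (leq0n _).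
case: (okp T 0) => // _ _ _ _.
by rewrite /kind /= eqxx /= hst.
Qed.

End Tableau.

(** An arbitrary function of finitely many definable bits and of a number below a constant is
    definable. Through [square_ok], this turns the transition table of a machine into an
    expression. *)
Lemma def_bits (bs : seq (env -> bool)) (F : seq bool -> nat -> nat) (G : env -> nat) n :
  (forall i, i < size bs -> definable (fun r => nat_of_bool (nth (fun=> false) bs i r))) ->
  definable G -> (forall r, G r < n) -> definable (fun r => F [seq b r | b <- bs] (G r)).
Proof.
move=> hb hG hn; elim: bs F hb => [|b bs IH] F hb.
  by apply: (def_table (F := fun c _ => F [::] c) (q := n)) => // c; exact: def_const.
have h c := IH (fun s => F (c :: s)) (fun i => hb i.+1).
apply: def_ext (def_if (hb 0 isT) (h true) (h false)) => r /=.
by case: (b r).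
Qed.

(** * From NP to hitting sets *)

Section CookLevin.
Variables (M : machine) (qpoly ppoly : {poly nat}).
Let q0 := #|square M|.

Definition time_bound (x : seq bool) : nat := ppoly.[size x + qpoly.[size x]]%R.

Let base : square M := (start M, [ffun=> None], [ffun=> (None, false)]).
Definition decode (a : nat) : square M := nth base (enum (square M)) a.

Lemma decode_index d : decode (index d (enum (square M))) = d.
Proof. by rewrite /decode nth_index // mem_enum. Qed.

Lemma index_lt (d : square M) : index d (enum (square M)) < q0.
Proof. by rewrite /q0 cardE index_mem mem_enum. Qed.

Definition neighbour (T k j : nat) : nat :=
  let t := j %/ T.+1 in let i := j %% T.+1 in
  match k with
  | 0 => t * T.+1 + i.-1
  | 1 => t * T.+1 + i
  | 2 => t * T.+1 + minn i.+1 T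
  | _ => minn t.+1 T * T.+1 + i
  end.

Definition local_rule (x : seq bool) (j code : nat) : bool :=
  let T := time_bound x in
  square_ok (kind x qpoly.[size x]%R T (j %/ T.+1) (j %% T.+1))
    (decode (digit q0 0 code)) (decode (digit q0 1 code))
    (decode (digit q0 2 code)) (decode (digit q0 3 code)).

Definition squares (x : seq bool) : nat := (time_bound x).+1 * (time_bound x).+1.

Definition tableau_clause (x : seq bool) : nat -> nat -> bool :=
  clause (squares x) q0 (neighbour (time_bound x)) (local_rule x).

Lemma neighbour_lt x k j : j < squares x -> neighbour (time_bound x) k j < squares x.
Proof.
rewrite /squares /neighbour; set T := time_bound x => h.
have ht : j %/ T.+1 < T.+1 by rewrite ltn_divLR.
have hi : j %% T.+1 < T.+1 by rewrite ltn_mod.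
have c t i : t <= T -> i <= T -> t * T.+1 + i < T.+1 * T.+1.
  by move=> h1 h2; apply: (@leq_trans (t.+1 * T.+1)); [rewrite mulSnr ltn_add2l|rewrite leq_mul2r ltnS h1 orbT].
case: k => [|[|[|k]]]; apply: c; move: ht hi; move: (_ %/ _) (_ %% _); lia.
Qed.

Lemma tableau_hits x :
  (exists P, hits (squares x) (squares x * q0) (squares x + squares x * q0 ^ 4) (tableau_clause x) P) <->
  exists2 y : seq bool, size y <= qpoly.[size x]%R & accepting (@run M (time_bound x) x y).1.
Proof.
have N0 : 0 < squares x by rewrite muln_gt0.
rewrite (clauseP _ _ N0 (fun k j => @neighbour_lt x k j)).
set T := time_bound x.
have cell t i : t <= T -> i <= T -> t * T.+1 + i < squares x.
  by move=> h1 h2; apply: (@leq_trans (t.+1 * T.+1)); [rewrite mulSnr ltn_add2l|rewrite leq_mul2r ltnS h1 orbT].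
have dv t i : i <= T -> (t * T.+1 + i) %/ T.+1 = t.
  by move=> hi; rewrite divnMDl // divn_small // addn0.
have md t i : i <= T -> (t * T.+1 + i) %% T.+1 = i by move=> hi; rewrite modnMDl modn_small.
split=> [[g [gq hg]]|[y hy acc]].
  apply: (@table_sound M x _ T (fun t i => decode (g (t * T.+1 + i)))) => t i ht hi.
  have := hg _ (cell t i ht hi).
  by rewrite /local_rule /neighbour -/T !digit_code4 // dv // md.
pose g j := index (@true_square M x y (j %/ T.+1) (j %% T.+1)) (enum (square M)).
exists g; split=> [j|j hj]; first exact: index_lt.
have ht : j %/ T.+1 <= T by rewrite -ltnS ltn_divLR.
have hi : j %% T.+1 <= T by rewrite -ltnS ltn_mod.
rewrite /local_rule !digit_code4 // => [|k|k|k|k]; try exact: index_lt.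
have h1 : (j %% T.+1).-1 <= T := leq_trans (leq_pred _) hi.
have h2 : minn (j %% T.+1).+1 T <= T := geq_minr _ _.
rewrite /g !decode_index /neighbour -/T !dv ?md //.
exact: (table_complete hy acc).
Qed.

Lemma def_time_bound : definable (fun r => time_bound r.1.1).
Proof. exact: def_horner (def_add def_size (def_horner _ def_size)). Qed.

Lemma def_squares : definable (fun r => squares r.1.1).
Proof. exact: def_mul (def_S def_time_bound) (def_S def_time_bound). Qed.

Lemma def_minn F G : definable F -> definable G -> definable (fun r => minn (F r) (G r)).
Proof.
by move=> hF hG; apply: def_ext (def_sub hF (def_sub hF hG)) => r; rewrite minnE.
Qed.

Lemma def_neighbour k J : definable J -> definable (fun r => neighbour (time_bound r.1.1) k (J r)).
Proof.
move=> hJ; have hT := def_time_bound; have hT1 := def_S hT.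
have ht := def_div hJ hT1; have hi := def_mod hJ hT1.
case: k => [|[|[|k]]]; rewrite /neighbour /=.
- apply: def_ext (def_add (def_mul ht hT1) (def_sub hi (def_const 1))) => r.
  by rewrite subn1.
- exact: def_add (def_mul ht hT1) hi.
- exact: def_add (def_mul ht hT1) (def_minn (def_S hi) hT).
- exact: def_add (def_mul (def_minn (def_S ht) hT) hT1) hi.
Qed.

Lemma def_local_rule J C : definable J -> definable C -> (forall r, C r < q0 ^ 4) ->
  definable (fun r => local_rule r.1.1 (J r) (C r)).
Proof.
move=> hJ hC lt; have hT := def_time_bound; have hT1 := def_S hT.
have ht := def_div hJ hT1; have hi := def_mod hJ hT1.
pose T (r : env) := time_bound r.1.1.
(* The order is that of the list in [kind]. *)
pose bs : seq (env -> bool) := [:: fun r => J r %% (T r).+1 == 0;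
  fun r => J r %% (T r).+1 == T r; fun r => J r %/ (T r).+1 == 0;
  fun r => J r %/ (T r).+1 == T r; fun r => J r %% (T r).+1 < size r.1.1;
  fun r => nth false r.1.1 (J r %% (T r).+1);
  fun r => J r %% (T r).+1 < qpoly.[size r.1.1]%R].
pose F (s : seq bool) c := nat_of_bool (square_ok (nth false s)
  (decode (digit q0 0 c)) (decode (digit q0 1 c)) (decode (digit q0 2 c)) (decode (digit q0 3 c))).
apply: (def_ext _ (@def_bits bs F _ _ _ hC lt)) => //.
case=> [|[|[|[|[|[|[|//]]]]]]] _ /=.
- exact: def_eqn hi (def_const 0).
- exact: def_eqn hi hT.
- exact: def_eqn ht (def_const 0).
- exact: def_eqn ht hT.
- exact: def_leq (def_S hi) def_size.
- exact: def_x hi.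
- exact: def_leq (def_S hi) (def_horner _ def_size).
Qed.

Lemma def_tableau_clause J P : definable J -> definable P ->
  definable (fun r => tableau_clause r.1.1 (J r) (P r)).
Proof.
move=> hJ hP; have hN := def_squares.
have q0_gt0 : 0 < q0 by apply: leq_ltn_trans (leq0n _) (index_lt base).
have hd := def_sub hJ hN.
have hj := def_div hd (def_const (q0 ^ 4)).
have hc := def_mod hd (def_const (q0 ^ 4)).
have hr := def_local_rule hj hc (fun r => _ : _ %% _ < _).
have hb k := def_and (def_eqn (def_div hP (def_const q0)) (def_neighbour k hj))
  (def_not (def_eqn (def_mod hP (def_const q0))
    (def_mod (def_div hc (def_const (q0 ^ k))) (def_const q0)))).
have e (f : nat -> bool) : bex 4 f = f 0 || f 1 || f 2 || f 3.
  apply/bexP/idP => [[[|[|[|[|//]]]] _ ->]|]; rewrite ?orbT //.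
  by case/orP => [/orP[/orP[]|]|] h; [exists 0|exists 1|exists 2|exists 3].
have := def_ifb (def_leq (def_S hJ) hN) (def_eqn (def_div hP (def_const q0)) hJ)
  (def_or (hr _) (def_or (def_or (def_or (hb 0) (hb 1)) (hb 2)) (hb 3))).
move=> h; apply: def_ext (h _) => r; last by rewrite ltn_mod expn_gt0 q0_gt0.
by rewrite /tableau_clause /clause e.
Qed.

End CookLevin.

(** Sizes and sets are obtained as definable functions, which is the form needed for substituting
    them into the description of the grid. *)
Theorem NP_hitting_set (L : language) : NP L ->
  exists (N Q m : seq bool -> nat) (A : seq bool -> nat -> nat -> bool),
  [/\ [/\ definable (fun r => N r.1.1), definable (fun r => Q r.1.1) & definable (fun r => m r.1.1)],
      forall J P, definable J -> definable P -> definable (fun r => A r.1.1 (J r) (P r)),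
      forall x, 0 < N x <= Q x &
      forall x, L x <-> exists P, hits (N x) (Q x) (m x) (A x) P].
Proof.
move=> [V [qp [[M [p hM]] hL]]].
exists (squares qp p), (fun x => squares qp p x * #|square M|),
  (fun x => squares qp p x + squares qp p x * #|square M| ^ 4), (@tableau_clause M qp p).
have hN := def_squares qp p.
split=> [||x|x].
- split=> //; first exact: def_mul hN (def_const _).
  exact: def_add hN (def_mul hN (def_const _)).
- exact: def_tableau_clause.
- have [d _] : exists d : square M, true by exists (start M, [ffun=> None], [ffun=> (None, false)]).
  by rewrite leq_pmulr ?muln_gt0 //; apply/card_gt0P; exists d.
(* The verifier stops at a time that depends on [size y]. A halted run no longer changes, so its
   answer can be read at the time bound common to all certificates. *)
have hV y : size y <= qp.[size x]%R -> accepting (@run M (time_bound qp p x) x y).1 = V x y.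
  move=> hy; have [h1 <-] := hM x y.
  rewrite (run_leq _ h1) //; apply: horner_leq; exact: leq_add.
rewrite hL tableau_hits; split=> -[y hy]; first by rewrite -hV //; exists y.
by rewrite hV //; exists y.
Qed.

Lemma def_pred F : definable F -> definable (fun r => (F r).-1).
Proof. by move=> h; apply: def_ext (def_sub h (def_const 1)) => r; rewrite subn1. Qed.

Lemma def_double F : definable F -> definable (fun r => (F r).*2).
Proof. by move=> h; apply: def_ext (def_add h h) => r; rewrite addnn. Qed.

Lemma def_half F : definable F -> definable (fun r => (F r)./2).
Proof. by move=> h; apply: def_ext (def_div h (def_const 2)) => r; rewrite divn2. Qed.

Lemma def_eqb P Q : definable (fun r => nat_of_bool (P r)) -> definable (fun r => nat_of_bool (Q r)) ->
  definable (fun r => P r == Q r).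
Proof.
by move=> h h'; apply: def_ext (def_eqn h h') => r; case: (P r); case: (Q r).
Qed.

(** Chooses the closure lemma by the head symbol of the body. After a binder, [cbn [fst snd]]
    simplifies the projections of the extended environment, so that variables have the form of
    [def_var]. *)
Ltac def_step :=
  lazymatch goal with
  | |- definable (fun r => nat_of_bool (ball (@?F r) (@?P r))) => eapply def_ball; cbn [fst snd]
  | |- definable (fun r => nat_of_bool (bex (@?F r) (@?P r))) => eapply def_bex; cbn [fst snd]
  | |- definable (fun r => nat_of_bool (@?P r && @?Q r)) => eapply def_and
  | |- definable (fun r => nat_of_bool (@?P r || @?Q r)) => eapply def_or
  | |- definable (fun r => nat_of_bool (@?P r ==> @?Q r)) => eapply def_imp
  | |- definable (fun r => nat_of_bool (~~ @?P r)) => eapply def_not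
  | |- definable (fun r => nat_of_bool (@?F r == @?G r)) => first [eapply def_eqn | eapply def_eqb]
  | |- definable (fun r => nat_of_bool (@?F r <= @?G r)) => eapply def_leq
  | |- definable (fun r => nat_of_bool (odd (@?F r))) => eapply def_odd
  | |- definable (fun r => nat_of_bool (@?P r)) => first [assumption | eapply def_ifb]
  | |- definable (fun r => bsum (@?F r) (@?P r)) => eapply def_bsum; cbn [fst snd]
  | |- definable (fun r => carry (@?P r) (@?F r)) => eapply def_carry; cbn [fst snd]
  | |- definable (fun r => @?F r %/ 2 ^ @?G r) => eapply def_shiftr
  | |- definable (fun r => @?F r %/ @?G r) => eapply def_div
  | |- definable (fun r => @?F r %% @?G r) => eapply def_mod
  | |- definable (fun r => minn (@?F r) (@?G r)) => eapply def_minn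
  | |- definable (fun r => @?F r + @?G r) => eapply def_add
  | |- definable (fun r => @?F r - @?G r) => eapply def_sub
  | |- definable (fun r => @?F r * @?G r) => eapply def_mul
  | |- definable (fun r => (@?F r)./2) => eapply def_half
  | |- definable (fun r => (@?F r).*2) => eapply def_double
  | |- definable (fun r => (@?F r).-1) => eapply def_pred
  | |- _ => first [ assumption | exact (def_var 0) | exact (def_var 1) | exact (def_var 2)
      | exact (def_var 3) | exact def_size | simple apply def_const | eapply def_S | eapply def_if ]
  end.
Ltac def_tac := repeat def_step.

(** * The encoding as a stream *)

(** Takes a length and digits instead of a number: the verifier handles capacities and costs of
    exponential size, which are not values of expressions. *)
Definition digit_stream (l : nat) (g : nat -> bool) : seq bool :=
  concat l (fun i => [:: true; g i]) ++ [:: false].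

Lemma encode_binaryE n :
  encode_binary n = digit_stream (up_log 2 n.+1) (fun i => odd (n %/ 2 ^ i)).
Proof. by rewrite /encode_binary /binary_digits -map_comp. Qed.

(** Counts and vertex indices are small and given by value; the other numbers may be exponentially
    large and are given as words. *)
Definition instance_stream (nv ne : nat) (tl hd : nat -> nat) (cp cs : nat -> seq bool)
    (B : seq bool) (s t : nat) (k : seq bool) : seq bool :=
  encode_unary nv ++ encode_unary ne ++
  concat ne (fun e => encode_binary (tl e) ++ encode_binary (hd e) ++ cp e ++ cs e) ++
  B ++ encode_binary s ++ encode_binary t ++ k.

Lemma flatten_enum n (F : 'I_n -> seq bool) (g : nat -> seq bool) : (forall e, F e = g e) ->
  flatten [seq F e | e <- enum 'I_n] = concat n g.
Proof.
move=> h; rewrite (eq_map h) /concat -val_enum_ord -map_comp.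
by [].
Qed.

Lemma encode_instanceE X (tl hd : nat -> nat) (cp cs : nat -> nat) :
  (forall e : edge (graph X), edge_tail e = tl e :> nat) ->
  (forall e : edge (graph X), edge_head e = hd e :> nat) ->
  (forall e : edge (graph X), capacity e = cp e) -> (forall e : edge (graph X), cost e = cs e) ->
  encode_instance X = instance_stream (nb_vertices (graph X)) (nb_edges (graph X)) tl hd
    (fun e => encode_binary (cp e)) (fun e => encode_binary (cs e))
    (encode_binary (budget X)) (source X) (sink X) (encode_binary (threshold X)).
Proof.
move=> h1 h2 h3 h4; rewrite /encode_instance (flatten_enum (g := fun e =>
  encode_binary (tl e) ++ encode_binary (hd e) ++ encode_binary (cp e) ++ encode_binary (cs e))) //.
by move=> e; rewrite h1 h2 h3 h4.
Qed.

(** The number of binary digits is the number of shifts [i] for which [F r %/ 2 ^ i] is still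
    positive. *)
Lemma def_up_log F : definable F -> definable (fun r => up_log 2 (F r).+1).
Proof.
move=> hF; have h : definable (fun r => bsum (F r).+1 (fun i => nat_of_bool (0 < F r %/ 2 ^ i))).
  apply: (def_bsum (G := fun r i => nat_of_bool (0 < F r %/ 2 ^ i)) (def_S hF)).
  exact: def_leq (def_const 1) (def_shiftr (def_pop hF) (def_var 0)).
apply: def_ext h => r; rewrite /bsum (eq_bigr (fun i : 'I_(F r).+1 => nat_of_bool (i < up_log 2 (F r).+1))).
  rewrite sum_ltn; apply/esym/minn_idPr/up_log_min => //.
  exact: ltnW (ltn_expl (F r).+1 (isT : 1 < 2)).
move=> i _; rewrite divn_gt0 ?expn_gt0 //.
congr nat_of_bool; rewrite [RHS]ltnNge; apply/idP/idP => h'.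
  by apply: contraL h'; rewrite -ltnNge => /(leq_pexp2l (isT : 0 < 2)); apply: leq_trans (up_logP _ _).
by rewrite leqNgt; apply: contra h' => h'; apply: up_log_min.
Qed.

Lemma defs_digit_stream L g : definable L ->
  definable (fun r => nat_of_bool (g (r.1, behead r.2) (head 0 r.2))) ->
  definable_word (fun r => digit_stream (L r) (fun i => g r i)).
Proof.
move=> hL hg; apply: defs_cat; last exact: (defs_bit (P := fun _ => false) (def_const 0)).
apply: (defs_concat (g := fun r i => [:: true; g r i])) => //.
apply: (defs_cat (F := fun=> [:: true])); first exact: (defs_bit (P := fun _ => true) (def_const 1)).
exact: defs_bit hg.
Qed.

Lemma defs_encode_binary F : definable F -> definable_word (fun r => encode_binary (F r)).
Proof.
move=> hF; apply: (defs_ext (fun r => encode_binaryE (F r))).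
apply: (defs_digit_stream (g := fun r i => odd (F r %/ 2 ^ i)) (def_up_log hF)).
exact: def_odd (def_shiftr (def_pop hF) (def_var 0)).
Qed.

Lemma defs_encode_unary F : definable F -> definable_word (fun r => encode_unary (F r)).
Proof. by move=> hF; apply: defs_cat (defs_nseq true hF) (defs_bit (P := fun _ => false) (def_const 0)). Qed.

Lemma defs_instance_stream nv ne tl hd cp cs B s t k : definable nv -> definable ne ->
  definable (fun r => tl (r.1, behead r.2) (head 0 r.2)) ->
  definable (fun r => hd (r.1, behead r.2) (head 0 r.2)) ->
  definable_word (fun r => cp (r.1, behead r.2) (head 0 r.2)) ->
  definable_word (fun r => cs (r.1, behead r.2) (head 0 r.2)) ->
  definable_word B -> definable s -> definable t -> definable_word k ->
  definable_word (fun r => instance_stream (nv r) (ne r) (tl r) (hd r) (cp r) (cs r) (B r) (s r) (t r) (k r)).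
Proof.
move=> hnv hne htl hhd hcp hcs hB hs ht hk.
do 2![apply: defs_cat; first exact: defs_encode_unary].
apply: defs_cat.
  apply: (defs_concat (g := fun r e => encode_binary (tl r e) ++ encode_binary (hd r e) ++ cp r e ++ cs r e)) => //.
  by do 2![apply: defs_cat; first exact: defs_encode_binary]; apply: defs_cat.
by apply: defs_cat => //; do 2![apply: defs_cat; first exact: defs_encode_binary].
Qed.

(** * The reduction *)

Section Reduction.
Variables (N Q m : seq bool -> nat) (A : seq bool -> nat -> nat -> bool).
Hypotheses (hN : definable (fun r => N r.1.1)) (hQ : definable (fun r => Q r.1.1)) (hm : definable (fun r => m r.1.1)).
Hypothesis hA : forall J P, definable J -> definable P -> definable (fun r => A r.1.1 (J r) (P r)).

Lemma defs_grid : definable_word (fun r => encode_instance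
  (grid_instance (N r.1.1) (Q r.1.1) (m r.1.1) (A r.1.1))).
Proof.
pose C x := (m x).*2.+2; pose n x := ((Q x).+2 * C x).-1.
have hC : definable (fun r => C r.1.1) by rewrite /C; def_tac.
have hn : definable (fun r => n r.1.1) by rewrite /n; def_tac.
have e (r : env) : encode_instance (grid_instance (N r.1.1) (Q r.1.1) (m r.1.1) (A r.1.1)) =
  instance_stream (n r.1.1).+1 (n r.1.1 + ((n r.1.1).+1 - C r.1.1))
    (spiral_tail (n r.1.1) (C r.1.1) (on_last (m r.1.1)))
    (spiral_head (n r.1.1) (C r.1.1) (on_last (m r.1.1)))
    (fun e => encode_binary (grid_capacity (N r.1.1) (Q r.1.1) (m r.1.1) (A r.1.1) e))
    (fun e => encode_binary (grid_cost (N r.1.1) (Q r.1.1) (m r.1.1) e))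
    (encode_binary (grid_budget (N r.1.1) (m r.1.1))) 0 (m r.1.1).*2.+1
    (encode_binary (2 * N r.1.1 + m r.1.1).-1).
  rewrite (@encode_instanceE _ (spiral_tail (n r.1.1) (C r.1.1) (on_last (m r.1.1)))
    (spiral_head (n r.1.1) (C r.1.1) (on_last (m r.1.1)))
    (grid_capacity (N r.1.1) (Q r.1.1) (m r.1.1) (A r.1.1)) (grid_cost (N r.1.1) (Q r.1.1) (m r.1.1))) //.
  - by rewrite /= !inordK // /n /C; lia.
  - exact: spiral_tailE.
  - exact: spiral_headE.
apply: (defs_ext e).
apply: (@defs_instance_stream _ _
  (fun r e => spiral_tail (n r.1.1) (C r.1.1) (on_last (m r.1.1)) e)
  (fun r e => spiral_head (n r.1.1) (C r.1.1) (on_last (m r.1.1)) e)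
  (fun r e => encode_binary (grid_capacity (N r.1.1) (Q r.1.1) (m r.1.1) (A r.1.1) e))
  (fun r e => encode_binary (grid_cost (N r.1.1) (Q r.1.1) (m r.1.1) e)));
  try apply: defs_encode_binary.
- def_tac.
- def_tac.
- rewrite /spiral_tail /on_last; cbn [fst snd]; def_tac.
- rewrite /spiral_head /on_last; cbn [fst snd]; def_tac.
- rewrite /grid_capacity /hcap /vcap; cbn [fst snd]; def_tac; apply: hA; def_tac.
- rewrite /grid_cost /hcost; cbn [fst snd]; def_tac.
- rewrite /grid_budget; def_tac.
- def_tac.
- def_tac.
- def_tac.
Qed.

End Reduction.

Lemma size_instance X : nb_vertices (graph X) <= size (encode_instance X).
Proof. by rewrite /encode_instance !size_cat size_nseq; lia. Qed.

Section GridInstance.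
Variables (N Q M : nat) (A : nat -> nat -> bool).
Hypotheses (N_gt0 : 0 < N) (N_le : N <= Q).
Let X := grid_instance N Q M A.

Lemma grid_is_instance R : is_instance (X : raw_instance (flow_improvement R)).
Proof.
split; first exact: spiral_simple.
  by rewrite /= /grid_budget; move: N_gt0; nia.
move=> /(congr1 val) /=; rewrite !inordK //; lia.
Qed.

Lemma grid_planar : planar_instance X.
Proof.
have h1 : 1 < M.*2.+2 by [].
have h2 : M.*2.+2 <= (Q.+2 * M.*2.+2).-1 by nia.
exists (spiral_rotation (on_last M) h1 h2); split; first exact: spiral_planar.
apply: spiral_common_face; first by rewrite /= inordK.
by rewrite /= inordK; lia.
Qed.

(** The size of the encoding is at least the number of vertices, which is written in unary and, by
    [N <= Q], at least [2 * a]. Capacities, costs and threshold are at most linear in [a], and the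
    budget is at most [a * a + a]. *)
Lemma grid_numbers : max_number X <= size (encode_instance X) ^ 2.
Proof.
have hs : (Q.+2 * M.*2.+2).-1.+1 <= size (encode_instance X) := size_instance X.
set a := (N + 2) * (M + 1).
have ha : 2 * a <= size (encode_instance X) by apply: leq_trans hs; rewrite /a; nia.
have hK : N * M + 1 <= a by rewrite /a; nia.
have hB : 2 * N + M <= 2 * a by rewrite /a; nia.
have h3 : 3 <= 2 * a by rewrite /a; nia.
have a2 : (2 * a) ^ 2 <= size (encode_instance X) ^ 2 by rewrite leq_exp2r.
apply: leq_trans a2; have a1 : 2 * a <= (2 * a) ^ 2 by rewrite -mulnn; nia.
rewrite /max_number !geq_max; apply/andP; split; apply/andP; split.
- apply/bigmax_leqP => e _; apply: leq_trans a1; rewrite /= /grid_capacity /hcap /vcap.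
  have hb (b : bool) : b <= 2 * a by apply: leq_trans (ltnW (ltnW h3)); case: b.
  have hb2 (b : bool) : 2 + b <= 2 * a by apply: leq_trans h3; case: b.
  by do ?case: ifP => _ //; exact: ltnW h3.
- apply/bigmax_leqP => e _; apply: leq_trans a1; rewrite /= /grid_cost /hcost.
  by do ?case: ifP => _ //; lia.
- rewrite /= /grid_budget -mulnn; apply: (@leq_trans (a * a + a)); last by nia.
  have : (N * M + 1) * (N * M.+1) <= a * a by apply: leq_mul => //; rewrite /a; nia.
  by move: hK; lia.
- by apply: leq_trans a1; rewrite /=; lia.
Qed.

End GridInstance.

(** * Sums of binary numbers *)

(* The digits [g j] may exceed 1. *)
Definition value (n : nat) (g : nat -> nat) : nat := bsum n (fun j => g j * 2 ^ j).

Lemma value0 g : value 0 g = 0.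
Proof. exact: big_ord0. Qed.

Lemma valueS n g : value n.+1 g = value n g + g n * 2 ^ n.
Proof. by rewrite /value /bsum big_ord_recr. Qed.

Lemma eq_value n g h : (forall j, j < n -> g j = h j) -> value n g = value n h.
Proof. by move=> e; apply: eq_bigr => j _; rewrite e. Qed.

Lemma value_add n g h : value n (fun j => g j + h j) = value n g + value n h.
Proof. by rewrite /value /bsum -big_split; apply: eq_bigr => j _; rewrite mulnDl. Qed.

Lemma value_sum n m (g : nat -> nat -> nat) :
  value n (fun j => bsum m (fun e => g e j)) = bsum m (fun e => value n (g e)).
Proof.
rewrite /value /bsum exchange_big; apply: eq_bigr => j _; rewrite big_distrl.
by [].
Qed.

Lemma value_scale n c g : value n (fun j => c * g j) = c * value n g.
Proof. by rewrite /value /bsum big_distrr /=; apply: eq_bigr => j _; rewrite mulnA. Qed.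

Lemma value_one n : 0 < n -> value n (fun j => j == 0) = 1.
Proof.
elim: n => // -[|n] IH _; first by rewrite valueS value0.
by rewrite valueS IH.
Qed.

Lemma value_gt0 n g : (0 < value n g) = bex n (fun j => 0 < g j).
Proof.
rewrite lt0n /value /bsum sum_nat_eq0 negb_forall; apply: eq_existsb => j /=.
by rewrite muln_eq0 expn_eq0 orbF lt0n.
Qed.

Lemma value_shift n g : value n g %/ 2 ^ n = carry g n.
Proof.
elim: n => [|n IH]; first by rewrite value0 div0n.
rewrite valueS expnSr divnMA addnC divnMDl ?expn_gt0 // IH divn2 addnC.
by [].
Qed.

Lemma value_bit n j g : j < n -> odd (value n g %/ 2 ^ j) = odd (carry g j + g j).
Proof.
elim: n => // n IH; rewrite ltnS leq_eqVlt valueS.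
case/orP => [/eqP ->|lt]; first by rewrite addnC divnMDl ?expn_gt0 // value_shift addnC.
rewrite -IH // -(subnK (ltnW lt)) expnD mulnA addnC divnMDl ?expn_gt0 // oddD oddM oddX.
by rewrite subn_eq0 leqNgt lt /= andbF.
Qed.

Lemma value_carry n g :
  value n g = value n (fun j => odd (carry g j + g j)) + carry g n * 2 ^ n.
Proof.
elim: n => [|n IH]; first by rewrite !value0.
rewrite !valueS {1}IH /= -!addnA; congr (_ + _).
by rewrite expnS -mulnDl mulnCA mulnA -mulnDl -{1}(odd_double_half (carry g n + g n)) mul2n.
Qed.

(** An equality test for sums of exponential size that only involves carries and digits, which
    remain polynomially bounded. *)
Definition same_sum (n : nat) (g h : nat -> nat) : bool :=
  ball n (fun j => odd (carry g j + g j) == odd (carry h j + h j)) && (carry g n == carry h n).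

Lemma same_sumE n g h : same_sum n g h = (value n g == value n h).
Proof.
apply/andP/eqP => [[/ballP h1 /eqP h2]|e].
  rewrite (value_carry n g) (value_carry n h) h2; congr (_ + _).
  by apply: eq_value => j /h1 /eqP ->.
split; last by rewrite -!value_shift e.
by apply/ballP => j hj; rewrite -!(value_bit _ hj) e.
Qed.

Lemma value_digits n m : value n (fun j => odd (m %/ 2 ^ j)) = m %% 2 ^ n.
Proof.
elim: n => [|n IH]; first by rewrite value0 modn1.
rewrite valueS IH; set a := m %/ 2 ^ n.
have lt : m %% 2 ^ n + odd a * 2 ^ n < 2 ^ n.+1.
  rewrite expnS mul2n -addnn; apply: (@leq_trans (2 ^ n + odd a * 2 ^ n)).
    by rewrite ltn_add2r ltn_mod expn_gt0.
  by rewrite leq_add2l; case: (odd a); rewrite ?mul1n.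
rewrite -[LHS](modn_small lt) -(modnMDl a./2); congr (_ %% _).
rewrite [in RHS](divn_eq m (2 ^ n)) -/a addnCA [RHS]addnC; congr (_ + _).
by rewrite expnS mulnA -mulnDl -{3}(odd_double_half a) muln2 addnC.
Qed.

(* A number in binary given by its length and its digits (positive or zero). *)
Definition digit_of (l : nat) (d : nat -> nat) (j : nat) : bool := (j < l) && (0 < d j).

Definition no_leading_zero (l : nat) (d : nat -> nat) : bool := (l == 0) || (0 < d l.-1).

Definition denotes (l : nat) (d : nat -> nat) (n : nat) : Prop :=
  l = up_log 2 n.+1 /\ forall j, digit_of l d j = odd (n %/ 2 ^ j).

Lemma denotes_digits l (d : nat -> nat) n : l = up_log 2 n.+1 ->
  (forall j, j < l -> d j = odd (n %/ 2 ^ j)) -> denotes l d n.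
Proof.
move=> hl hd; split=> // j; rewrite /digit_of; case: (ltnP j l) => h; first by rewrite hd //; case: odd.
rewrite divn_small //; apply: (@leq_trans (2 ^ l)); last by rewrite leq_exp2l.
by rewrite hl; apply: up_logP.
Qed.

Lemma denotes_stream l d n : denotes l d n ->
  digit_stream l (digit_of l d) = encode_binary n.
Proof.
case=> hl hd; rewrite encode_binaryE -hl /digit_stream /concat; congr (flatten _ ++ _).
by apply: eq_map => i; rewrite hd.
Qed.

Lemma denotes_value l d n m : denotes l d n -> l <= m ->
  value m (fun j => digit_of l d j) = n.
Proof.
case=> hl hd lm; rewrite (@eq_value _ _ (fun j => odd (n %/ 2 ^ j))) => [|j _]; last by rewrite hd.
rewrite value_digits modn_small //; apply: (@leq_trans (2 ^ l)); last by rewrite leq_exp2l.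
by rewrite hl; apply: up_logP.
Qed.

Lemma value_lt n (b : nat -> bool) : value n (fun j => b j) < 2 ^ n.
Proof.
elim: n => [|n IH]; first by rewrite value0.
rewrite valueS expnS mul2n -addnn -addSn leq_add //.
by case: (b n); rewrite ?mul1n.
Qed.

Lemma carry_bits (b : nat -> bool) n : carry (fun j => b j) n = 0.
Proof. by rewrite -value_shift divn_small // value_lt. Qed.

Lemma leading_represents l d : no_leading_zero l d ->
  denotes l d (value l (fun j => digit_of l d j)).
Proof.
set n := value _ _ => hc.
have bits j : digit_of l d j = odd (n %/ 2 ^ j).
  case: (ltnP j l) => hj; first by rewrite value_bit // carry_bits add0n; case: digit_of.
  rewrite divn_small /digit_of ltnNge ?hj //.
  by rewrite -ltnNge; apply: (leq_trans (value_lt l (digit_of l d))); rewrite leq_exp2l.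
split=> //; apply/eqP; rewrite eqn_leq; apply/andP; split; last exact: (up_log_min _ (value_lt l (digit_of l d))).
case/orP: hc => [/eqP -> //|]; rewrite {bits}/n; case: l => // l /= h.
rewrite leqNgt; apply/negP => hu.
have : value l.+1 (fun j => digit_of l.+1 d j) < 2 ^ l.
  rewrite ltnS in hu; exact: leq_trans (up_logP _ (isT : 1 < 2)) (leq_pexp2l (isT : 0 < 2) hu).
by rewrite ltnNge valueS /digit_of ltnSn h mul1n leq_addl.
Qed.

Lemma denotes_leading l d n : denotes l d n -> no_leading_zero l d.
Proof.
case=> hl hd; rewrite /no_leading_zero; case: l hl hd => // l hl hd.
have lt : n < 2 ^ l.+1 by rewrite hl; exact: (up_logP _ (isT : 1 < 2)).
have ge : 2 ^ l <= n.
  rewrite leqNgt; apply/negP => h; have := up_log_min (isT : 1 < 2) h.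
  by rewrite -hl ltnn.
have e : n %/ 2 ^ l = 1.
  apply/eqP; rewrite eqn_leq divn_gt0 ?expn_gt0 // ge andbT -ltnS ltn_divLR ?expn_gt0 //.
  by rewrite -expnS.
by have := hd l; rewrite e /digit_of ltnSn.
Qed.

(** The bound [m] is small whereas the number may be huge, so a number [k <= m] with the same digits
    is searched for. *)
Definition at_most (n m : nat) (g : nat -> bool) : bool :=
  bex m.+1 (fun k => ball n (fun j => odd (k %/ 2 ^ j) == g j)).

Lemma at_mostE n m g : at_most n m g = (value n (fun j => g j) <= m).
Proof.
apply/bexP/idP => [[k hk /ballP h]|h].
  rewrite -(@eq_value _ (fun j => odd (k %/ 2 ^ j))) => [|j /h /eqP -> //].
  by rewrite value_digits; apply: leq_trans (leq_mod _ _) _.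
exists (value n (fun j => g j)) => //; apply/ballP => j hj.
by rewrite value_bit // carry_bits add0n; case: (g j).
Qed.

(** * Certificates for connected components and for planarity *)

(** [h x] is the length of a shortest path from [x] to its representative; the first step of such a
    path decreases it. *)
Lemma connect_distance (T : finType) (e : rel T) (R : T -> T) :
  (forall x, connect e x (R x)) -> (forall x y, e x y -> R x = R y) ->
  exists2 h : T -> nat, forall x, h x <= #|T| &
    forall x, R x = x \/ exists2 y, e x y & h y < h x.
Proof.
move=> hc hR; pose P x n := [exists p : n.-tuple T, path e x p && (last x p == R x)].
have PI x (p : seq T) : path e x p -> last x p = R x -> P x (size p).
  by move=> h1 h2; apply/existsP; exists (in_tuple p); rewrite h1 h2 eqxx.
have exP x : exists n, P x n.
  by case/connectP: (hc x) => p h1 h2; exists (size p); apply: PI.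
exists (fun x => ex_minn (exP x)) => x; case: ex_minnP => n /existsP[p /andP[h1 /eqP h2]] hmin.
  case/connectP: (hc x) => p'; case/shortenP => p'' h3 hu _ h4.
  have : n <= size p'' by apply: hmin; apply: PI.
  have : size (x :: p'') <= #|T| by rewrite -(card_uniqP hu); apply: max_card.
  by rewrite /=; lia.
case: n p h1 h2 hmin => [|n] p; first by rewrite tuple0 /= => _ <-; left.
case/tupleP: p => y p /= /andP[exy hp] hl hmin; right; exists y => //.
case: ex_minnP => m _ /(_ n); rewrite ltnS; apply.
by apply/existsP; exists p; rewrite hp hl (hR _ _ exy) eqxx.
Qed.

(* [h] decreases towards the representative [r x] of the component of [x]. *)
Definition labelled (D : nat) (e : nat -> nat -> bool) (r h : nat -> nat) : bool :=
  ball D (fun x => [&& r x < D, (r x == x) || bex D (fun y => e x y && (h y < h x)) &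
    ball D (fun y => e x y ==> (r x == r y))]).

Section Labelled.
Variables (T : finType) (code : T -> nat).
Hypotheses (code_inj : injective code) (code_lt : forall x, code x < #|T|).

Lemma code_dec : exists dec : 'I_#|T| -> T,
  cancel (fun x => Ordinal (code_lt x)) dec /\ forall k : 'I_#|T|, code (dec k) = k.
Proof.
have [||dec h1 h2] := @inj_card_bij _ _ (fun x => Ordinal (code_lt x)).
- by move=> x y [/code_inj].
- by rewrite card_ord.
by exists dec; split=> // k; have := congr1 val (h2 k).
Qed.

Definition extend (F : T -> nat) (k : nat) : nat :=
  if [pick x | code x == k] is Some x then F x else 0.

Lemma extendE F x : extend F (code x) = F x.
Proof.
by rewrite /extend; case: pickP => [y /eqP/code_inj -> //|/(_ x)]; rewrite eqxx.
Qed.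

Lemma code_ex k : k < #|T| -> exists x, code x = k.
Proof. by have [dec [_ h]] := code_dec => hk; exists (dec (Ordinal hk)); rewrite h. Qed.

Lemma code_sum (F : nat -> nat) : bsum #|T| F = \sum_x F (code x).
Proof.
have [dec [h1 h2]] := code_dec; rewrite /bsum (reindex (fun x => Ordinal (code_lt x))) //=.
exists dec => x _; [exact: h1|by apply: val_inj; rewrite /= h2].
Qed.

Lemma ball_code (P : nat -> bool) : ball #|T| P <-> forall x, P (code x).
Proof.
split=> [/ballP h x|h]; first exact: h.
by apply/ballP => k /code_ex[x <-].
Qed.

Variables (E : rel T) (e : nat -> nat -> bool).
Hypotheses (eE : forall x y, E x y = e (code x) (code y)) (symE : connect_sym E).

(** Constancy of [r] along edges alone would allow a common representative for several components.
    The descent along [h] shows that [r x] is reachable from [x]. *)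
Lemma labelled_sound r h : labelled #|T| e r h ->
  n_comp E predT = bsum #|T| (fun x => r x == x) /\
  forall x y, connect E x y = (r (code x) == r (code y)).
Proof.
move=> /ball_code ok; have [dec [h1 h2]] := code_dec.
have ok1 x : r (code x) < #|T| by case/and3P: (ok x).
pose R x := dec (Ordinal (ok1 x)).
have cR x : code (R x) = r (code x) by rewrite h2.
have RE x y : E x y -> R x = R y.
  case/and3P: (ok x) => _ _ /ball_code /(_ y); rewrite -eE => /implyP h3 /h3 /eqP h4.
  by apply: code_inj; rewrite !cR.
have cn n x : h (code x) < n -> connect E x (R x).
  elim: n x => // n IH x; rewrite ltnS => hn.
  case/and3P: (ok x) => _ /orP[/eqP h3 _|/bexP[k /code_ex[y <-] /andP[]]].
    by have -> : R x = x by apply: code_inj; rewrite cR.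
  rewrite -eE => exy lt _; apply: connect_trans (connect1 exy) _.
  by rewrite (RE _ _ exy); apply: IH; apply: leq_trans lt hn.
have hc x : connect E x (R x) := cn _ x (ltnSn _).
split.
  rewrite (n_comp_roots symE RE hc) code_sum -sum1_card big_mkcond.
  apply: eq_bigr => x _; rewrite inE -(inj_eq code_inj) cR.
  by case: eqP.
move=> x y; rewrite -!cR (inj_eq code_inj); apply/idP/eqP => [|hR].
  exact: connect_label.
by apply: connect_trans (hc x) _; rewrite hR symE.
Qed.

Lemma extend_le F n k : (forall x, F x <= n) -> extend F k <= (k < #|T|) * n.
Proof.
by rewrite /extend => h; case: pickP => // x /eqP <-; rewrite code_lt mul1n.
Qed.

Lemma labelled_complete : exists r h, labelled #|T| e r h /\
  forall k, r k <= (k < #|T|) * #|T| /\ h k <= (k < #|T|) * #|T|.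
Proof.
have hR x y : E x y -> fingraph.root E x = fingraph.root E y by move=> /connect1 /(fingraph.rootP symE).
have [h hle hd] := connect_distance (@connect_root _ E) hR.
exists (extend (fun x => code (fingraph.root E x))), (extend h); split; last first.
  by move=> k; split; apply: extend_le => // x; exact: ltnW.
apply/ball_code => x; rewrite extendE code_lt /=; apply/andP; split.
  case: (hd x) => [->|[y exy lt]]; first by rewrite eqxx.
  by apply/orP; right; apply/bexP; exists (code y); rewrite // -eE exy !extendE.
by apply/ball_code => y; rewrite extendE -eE; apply/implyP => /hR ->.
Qed.

End Labelled.

(** Darts are numbered [2 * e + b]. The labellings by [rv], [rf] and [rl] certify the orbits around
    vertices, the faces and the components; comparison of [rv] with [vert] expresses that [rot] is a
    rotation system. If [s] and [t] have no common face, the colouring [col] has to separate their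
    components. *)
Definition planar_check (ne : nat) (tl hd : nat -> nat) (s t : nat)
    (rot rv hv rf hf rl hl col : nat -> nat) : bool :=
  let D := ne.*2 in
  let vert d := if odd d then hd d./2 else tl d./2 in
  let flp d := if odd d then d.-1 else d.+1 in
  [&& ball D (fun d => rot d < D),
      ball D (fun d => ball D (fun d' => (rot d == rot d') ==> (d == d'))),
      labelled D (fun d d' => rot d == d') rv hv,
      labelled D (fun d d' => rot (flp d) == d') rf hf,
      labelled D (fun d d' => (rot d == d') || (flp d == d')) rl hl,
      ball D (fun d => ball D (fun d' => (rv d == rv d') == (vert d == vert d'))),
      bsum D (fun d => rv d == d) + bsum D (fun d => rf d == d) ==
        ne + (bsum D (fun d => rl d == d)).*2 &
      bex D (fun d => bex D (fun d' => [&& vert d == s, vert d' == t & rf d == rf d'])) ||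
      (col s != col t) && ball ne (fun e => col (tl e) == col (hd e))].

Section PlanarCheck.
Variables (G : digraph) (tl hd : nat -> nat) (s t : vertex G).
Hypotheses (tlE : forall e : edge G, edge_tail e = tl e :> nat)
  (hdE : forall e : edge G, edge_head e = hd e :> nat).

Definition dart_code (d : dart G) : nat := d.1.*2 + d.2.

Lemma dart_code_inj : injective dart_code.
Proof.
move=> [e b] [e' b']; rewrite /dart_code /= => h.
have hb : b = b' by have := congr1 odd h; rewrite !oddD !odd_double; case: b {h}; case: b'.
by rewrite hb in h *; congr (_, _); apply: val_inj => /=; move: h; move: (nat_of_ord e) (nat_of_ord e'); lia.
Qed.

Lemma card_dart : #|{: dart G}| = (nb_edges G).*2.
Proof. by rewrite card_prod card_ord card_bool muln2. Qed.

Lemma dart_code_lt d : dart_code d < #|{: dart G}|.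
Proof.
rewrite card_dart /dart_code; case: d => e b /=; have := ltn_ord e.
by move: (nat_of_ord e) => m; case: b => /=; lia.
Qed.

Let vert d := if odd d then hd d./2 else tl d./2.
Let flp d := if odd d then d.-1 else d.+1.

Lemma dart_code_odd d : odd (dart_code d) = d.2.
Proof. by rewrite /dart_code oddD odd_double oddb. Qed.

Lemma dart_code_half d : (dart_code d)./2 = d.1.
Proof. by rewrite /dart_code addnC half_bit_double. Qed.

Lemma dart_code_vertex d : dart_vertex d = vert (dart_code d) :> nat.
Proof. by rewrite /vert dart_code_odd dart_code_half /dart_vertex; case: d.2. Qed.

Lemma dart_code_flip d : dart_code (flip d) = flp (dart_code d).
Proof. by rewrite /flp dart_code_odd /flip /dart_code; case: d.2 => /=; lia. Qed.

Lemma planar_sound rot rv hv rf hf rl hl col :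
  planar_check (nb_edges G) tl hd s t rot rv hv rf hf rl hl col ->
  planar_with_common_face s t.
Proof.
rewrite /planar_check -card_dart -/vert -/flp.
case/and5P => rotlt rotinj lv lf /and4P[ll rs euler common].
have hlt d : rot (dart_code d) < #|{: dart G}|.
  by move: rotlt => /(ball_code dart_code_inj dart_code_lt); apply.
have [dec [h1 h2]] := code_dec dart_code_inj dart_code_lt.
pose f d := dec (Ordinal (hlt d)).
have cf d : dart_code (f d) = rot (dart_code d) by rewrite h2.
have fI : injective f.
  move=> d d' e; apply: dart_code_inj.
  move: rotinj => /(ball_code dart_code_inj dart_code_lt) /(_ d).
  move=> /(ball_code dart_code_inj dart_code_lt) /(_ d') /implyP h.
  by apply/eqP/h; rewrite -!cf e.
pose R := perm fI.
have cR d : dart_code (R d) = rot (dart_code d) by rewrite permE cf.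
have faceI : injective (face_step R).
  by move=> d d' /perm_inj [h3 h4]; rewrite (surjective_pairing d) h3 (negb_inj h4) -surjective_pairing.
have [nv cv] := labelled_sound dart_code_inj dart_code_lt (E := frel R)
  (fun x y => etrans (esym (inj_eq dart_code_inj _ _)) (congr1 (eq_op^~ _) (cR x)))
  (fconnect_sym (@perm_inj _ R)) lv.
have [nf cfc] : n_comp (frel (face_step R)) predT = bsum #|{: dart G}| (fun x => rf x == x) /\
    forall x y, connect (frel (face_step R)) x y = (rf (dart_code x) == rf (dart_code y)).
  apply: (labelled_sound dart_code_inj dart_code_lt (E := frel (face_step R)) _ _ lf).
    by move=> x y /=; rewrite -(inj_eq dart_code_inj) cR dart_code_flip.
  exact: fconnect_sym.
have [nl _] : n_comp (dart_link R) predT = bsum #|{: dart G}| (fun x => rl x == x) /\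
    forall x y, connect (dart_link R) x y = (rl (dart_code x) == rl (dart_code y)).
  apply: (labelled_sound dart_code_inj dart_code_lt (E := dart_link R) _ _ ll).
    by move=> x y /=; rewrite /dart_link -!(inj_eq dart_code_inj) cR dart_code_flip.
  exact: dart_link_sym.
exists R; split; first split.
- move=> d d'; rewrite cv -(inj_eq val_inj) /= !dart_code_vertex.
  move: rs => /(ball_code dart_code_inj dart_code_lt) /(_ d).
  by move=> /(ball_code dart_code_inj dart_code_lt) /(_ d') /eqP.
- by rewrite nv nf nl; apply/eqP.
case/orP: common => [/bexP[k hk /bexP[k' hk' /and3P[e1 e2 e3]]] _|/andP[ne hcol] hst].
  have [d ed] := code_ex dart_code_inj dart_code_lt hk.
  have [d' ed'] := code_ex dart_code_inj dart_code_lt hk'.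
  exists d, d'; rewrite -ed in e1 e3; rewrite -ed' in e2 e3.
  split; last by rewrite cfc.
    by apply: val_inj; rewrite /= dart_code_vertex; apply/eqP.
  by apply: val_inj; rewrite /= dart_code_vertex; apply/eqP.
case/eqP: ne; apply: (@connect_label _ (@adjacent G) _ (fun v => col v)) hst.
move=> u v /existsP[[e b] /andP[/eqP <- /eqP <-]].
have /eqP := ballP _ _ hcol e (ltn_ord e).
by rewrite /dart_vertex /=; case: b; rewrite /= tlE hdE.
Qed.

(** The bounds ensure that all entries fit into the certificate table and vanish outside their
    range, so that [clip] returns the functions themselves. *)
Lemma planar_complete : planar_with_common_face s t ->
  exists rot rv hv rf hf rl hl col,
  planar_check (nb_edges G) tl hd s t rot rv hv rf hf rl hl col /\
  forall k, let b := (k < (nb_edges G).*2) * (nb_edges G).*2 in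
    [/\ [/\ rot k <= b, rv k <= b & hv k <= b], [/\ rf k <= b, hf k <= b & rl k <= b],
      hl k <= b & col k <= (k < nb_vertices G)].
Proof.
case=> R [[rs euler] common].
pose rot := extend dart_code (fun d => dart_code (R d)).
have cR d : dart_code (R d) = rot (dart_code d) by rewrite /rot extendE //; exact: dart_code_inj.
have faceI : injective (face_step R).
  by move=> d d' /perm_inj [h3 h4]; rewrite (surjective_pairing d) h3 (negb_inj h4) -surjective_pairing.
have ev x y : frel R x y = (rot (dart_code x) == dart_code y).
  by rewrite /= -(inj_eq dart_code_inj) cR.
have ef x y : frel (face_step R) x y = (rot (flp (dart_code x)) == dart_code y).
  by rewrite /= -(inj_eq dart_code_inj) cR dart_code_flip.
have el x y : dart_link R x y = (rot (dart_code x) == dart_code y) || (flp (dart_code x) == dart_code y).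
  by rewrite /dart_link -!(inj_eq dart_code_inj) cR dart_code_flip.
have sv := fconnect_sym (@perm_inj _ R).
have sf := fconnect_sym faceI.
have sl := @dart_link_sym _ R.
have [rv [hv [lv bv]]] := labelled_complete dart_code_inj dart_code_lt (e := fun k k' => rot k == k') ev sv.
have [rf [hf [lf bf]]] := labelled_complete dart_code_inj dart_code_lt (e := fun k k' => rot (flp k) == k') ef sf.
have [rl [hl [ll bl]]] := labelled_complete dart_code_inj dart_code_lt
  (e := fun k k' => (rot k == k') || (flp k == k')) el sl.
have [nv cv] := labelled_sound dart_code_inj dart_code_lt (e := fun k k' => rot k == k') ev sv lv.
have [nf cfc] := labelled_sound dart_code_inj dart_code_lt (e := fun k k' => rot (flp k) == k') ef sf lf.
have [nl _] := labelled_sound dart_code_inj dart_code_lt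
  (e := fun k k' => (rot k == k') || (flp k == k')) el sl ll.
pose col k : nat := if insub k is Some v then connect (@adjacent G) s v : nat else 0.
have colE (v : vertex G) : col v = connect (@adjacent G) s v by rewrite /col valK.
exists rot, rv, hv, rf, hf, rl, hl, col; split; last first.
  move=> k; rewrite -card_dart; have [b1 b2] := bv k; have [b3 b4] := bf k; have [b5 b6] := bl k.
  split=> //; last by rewrite /col; case: insubP => // v -> _; case: connect.
  by split=> //; apply: extend_le => [d|d]; [exact: dart_code_lt|exact: ltnW (dart_code_lt _)].
rewrite /planar_check -card_dart -/vert -/flp.
apply/and5P; split=> //; last apply/and4P; last split=> //.
- by apply/(ball_code dart_code_inj dart_code_lt) => d; rewrite -cR dart_code_lt.
- apply/(ball_code dart_code_inj dart_code_lt) => d.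
  apply/(ball_code dart_code_inj dart_code_lt) => d'; rewrite -!cR.
  by apply/implyP => /eqP/dart_code_inj/perm_inj ->.
- apply/(ball_code dart_code_inj dart_code_lt) => d.
  apply/(ball_code dart_code_inj dart_code_lt) => d'.
  by rewrite -cv -[connect _ _ _]/(fconnect R d d') rs -(inj_eq val_inj) /= !dart_code_vertex.
- by rewrite -nv -nf -nl; apply/eqP.
case hst: (connect (@adjacent G) s t).
  have [d [d' [e1 e2 e3]]] := common hst.
  apply/orP; left; apply/bexP; exists (dart_code d); first exact: dart_code_lt.
  apply/bexP; exists (dart_code d'); first exact: dart_code_lt.
  apply/and3P; split; last by rewrite -cfc.
    by rewrite -e1 dart_code_vertex eqxx.
  by rewrite -e2 dart_code_vertex eqxx.
apply/orP; right; rewrite !colE connect0 hst /=.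
apply/ballP => e he; pose e' : edge G := Ordinal he.
rewrite -[e]/(nat_of_ord e') -tlE -hdE !colE.
have a b : adjacent (dart_vertex (e', b)) (dart_vertex (flip (e', b))).
  by apply/existsP; exists (e', b); rewrite !eqxx.
suff -> : connect (@adjacent G) s (edge_tail e') = connect (@adjacent G) s (edge_head e') by [].
apply/idP/idP => h; apply: (connect_trans h); apply: connect1; [exact: (a false)|exact: (a true)].
Qed.

End PlanarCheck.

(** * Certificates for instances and flows *)

(** Since [same_sum] tests equalities, inequalities come with slack numbers: [sl] for capacities,
    [bs] for the budget, [ks] for the value. The digit [j == 0] is the 1 of the strict
    inequality. *)
Definition flow_check (S nv ne s t : nat) (tl hd : nat -> nat) (cp cs : nat -> nat -> bool)
    (B k : nat -> bool) (f sl : nat -> nat -> nat) (bs ks : nat -> nat) : bool :=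
  [&& ball ne (fun e => same_sum S (fun j => f e j + sl e j) (fun j => cp e j)),
      ball nv (fun v => [|| v == s, v == t |
        same_sum S (fun j => bsum ne (fun e => (hd e == v) * f e j))
          (fun j => bsum ne (fun e => (tl e == v) * f e j))]),
      same_sum S (fun j => bsum ne (fun e => bex S (fun i => 0 < f e i) * cs e j) + bs j)
        (fun j => B j) &
      same_sum S
        (fun j => bsum ne (fun e => (hd e == s) * f e j) + (k j + ((j == 0) + ks j)))
        (fun j => bsum ne (fun e => (tl e == s) * f e j))].

Lemma flow_checkP S nv ne s t tl hd (cp cs : nat -> nat -> bool) (B k : nat -> bool) f sl bs ks : 0 < S ->
  flow_check S nv ne s t tl hd cp cs B k f sl bs ks <->
  [/\ forall e, e < ne -> value S (f e) + value S (sl e) = value S (fun j => cp e j),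
      forall w, w < nv -> w != s -> w != t ->
        bsum ne (fun e => (hd e == w) * value S (f e)) = bsum ne (fun e => (tl e == w) * value S (f e)),
      bsum ne (fun e => (0 < value S (f e)) * value S (fun j => cs e j)) + value S bs = value S (fun j => B j) &
      bsum ne (fun e => (hd e == s) * value S (f e)) + (value S (fun j => k j) + (1 + value S ks)) =
      bsum ne (fun e => (tl e == s) * value S (f e))].
Proof.
move=> S0.
have sumE (c : nat -> nat) (g : nat -> nat -> nat) :
    value S (fun j => bsum ne (fun e => c e * g e j)) = bsum ne (fun e => c e * value S (g e)).
  by rewrite value_sum; apply: eq_bsum => e; rewrite value_scale.
rewrite /flow_check !same_sumE !value_add !sumE value_one //.
have -> : bsum ne (fun e => bex S (fun i => 0 < f e i) * value S (fun j => cs e j)) =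
    bsum ne (fun e => (0 < value S (f e)) * value S (fun j => cs e j)).
  by apply: eq_bsum => e; rewrite value_gt0.
split=> [/and4P[/ballP h1 /ballP h2 /eqP h3 /eqP h4]|[h1 h2 h3 h4]].
  split=> // [e /h1|w hw ns nt]; first by rewrite same_sumE value_add => /eqP.
  by have := h2 w hw; rewrite (negbTE ns) (negbTE nt) /= same_sumE !sumE => /eqP.
apply/and4P; split; try exact/eqP.
  by apply/ballP => e he; rewrite same_sumE value_add; apply/eqP/h1.
apply/ballP => w hw; case: eqVneq => //= ns; case: eqVneq => //= nt.
by rewrite same_sumE !sumE; apply/eqP/h2.
Qed.

Definition flow_sums (nv ne s t : nat) (tl hd cp cs : nat -> nat) (B k : nat) (f : nat -> nat) : Prop :=
  [/\ forall e, e < ne -> f e <= cp e,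
      forall w, w < nv -> w != s -> w != t ->
        bsum ne (fun e => (hd e == w) * f e) = bsum ne (fun e => (tl e == w) * f e),
      bsum ne (fun e => (0 < f e) * cs e) <= B &
      bsum ne (fun e => (hd e == s) * f e) + k < bsum ne (fun e => (tl e == s) * f e)].

Definition ord_extend n (F : 'I_n -> nat) (k : nat) : nat := if insub k is Some i then F i else 0.

Lemma ord_extendE n (F : 'I_n -> nat) (i : 'I_n) : ord_extend F i = F i.
Proof. by rewrite /ord_extend valK. Qed.

Section Sums.
Variables (X : flow_instance) (tl hd cp cs : nat -> nat).
Hypotheses (tlE : forall e : edge (graph X), edge_tail e = tl e :> nat)
  (hdE : forall e : edge (graph X), edge_head e = hd e :> nat)
  (cpE : forall e : edge (graph X), capacity e = cp e)
  (csE : forall e : edge (graph X), cost e = cs e).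

Lemma nat_yes_sums : nat_yes X <-> exists f, flow_sums (nb_vertices (graph X)) (nb_edges (graph X))
  (source X) (sink X) tl hd cp cs (budget X) (threshold X) f.
Proof.
have hs (f : nat -> nat) (v : vertex (graph X)) :
    \sum_(e : edge (graph X) | edge_head e == v) f e =
    bsum (nb_edges (graph X)) (fun e => (hd e == v) * f e).
  rewrite big_mkcond; apply: eq_bigr => e _; rewrite -hdE.
  by rewrite -(inj_eq val_inj) /=; case: eqP; rewrite ?mul1n.
have ts (f : nat -> nat) (v : vertex (graph X)) :
    \sum_(e : edge (graph X) | edge_tail e == v) f e =
    bsum (nb_edges (graph X)) (fun e => (tl e == v) * f e).
  rewrite big_mkcond; apply: eq_bigr => e _; rewrite -tlE.
  by rewrite -(inj_eq val_inj) /=; case: eqP; rewrite ?mul1n.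
have cc (f : nat -> nat) : \sum_(e : edge (graph X) | 0 < f e) cost e =
    bsum (nb_edges (graph X)) (fun e => (0 < f e) * cs e).
  by rewrite big_mkcond; apply: eq_bigr => e _; rewrite -csE; case: ifP; rewrite ?mul1n.
have main (f : nat -> nat) : [/\ nat_flow (@capacity X) (source X) (sink X) (fun e => f e),
      \sum_(e : edge (graph X) | 0 < f e) cost e <= budget X &
      \sum_(e : edge (graph X) | edge_head e == source X) f e + threshold X <
      \sum_(e : edge (graph X) | edge_tail e == source X) f e] <->
    flow_sums (nb_vertices (graph X)) (nb_edges (graph X)) (source X) (sink X) tl hd cp cs
      (budget X) (threshold X) f.
  rewrite hs ts cc; split=> [[[h1 h2] h3 h4]|[h1 h2 h3 h4]]; split=> //.
  - by move=> e he; have := h1 (Ordinal he); rewrite cpE.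
  - move=> w hw ns nt; have := h2 (Ordinal hw); rewrite hs ts; apply.
      by rewrite -(inj_eq val_inj).
    by rewrite -(inj_eq val_inj).
  - split=> [e|v ns nt]; first by rewrite cpE; apply: h1.
    by rewrite hs ts; apply: h2.
split=> [[f hf]|[f /main hf]]; last by exists (fun e => f e).
exists (ord_extend f); apply/main.
have e : (fun e : edge (graph X) => ord_extend f e) = f.
  by apply/funext => e; rewrite ord_extendE.
move: hf => [h1 h2 h3]; rewrite e; split=> //.
- by under eq_bigl => i do rewrite ord_extendE.
- by under eq_bigr => i _ do rewrite ord_extendE; under [X in _ < X]eq_bigr => i _ do rewrite ord_extendE.
Qed.

End Sums.

Section Certificate.
Variables (planar bounded : bool).

(* The certificate is a table [u], whose row [u 0 0] lists the numbers of
   vertices and edges, the source and the sink. *)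
Definition certificate_stream (u : nat -> nat -> nat -> nat) : seq bool :=
  instance_stream (u 0 0 0) (u 0 0 1) (u 1 0) (u 1 1)
    (fun e => digit_stream (u 2 0 e) (digit_of (u 2 0 e) (u 3 e)))
    (fun e => digit_stream (u 2 1 e) (digit_of (u 2 1 e) (u 4 e)))
    (digit_stream (u 2 2 0) (digit_of (u 2 2 0) (u 5 0))) (u 0 0 2) (u 0 0 3)
    (digit_stream (u 2 2 1) (digit_of (u 2 2 1) (u 5 1))).

(** Without leading zeros, a number is positive exactly when its length is; this is the test on the
    budget. It also makes the encoding canonical. *)
Definition instance_check (u : nat -> nat -> nat -> nat) : bool :=
  [&& u 0 0 2 < u 0 0 0, u 0 0 3 < u 0 0 0, u 0 0 2 != u 0 0 3,
      ball (u 0 0 1) (fun e => (u 1 0 e < u 0 0 0) && (u 1 1 e < u 0 0 0)) &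
   [&& ball (u 0 0 1) (fun e => ball (u 0 0 1) (fun e' =>
         (u 1 0 e == u 1 0 e') && (u 1 1 e == u 1 1 e') ==> (e == e'))),
      0 < u 2 2 0,
      ball (u 0 0 1) (fun e => no_leading_zero (u 2 0 e) (u 3 e) && no_leading_zero (u 2 1 e) (u 4 e)),
      no_leading_zero (u 2 2 0) (u 5 0) & no_leading_zero (u 2 2 1) (u 5 1)]].

Definition number_check (u : nat -> nat -> nat -> nat) (S m : nat) : bool :=
  [&& ball (u 0 0 1) (fun e => at_most S m (digit_of (u 2 0 e) (u 3 e)) &&
        at_most S m (digit_of (u 2 1 e) (u 4 e))),
      at_most S m (digit_of (u 2 2 0) (u 5 0)) & at_most S m (digit_of (u 2 2 1) (u 5 1))].

(** An index beyond the width would read another row of the certificate; such entries count as 0. *)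
Definition clip (S : nat) (g : nat -> nat) (i : nat) : nat := if i < S then g i else 0.

Definition full_check (u : nat -> nat -> nat -> nat) (S m : nat) : bool :=
  [&& instance_check u,
      flow_check S (u 0 0 0) (u 0 0 1) (u 0 0 2) (u 0 0 3) (u 1 0) (u 1 1)
        (fun e => digit_of (u 2 0 e) (u 3 e)) (fun e => digit_of (u 2 1 e) (u 4 e))
        (digit_of (u 2 2 0) (u 5 0)) (digit_of (u 2 2 1) (u 5 1))
        (u 6) (u 7) (u 9 0) (u 9 1),
      planar ==> planar_check (u 0 0 1) (clip S (u 1 0)) (clip S (u 1 1)) (u 0 0 2) (u 0 0 3)
        (clip S (u 8 0)) (clip S (u 8 1)) (clip S (u 8 2)) (clip S (u 8 3)) (clip S (u 8 4))
        (clip S (u 8 5)) (clip S (u 8 6)) (clip S (u 8 7)) &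
      bounded ==> number_check u S m].

(** The two booleans select one of four problems: all instances or the planar ones, with arbitrary
    numbers or with numbers at most the square of the input length. *)
Definition good_instance (X : flow_instance) (x : seq bool) : Prop :=
  [/\ [/\ simple (graph X), 0 < budget X & source X <> sink X], nat_yes X, encode_instance X = x,
      planar -> planar_instance X &
      bounded -> max_number X <= size x * size x].

Lemma check_sound u S x : 0 < S -> (forall a i j, u a i j <= S) ->
  full_check u S (size x * size x) -> x = certificate_stream u -> exists X, good_instance X x.
Proof.
move=> S0 uS /and4P[/and5P[hs ht hst hv /and5P[hsimple hB hcan hcB hck]] hflow hpl hnum] hx.
set nv := u 0 0 0 in hs ht hv hflow; set ne := u 0 0 1 in hv hsimple hcan hflow hpl.
have nv1 : nv.-1.+1 = nv by rewrite prednK //; apply: leq_ltn_trans hs.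
pose cp e := value S (fun j => digit_of (u 2 0 e) (u 3 e) j).
pose cs e := value S (fun j => digit_of (u 2 1 e) (u 4 e) j).
pose B := value S (fun j => digit_of (u 2 2 0) (u 5 0) j).
pose k := value S (fun j => digit_of (u 2 2 1) (u 5 1) j).
have rep l d : no_leading_zero l d -> l <= S -> denotes l d (value S (fun j => digit_of l d j)).
  by move=> /leading_represents h lS; rewrite (denotes_value h lS).
(* [inord] requires a successor as its bound, hence [nv.-1.+1], which equals [nv] by [nv1]. *)
pose X := @FlowInstance (@Digraph nv.-1.+1 ne (fun e => inord (u 1 0 e)) (fun e => inord (u 1 1 e)))
  (fun e => cp e) (fun e => cs e) B (inord (u 0 0 2)) (inord (u 0 0 3)) k.
have sE : source X = u 0 0 2 :> nat by rewrite inordK // nv1.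
have tE : sink X = u 0 0 3 :> nat by rewrite inordK // nv1.
have tlE (e : edge (graph X)) : edge_tail e = u 1 0 e :> nat.
  by have /andP[h _] := ballP _ _ hv e (ltn_ord e); rewrite inordK // nv1.
have hdE (e : edge (graph X)) : edge_head e = u 1 1 e :> nat.
  by have /andP[_ h] := ballP _ _ hv e (ltn_ord e); rewrite inordK // nv1.
have enc : encode_instance X = x.
  rewrite (@encode_instanceE X (u 1 0) (u 1 1) cp cs) // sE tE hx /certificate_stream.
  have -> : u 0 0 0 = nb_vertices (graph X) := esym nv1.
  rewrite /instance_stream !(denotes_stream (rep _ _ _ _)) // /concat.
  congr (_ ++ (_ ++ (flatten _ ++ _))); apply/eq_in_map => e; rewrite mem_iota add0n => he.
  have /andP[c1 c2] := ballP _ _ hcan e he.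
  by rewrite !(denotes_stream (rep _ _ _ _)).
exists X; split=> //.
- split.
  + move=> e e' E; have h1 : edge_tail e = edge_tail e' := congr1 fst E.
    have h2 : edge_head e = edge_head e' := congr1 snd E.
    have /ballP/(_ e' (ltn_ord e'))/implyP h := ballP _ _ hsimple e (ltn_ord e).
    by apply/val_inj/eqP/h; rewrite -!tlE -!hdE h1 h2 !eqxx.
  + have [+ _] := rep _ _ hcB (uS _ _ _); rewrite -/B => h; rewrite /= lt0n; apply/eqP => B0.
    by move: hB; rewrite h B0.
  + by move=> E; case/eqP: hst; rewrite -sE -tE E.
- rewrite (@nat_yes_sums X (u 1 0) (u 1 1) cp cs) //.
  case/flow_checkP: hflow => // h1 h2 h3 h4.
  exists (fun e => value S (u 6 e)); rewrite /flow_sums sE tE; split=> //.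
  + by move=> e /h1 h; rewrite /cp -h leq_addr.
  + by move=> w hw; apply: h2; rewrite -nv1.
  + by rewrite /= /B -h3 leq_addr.
  + by rewrite -h4 /= -/k ltn_add2l add1n addnS ltnS leq_addr.
- move=> pl; move: hpl; rewrite pl /= -sE -tE => hpl.
  have lt (e : edge (graph X)) : e < S := leq_trans (ltn_ord e) (uS _ _ _).
  by apply: (planar_sound (G := graph X) _ _ hpl) => e; rewrite /clip lt.
move=> bd; move: hnum; rewrite bd /= /number_check !at_mostE => /and3P[/ballP h1 h2 h3].
rewrite /max_number !geq_max -/B -/k h2 h3 !andbT.
apply/andP; split; apply/bigmax_leqP => e _; have := h1 e (ltn_ord e); rewrite !at_mostE => /andP[].
  by [].
by [].
Qed.

Lemma size_encode_binary n : up_log 2 n.+1 <= size (encode_binary n).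
Proof.
rewrite encode_binaryE size_cat size_concat /bsum /= sum_nat_const card_ord; lia.
Qed.

Lemma number_lt n : n < 2 ^ size (encode_binary n).
Proof.
apply: (leq_trans (up_logP _ (isT : 1 < 2))).
by rewrite leq_exp2l // size_encode_binary.
Qed.

Lemma up_log_gt0 n : 0 < n -> 0 < up_log 2 n.+1.
Proof. by case: n => // n _; rewrite up_log_gt0. Qed.

(** The width allows [2 * n] digits, enough for a sum of at most [n] numbers below [2 ^ n], and as
    many dart indices; the summand 8 makes room for the eight functions that certify planarity.
    Entries in unary are capped at the width, hence [minn S]. *)
Lemma check_complete S x X : good_instance X x -> (size x).*2 + 8 <= S ->
  exists v : nat -> nat -> nat -> nat, forall u,
    (forall a i j, a < 10 -> i < S -> j < S -> u a i j = minn S (v a i j)) ->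
    full_check u S (size x * size x) /\ x = certificate_stream u.
Proof.
move=> [[hsimple hB hst] hyes enc hpl hbd] hS.
set n := size x in hS hbd *.
set nv := nb_vertices (graph X); set ne := nb_edges (graph X).
pose tl := @ord_extend ne (fun e => @edge_tail (graph X) e); pose hd := @ord_extend ne (fun e => @edge_head (graph X) e).
pose cp := @ord_extend ne (@capacity X); pose cs := @ord_extend ne (@cost X).
have tlE (e : edge (graph X)) : edge_tail e = tl e :> nat by rewrite /tl ord_extendE.
have hdE (e : edge (graph X)) : edge_head e = hd e :> nat by rewrite /hd ord_extendE.
have cpE (e : edge (graph X)) : capacity e = cp e by rewrite /cp ord_extendE.
have csE (e : edge (graph X)) : cost e = cs e by rewrite /cs ord_extendE.
have tl_lt e : e < ne -> tl e < nv by move=> he; rewrite -[e]/(nat_of_ord (Ordinal he)) -tlE.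
have hd_lt e : e < ne -> hd e < nv by move=> he; rewrite -[e]/(nat_of_ord (Ordinal he)) -hdE.
move: hyes; rewrite (nat_yes_sums tlE hdE cpE csE) -/nv -/ne => -[f [h1 h2 h3 h4]].
set s := nat_of_ord (source X) in h2 h3 h4; set t := nat_of_ord (sink X) in h2 h3 h4.
set B := budget X in h3; set k := threshold X in h4.
have encE : x = instance_stream nv ne tl hd (fun e => encode_binary (cp e))
    (fun e => encode_binary (cs e)) (encode_binary B) s t (encode_binary k).
  by rewrite -enc (encode_instanceE tlE hdE cpE csE).
have sizes : [/\ nv + ne <= n, forall e, e < ne -> size (encode_binary (cp e)) <= n,
    forall e, e < ne -> size (encode_binary (cs e)) <= n,
    size (encode_binary B) <= n & size (encode_binary k) <= n].
  have hn : n = size x by []; rewrite encE !size_cat !size_nseq size_concat in hn.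
  have he e : e < ne -> size (encode_binary (cp e)) + size (encode_binary (cs e)) <= n.
    move=> he; rewrite hn /bsum (bigD1 (Ordinal he)) //= !size_cat.
    move: (\sum_(i < ne | _) _) => *; lia.
  split; last first.
  - by rewrite size_cat; lia.
  - by rewrite size_cat; lia.
  - by move=> e /he; apply: leq_trans; rewrite leq_addl.
  - by move=> e /he; apply: leq_trans; rewrite leq_addr.
  - by lia.
case: sizes => hvn hcp hcs hBn hkn.
have S0 : 0 < S by lia.
have small m : m < 2 ^ S -> value S (fun j => odd (m %/ 2 ^ j)) = m.
  by move=> h; rewrite value_digits modn_small.
have lt_n m : size (encode_binary m) <= n -> m < 2 ^ n.
  by move=> h; apply: leq_trans (number_lt m) _; rewrite leq_exp2l.
have n_S m : m < 2 ^ n -> m < 2 ^ S.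
  by move=> h; apply: leq_trans h _; rewrite leq_exp2l //; lia.
have fcp e : e < ne -> f e < 2 ^ n by move=> he; apply: leq_ltn_trans (h1 e he) _; apply/lt_n/hcp.
have out_lt : bsum ne (fun e => (tl e == s) * f e) < 2 ^ S.
  apply: (@leq_ltn_trans (bsum ne (fun=> 2 ^ n))).
    apply: leq_sum => e _; apply: leq_trans (ltnW (fcp e (ltn_ord e))).
    by case: (_ == _); rewrite ?mul1n.
  rewrite /bsum sum_nat_const card_ord; apply: (@leq_trans (2 ^ n * 2 ^ n)).
    rewrite ltn_pmul2r ?expn_gt0 //; apply: leq_ltn_trans (ltn_expl n (isT : 1 < 2)); lia.
  by rewrite -expnD leq_exp2l //; lia.
pose bs := B - bsum ne (fun e => (0 < f e) * cs e).
pose ks := bsum ne (fun e => (tl e == s) * f e) - (bsum ne (fun e => (hd e == s) * f e) + k).+1.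
have [rot [rv [hv [rf [hf [rl [hl [col [hplanar hbound]]]]]]]]] : exists rot rv hv rf hf rl hl col,
    (planar ==> planar_check ne tl hd s t rot rv hv rf hf rl hl col) /\
    forall i, let b := (i < ne.*2) * ne.*2 in
    [/\ [/\ rot i <= b, rv i <= b & hv i <= b], [/\ rf i <= b, hf i <= b & rl i <= b],
      hl i <= b & col i <= (i < nv)].
  case: (planar) hpl => [hpl|_]; last by do 8![exists (fun=> 0)].
  have [rot [rv [hv [rf [hf [rl [hl [col hh]]]]]]]] := planar_complete tlE hdE (hpl isT).
  by exists rot, rv, hv, rf, hf, rl, hl, col.
(* Row group 2 contains lengths, 3 to 5 the digits of capacities, costs, budget and threshold, 6 and
   7 the flow and its slack, 8 the planarity certificate, and the last one the slacks of budget and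
   value. *)
exists (fun a i j => match a with
  | 0 => nth 0 [:: nv; ne; s; t] j
  | 1 => if i == 0 then tl j else hd j
  | 2 => if i == 0 then up_log 2 (cp j).+1 else if i == 1 then up_log 2 (cs j).+1
         else if j == 0 then up_log 2 B.+1 else up_log 2 k.+1
  | 3 => odd (cp i %/ 2 ^ j)
  | 4 => odd (cs i %/ 2 ^ j)
  | 5 => odd ((if i == 0 then B else k) %/ 2 ^ j)
  | 6 => odd (f i %/ 2 ^ j)
  | 7 => odd ((cp i - f i) %/ 2 ^ j)
  | 8 => nth (fun=> 0) [:: rot; rv; hv; rf; hf; rl; hl; col] i j
  | _ => odd ((if i == 0 then bs else ks) %/ 2 ^ j)
  end) => u hu.
have e00 : [/\ u 0 0 0 = nv, u 0 0 1 = ne, u 0 0 2 = s & u 0 0 3 = t].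
  have hs : s < nv := ltn_ord (source X); have ht : t < nv := ltn_ord (sink X).
  by split; rewrite hu //=; lia.
case: e00 => e0 e1 e2 e3.
have hne e : e < ne -> e < S by lia.
have [S1 S2] : 1 < S /\ 2 < S by split; lia.
have tlu e : e < ne -> u 1 0 e = tl e.
  by move=> he; have heS := hne e he; have := tl_lt e he; rewrite hu //=; lia.
have hdu e : e < ne -> u 1 1 e = hd e.
  by move=> he; have heS := hne e he; have := hd_lt e he; rewrite hu //=; lia.
have bit (b : bool) : minn S b = b by case: b; lia.
have lenS m : size (encode_binary m) <= n -> up_log 2 m.+1 <= S.
  by move=> h; apply: leq_trans (size_encode_binary m) _; lia.
have cpR e : e < ne -> denotes (u 2 0 e) (u 3 e) (cp e).
  move=> he; have heS := hne e he; have le := lenS _ (hcp e he).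
  have el : u 2 0 e = up_log 2 (cp e).+1 by rewrite hu //= (minn_idPr le).
  by apply: denotes_digits => // j hj; rewrite hu ?bit //; apply: leq_trans hj _; rewrite el.
have csR e : e < ne -> denotes (u 2 1 e) (u 4 e) (cs e).
  move=> he; have heS := hne e he; have le := lenS _ (hcs e he).
  have el : u 2 1 e = up_log 2 (cs e).+1 by rewrite hu //= (minn_idPr le).
  by apply: denotes_digits => // j hj; rewrite hu ?bit //; apply: leq_trans hj _; rewrite el.
have BR : denotes (u 2 2 0) (u 5 0) B.
  have le := lenS _ hBn.
  have el : u 2 2 0 = up_log 2 B.+1 by rewrite hu //= ?(minn_idPr le) //; lia.
  by apply: denotes_digits => // j hj; rewrite hu ?bit //; apply: leq_trans hj _; rewrite el.
have kR : denotes (u 2 2 1) (u 5 1) k.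
  have le := lenS _ hkn.
  have el : u 2 2 1 = up_log 2 k.+1 by rewrite hu //= ?(minn_idPr le) //; lia.
  apply: denotes_digits => // j hj; rewrite hu ?bit //.
  by apply: leq_trans hj _; rewrite el.
have len l d m : denotes l d m -> size (encode_binary m) <= n -> l <= S.
  by case=> -> _; exact: lenS.
have cpV e : e < ne -> value S (fun j => digit_of (u 2 0 e) (u 3 e) j) = cp e.
  by move=> he; have heS := hne e he; apply: (denotes_value (cpR e he)); apply: (len _ _ _ (cpR e he)); apply: hcp.
have csV e : e < ne -> value S (fun j => digit_of (u 2 1 e) (u 4 e) j) = cs e.
  by move=> he; have heS := hne e he; apply: (denotes_value (csR e he)); apply: (len _ _ _ (csR e he)); apply: hcs.
have BV : value S (fun j => digit_of (u 2 2 0) (u 5 0) j) = B.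
  by apply: (denotes_value BR); apply: (len _ _ _ BR).
have kV : value S (fun j => digit_of (u 2 2 1) (u 5 1) j) = k.
  by apply: (denotes_value kR); apply: (len _ _ _ kR).
have digits a i m : a < 10 -> i < S -> m < 2 ^ S ->
    (forall j, j < S -> u a i j = odd (m %/ 2 ^ j)) -> value S (u a i) = m.
  by move=> _ _ hm h; rewrite -[RHS](small m hm); apply: eq_value.
have fV e : e < ne -> value S (u 6 e) = f e.
  move=> he; have heS := hne e he; apply: digits => //; first exact/n_S/fcp.
  by move=> j hj; rewrite hu //= bit.
have sV e : e < ne -> value S (u 7 e) = cp e - f e.
  move=> he; have heS := hne e he; apply: digits => //.
    by apply: leq_ltn_trans (leq_subr _ _) _; apply/n_S/lt_n/hcp.
  by move=> j hj; rewrite hu //= bit.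
have bV : value S (u 9 0) = bs.
  apply: digits => //; last by move=> j hj; rewrite hu //= bit.
  by apply: leq_ltn_trans (leq_subr _ _) _; apply/n_S/lt_n.
have kV' : value S (u 9 1) = ks.
  apply: digits => //; last by move=> j hj; rewrite hu //= bit.
  by apply: leq_ltn_trans (leq_subr _ _) _.
have eq_in (g h : nat -> nat) : (forall e, e < ne -> g e = h e) -> bsum ne g = bsum ne h.
  by move=> gh; apply: eq_bigr => e _; apply: gh.
have clipE g h : (forall i, i < S -> g i = minn S (h i)) -> (forall i, h i <= (i < S) * S) ->
    clip S g = h.
  move=> h5 h6; apply/funext => i; rewrite /clip; have := h6 i.
  by case: ltnP => hi; rewrite ?h5 //; lia.
split; last first.
  rewrite {1}encE /certificate_stream e0 e1 e2 e3 (denotes_stream BR) (denotes_stream kR).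
  rewrite /instance_stream /concat; congr (_ ++ (_ ++ (flatten _ ++ _))).
  apply/eq_in_map => e; rewrite mem_iota add0n => he.
  by rewrite tlu // hdu // (denotes_stream (cpR e he)) (denotes_stream (csR e he)).
have no_zero l d m := @denotes_leading l d m.
apply/and4P; split.
- rewrite /instance_check e0 e1 e2 e3; apply/and5P; split; first exact: ltn_ord.
  + exact: ltn_ord.
  + by apply/eqP => h; apply: hst; apply: val_inj.
  + by apply/ballP => e he; rewrite tlu // hdu // tl_lt // hd_lt.
  apply/and5P; split; try exact: no_zero BR; try exact: no_zero kR.
  + apply/ballP => e he; apply/ballP => e' he'; rewrite !tlu // !hdu //.
    apply/implyP => /andP[/eqP h5 /eqP h6]; apply/eqP.
    suff : Ordinal he = Ordinal he' :> edge (graph X) by move/(congr1 val).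
    have h7 : edge_tail (Ordinal he : edge (graph X)) = edge_tail (Ordinal he' : edge (graph X)).
      by apply/val_inj/(etrans (tlE (Ordinal he)))/esym/(etrans (tlE (Ordinal he')))/esym.
    have h8 : edge_head (Ordinal he : edge (graph X)) = edge_head (Ordinal he' : edge (graph X)).
      by apply/val_inj/(etrans (hdE (Ordinal he)))/esym/(etrans (hdE (Ordinal he')))/esym.
    by apply: hsimple; rewrite h7 h8.
  + by case: BR => -> _; rewrite up_log_gt0.
  + by apply/ballP => e he; rewrite (no_zero _ _ _ (cpR e he)) (no_zero _ _ _ (csR e he)).
- rewrite e0 e1 e2 e3; apply/flow_checkP => //; split.
  + by move=> e he; rewrite fV // sV // cpV // subnKC // h1.
  + move=> w hw ns nt; have := h2 w hw ns nt => h5.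
    rewrite (eq_in _ (fun e => (hd e == w) * f e)) => [|e he]; last by rewrite hdu // fV.
    by rewrite h5; apply: eq_in => e he; rewrite tlu // fV.
  + rewrite BV bV (eq_in _ (fun e => (0 < f e) * cs e)) => [|e he]; last by rewrite fV // csV.
    by rewrite /bs subnKC.
  + rewrite kV kV' (eq_in _ (fun e => (hd e == s) * f e)) => [|e he]; last by rewrite hdu // fV.
    rewrite [RHS](eq_in _ (fun e => (tl e == s) * f e)) => [|e he]; last by rewrite tlu // fV.
    by rewrite /ks; move: h4; move: (bsum _ _) (bsum _ _) => *; lia.
- move: hplanar; rewrite e1 e2 e3.
  have hD : ne.*2 <= S by lia.
  have hb i : (i < ne.*2) * ne.*2 <= (i < S) * S.
    by case: ltnP => hi //; rewrite mul1n (leq_trans hi hD) mul1n.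
  have -> : clip S (u 1 0) = tl.
    apply: clipE => [i hi|i]; first by rewrite hu //; lia.
    rewrite /tl /ord_extend; case: insubP => // e hi _; rewrite (hne i hi) mul1n.
    by apply: leq_trans (ltnW (ltn_ord _)) _; rewrite -/nv; lia.
  have -> : clip S (u 1 1) = hd.
    apply: clipE => [i hi|i]; first by rewrite hu //; lia.
    rewrite /hd /ord_extend; case: insubP => // e hi _; rewrite (hne i hi) mul1n.
    by apply: leq_trans (ltnW (ltn_ord _)) _; rewrite -/nv; lia.
  have lab k0 (g : nat -> nat) : k0 < 8 -> (forall i, i < S -> u 8 k0 i = minn S (g i)) ->
      (forall i, g i <= (i < ne.*2) * ne.*2) -> clip S (u 8 k0) = g.
    by move=> _ h5 h6; apply: clipE => // i; apply: leq_trans (h6 i) (hb i).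
  rewrite (lab 0 rot) //; try (by move=> i hi; rewrite hu //; lia); try (by move=> i; case: (hbound i) => -[]).
  rewrite (lab 1 rv) //; try (by move=> i hi; rewrite hu //; lia); try (by move=> i; case: (hbound i) => -[]).
  rewrite (lab 2 hv) //; try (by move=> i hi; rewrite hu //; lia); try (by move=> i; case: (hbound i) => -[]).
  rewrite (lab 3 rf) //; try (by move=> i hi; rewrite hu //; lia); try (by move=> i; case: (hbound i) => _ []).
  rewrite (lab 4 hf) //; try (by move=> i hi; rewrite hu //; lia); try (by move=> i; case: (hbound i) => _ []).
  rewrite (lab 5 rl) //; try (by move=> i hi; rewrite hu //; lia); try (by move=> i; case: (hbound i) => _ []).
  rewrite (lab 6 hl) //; try (by move=> i hi; rewrite hu //; lia); try (by move=> i; case: (hbound i) => _ []).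
  rewrite (clipE _ col) // => [i hi|i]; first by rewrite hu //; lia.
  case: (hbound i) => _ _ _ h; apply: leq_trans h _; case: ltnP => hi //.
  by rewrite (_ : i < S) ?mul1n //; lia.
apply/implyP => bd; move: (hbd bd); rewrite /max_number !geq_max -/n => /andP[/andP[/bigmax_leqP m1 /bigmax_leqP m2] /andP[m3 m4]].
rewrite /number_check !at_mostE BV kV m3 m4 e1 !andbT; apply/ballP => e he.
rewrite !at_mostE cpV // csV //; have := m1 (Ordinal he) isT; rewrite cpE => -> /=.
by have := m2 (Ordinal he) isT; rewrite csE.
Qed.

End Certificate.

(** * The verifier and membership in NP *)

Definition width (x : seq bool) : nat := (size x).*2 + 8.

(* The entries of the table are written in unary in the second string. *)
Definition entry (b : seq bool * seq bool) (a i j : nat) : nat :=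
  let S := width b.1 in bsum S (fun d => nth false b.2 (((a * S + i) * S + j) * S + d)).

Lemma entry_le b a i j : entry b a i j <= width b.1.
Proof.
rewrite /entry /bsum -[leqRHS](card_ord (width b.1)) -sum1_card; apply: leq_sum => d _.
by case: nth.
Qed.

Definition certificate (S : nat) (v : nat -> nat -> nat -> nat) : seq bool :=
  mkseq (fun p => p %% S < v (p %/ S %/ S %/ S) (p %/ S %/ S %% S) (p %/ S %% S)) (10 * S * S * S).

Lemma entry_certificate x v a i j : a < 10 -> i < width x -> j < width x ->
  entry (x, certificate (width x) v) a i j = minn (width x) (v a i j).
Proof.
move=> ha hi hj; rewrite /entry /=; set S := width x in hi hj *.
have step m c d : m < c -> d < S -> m * S + d < c * S.
  by move=> h1 h2; apply: (@leq_trans (m.+1 * S)); [rewrite mulSnr ltn_add2l|rewrite leq_mul2r h1 orbT].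
have dv m d : d < S -> (m * S + d) %/ S = m.
  by move=> h; rewrite divnMDl ?divn_small ?addn0 //; lia.
have md m d : d < S -> (m * S + d) %% S = d by move=> h; rewrite modnMDl modn_small.
rewrite -sum_ltn /bsum; apply: eq_bigr => d _.
have hd := ltn_ord d; rewrite nth_mkseq; last by do 3![apply: (step) => //].
by rewrite !dv ?md.
Qed.

Lemma def_entry a I J : definable I -> definable J -> definable (fun r => entry r.1 a (I r) (J r)).
Proof.
move=> hI hJ; apply: (def_bsum (G := fun r d => nth false r.1.2
  (((a * width r.1.1 + I r) * width r.1.1 + J r) * width r.1.1 + d))).
  rewrite /width; def_tac.
apply: def_y; have h1 := def_pop hI; have h2 := def_pop hJ.
by rewrite /width; cbn [fst snd]; def_tac.
Qed.

Ltac check_tac := repeat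
  lazymatch goal with
  | |- definable (fun r => entry _ _ _ _) => eapply def_entry
  | |- _ => def_step
  end.

Lemma def_instance_check : definable (fun r => instance_check (entry r.1)).
Proof. rewrite /instance_check /no_leading_zero; check_tac. Qed.

Lemma def_number_check : definable (fun r => number_check (entry r.1) (width r.1.1) (size r.1.1 * size r.1.1)).
Proof. rewrite /number_check /at_most /digit_of /width; check_tac. Qed.

Lemma def_flow_check : definable (fun r => let u := entry r.1 in
  flow_check (width r.1.1) (u 0 0 0) (u 0 0 1) (u 0 0 2) (u 0 0 3) (u 1 0) (u 1 1)
        (fun e => digit_of (u 2 0 e) (u 3 e)) (fun e => digit_of (u 2 1 e) (u 4 e))
        (digit_of (u 2 2 0) (u 5 0)) (digit_of (u 2 2 1) (u 5 1))
        (u 6) (u 7) (u 9 0) (u 9 1)).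
Proof. rewrite /flow_check /same_sum /digit_of /width; cbv zeta; check_tac. Qed.

Lemma def_planar_check : definable (fun r => let u := entry r.1 in let S := width r.1.1 in
  planar_check (u 0 0 1) (clip S (u 1 0)) (clip S (u 1 1)) (u 0 0 2) (u 0 0 3)
        (clip S (u 8 0)) (clip S (u 8 1)) (clip S (u 8 2)) (clip S (u 8 3)) (clip S (u 8 4))
        (clip S (u 8 5)) (clip S (u 8 6)) (clip S (u 8 7))).
Proof. rewrite /planar_check /labelled /clip /width; cbv zeta; check_tac. Qed.

Lemma def_stream_check : definable (fun r => r.1.1 == certificate_stream (entry r.1)).
Proof.
apply: def_eqs defs_x _.
apply: (@defs_instance_stream _ _ (fun r => entry r.1 1 0) (fun r => entry r.1 1 1)
  (fun r e => digit_stream (entry r.1 2 0 e) (digit_of (entry r.1 2 0 e) (entry r.1 3 e)))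
  (fun r e => digit_stream (entry r.1 2 1 e) (digit_of (entry r.1 2 1 e) (entry r.1 4 e)))
  (fun r => digit_stream (entry r.1 2 2 0) (digit_of (entry r.1 2 2 0) (entry r.1 5 0)))
  _ _ (fun r => digit_stream (entry r.1 2 2 1) (digit_of (entry r.1 2 2 1) (entry r.1 5 1))));
  cbn [fst snd]; try (by check_tac).
- apply: (defs_digit_stream (g := fun r => digit_of (entry r.1 2 0 (head 0 r.2)) (entry r.1 3 (head 0 r.2)))).
    by check_tac.
  by rewrite /digit_of; cbn [fst snd]; check_tac.
- apply: (defs_digit_stream (g := fun r => digit_of (entry r.1 2 1 (head 0 r.2)) (entry r.1 4 (head 0 r.2)))).
    by check_tac.
  by rewrite /digit_of; cbn [fst snd]; check_tac.
- apply: (defs_digit_stream (g := fun r => digit_of (entry r.1 2 2 0) (entry r.1 5 0))).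
    by check_tac.
  by rewrite /digit_of; cbn [fst snd]; check_tac.
- apply: (defs_digit_stream (g := fun r => digit_of (entry r.1 2 2 1) (entry r.1 5 1))).
    by check_tac.
  by rewrite /digit_of; cbn [fst snd]; check_tac.
Qed.

Theorem good_instance_NP planar bounded :
  NP (fun x => exists X, good_instance planar bounded X x).
Proof.
pose V (x y : seq bool) := full_check planar bounded (entry (x, y)) (width x) (size x * size x) &&
  (x == certificate_stream (entry (x, y))).
(* The certificate has 10 times the cube of [width x] bits. With base [size x + 2], exponent 4
   covers the factor 10 and exponent 3 each factor [width x]. *)
exists V, (poly_of 13); split.
  apply: (@polytime_relation_def (fun r => full_check planar bounded (entry r.1) (width r.1.1)
    (size r.1.1 * size r.1.1) && (r.1.1 == certificate_stream (entry r.1)))).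
  apply: def_and def_stream_check; rewrite /full_check.
  apply: def_and def_instance_check _; apply: def_and def_flow_check _.
  apply: def_and; apply: def_imp.
  - exact: def_const.
  - exact: def_planar_check.
  - exact: def_const.
  - exact: def_number_check.
move=> x; have w0 : 0 < width x by rewrite /width addn_gt0 orbT.
split=> [[X hX]|[y _ /andP[h /eqP hx]]]; last first.
  exact: (@check_sound _ _ (entry (x, y)) (width x)) w0 (entry_le _) h hx.
have [v hv] := check_complete hX (leqnn (width x)).
exists (certificate (width x) v).
  rewrite size_mkseq poly_ofE /width; move: (size x) => n.
  have h3 : n.*2 + 8 <= n.+2 ^ 3.
    apply: (@leq_trans (4 * n.+2)); first by lia.
    by rewrite [in leqRHS]expnSr leq_mul // (@leq_trans (2 ^ 2)) // leq_exp2r.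
  have h4 : 10 <= n.+2 ^ 4 by apply: (@leq_trans (2 ^ 4)) => //; rewrite leq_exp2r.
  rewrite (_ : 13 = 4 + 3 + 3 + 3) // !expnD.
  by do 3![apply: leq_mul => //].
have [h1 h2] := hv (entry (x, certificate (width x) v)) (fun a i j ha hi hj => entry_certificate v ha hi hj).
by rewrite /V h1 -h2 eqxx.
Qed.

(** * NP-completeness of the four versions *)

Lemma NP_ext (L L' : language) : (forall x, L x <-> L' x) -> NP L -> NP L'.
Proof. by move=> h [V [q [hV hL]]]; exists V, q; split=> // x; rewrite -h. Qed.

Lemma yes_language_NP (R : realType) (planar bounded : bool) (D : flow_instance -> Prop) :
  (forall X, [/\ planar -> planar_instance X &
    bounded -> max_number X <= size (encode_instance X) * size (encode_instance X)] <-> D X) ->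
  NP (yes_language (restrict (P := flow_improvement R) D)).
Proof.
move=> hD; apply: NP_ext (good_instance_NP planar bounded) => x; split.
  case=> X [hI hy enc hp hb]; exists X; split=> //; last first.
    by case: hI => _ _ hst; apply/(is_yesP R hst).
  by split=> //; apply/hD; split=> //; rewrite enc.
case=> X [[hI /hD[hp hb]] hy enc]; exists X; rewrite -enc; split=> //.
by case: hI => _ _ hst; apply/(is_yesP R hst).
Qed.

Lemma reduces_to_flow (R : realType) (D : flow_instance -> Prop) :
  (forall N Q M A, 0 < N -> N <= Q -> D (grid_instance N Q M A)) ->
  forall L, NP L -> reduces_to L (restrict (P := flow_improvement R) D).
Proof.
move=> hD L /NP_hitting_set[N [Q [m [A [[hN hQ hm] hA hpos hL]]]]].
exists (fun x => encode_instance (grid_instance (N x) (Q x) (m x) (A x))).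
  exact: polytime_function_def (defs_grid hN hQ hm hA).
move=> x; exists (grid_instance (N x) (Q x) (m x) (A x)).
case/andP: (hpos x) => N0 NQ; have hI := grid_is_instance (m x) (A x) N0 NQ R.
split=> //; first by split=> //; exact: hD.
case: hI => _ _ hst; rewrite hL -grid_instanceP //.
exact: iff_sym (is_yesP R hst).
Qed.

(** Identifies the iterated restrictions in the definition of strong NP-completeness with the single
    restriction of [NP_complete_flow]. *)
Lemma NP_complete_ext (T : Type) (enc : T -> seq bool) (num num' : T -> nat)
    (D D' yes : T -> Prop) : (forall I, D I <-> D' I) ->
  NP_complete (DecisionProblem enc num D yes) -> NP_complete (DecisionProblem enc num' D' yes).
Proof.
move=> h [h1 h2]; split.
  by apply: NP_ext h1 => x; split=> -[I [hI hy e]]; exists I; split=> //; apply/h.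
move=> L /h2[f pf hf]; exists f => // x; have [I [hI e hL]] := hf x.
by exists I; split=> //; apply/h.
Qed.

(** Hardness is the same in all four cases, since the grid instances are both planar and bounded. *)
Lemma NP_complete_flow (R : realType) (planar bounded : bool) (D : flow_instance -> Prop) :
  (forall X, D X <-> [/\ planar -> planar_instance X &
    bounded -> max_number X <= size (encode_instance X) * size (encode_instance X)]) ->
  NP_complete (restrict (P := flow_improvement R) D).
Proof.
move=> hD; split; first by apply: (@yes_language_NP R planar bounded) => X; rewrite hD.
apply: reduces_to_flow => N Q M A N0 NQ; apply/hD; split=> _; first exact: grid_planar.
by rewrite mulnn; exact: grid_numbers.
Qed.

Theorem theorem2 (R : realType) :
  strongly_NP_complete (flow_improvement R) /\
  strongly_NP_complete
    (restrict (P := flow_improvement R) planar_instance).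
Proof.
have sq n : (('X ^+ 2 : {poly nat}).[n])%R = n * n by rewrite hornerXn GRing.expr2.
have both := NP_complete_flow R.
(* Both claims of strong NP-completeness use the polynomial of [grid_numbers]; four claims of
   NP-completeness remain. *)
split; split; try exists ('X ^+ 2)%R.
- apply: NP_complete_ext (both false false (fun=> True) _) => X; last by split.
  by split=> [[]|].
- apply: NP_complete_ext (both false true _ (fun X => iff_refl _)) => X.
  by rewrite /= sq; split=> [[hI [_ h]]|[hI h]]; split=> //; exact: h.
- by apply: both true false _ _ => X; split=> [h|[h _]]; [split|exact: h].
apply: NP_complete_ext (both true true _ (fun X => iff_refl _)) => X.
by rewrite /= sq; split=> [[hI [h h']]|[[hI h] h']]; split=> //; [split=> //; exact: h|exact: h'].
Qed.
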